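(* Let $0<\alpha<1$ and $G,M>0$, and let $A,B,V,\zeta,\chi_{\mathrm{CGMY}}$ be as in the context. Suppose that $T_R$ is a quantile clock with parameters $(R,L)$, such that there exists a positive random variable $Y$ independent of $R$ satisfying $RY\stackrel{d}{=}U^{1/\delta}$ for some $\delta>0$ ($U$ uniform on $[0,1]$). Let $\widehat W_A$ be a Brownian motion with drift $A$ independent of $T_R$. If the subordinator $L$ is chosen such that its Lévy density is $$\rho_L(s)=(1+\alpha/\delta)\frac{c_\alpha2^\alpha\Gamma(\alpha)}{\Gamma(2\alpha)}s^{-\alpha-1}\mathbb{E}[e^{-sV/Y_\alpha}]+\frac{c_\alpha2^\alpha\Gamma(\alpha)}{\delta\,\Gamma(2\alpha)}s^{-\alpha}\mathbb{E}\big[(V/Y_\alpha)e^{-sV/Y_\alpha}\big],$$ where $c_\alpha=\mathbb{E}[Y^\alpha]$ and $Y_\alpha$ is a random variable, independent of $V$, whose distribution is proportional to $y^\alpha F_Y(dy)$, then for each fixed $t$, $$\widehat W_A(T_R(t))\stackrel{d}{=}\chi_{\mathrm{CGMY}}(t).$$ When $Y=1$, $L=Z$ with $$\rho_Z(s)=(1+\alpha/\delta)\rho_\zeta(s)+\frac{2^\alpha\Gamma(\alpha)}{\delta\,\Gamma(2\alpha)}s^{-\alpha}\mathbb{E}[Ve^{-sV}].$$ Moreover $\mathbb{E}[V^\alpha]$ is finite only if $\alpha<1/2$; hence $s^{-\alpha}\mathbb{E}[(V/Y_\alpha)e^{-sV/Y_\alpha}]$ is the Lévy density of a compound Poisson process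 only in the case where $\alpha<1/2$.
   Context: Let $A=\frac{G-M}{2}$, $B=\frac{G+M}{2}$, and $$V\stackrel{d}{=}\Big(MG+B^2\frac{\gamma_\alpha}{\gamma_{1/2}}\Big)\Big/2,$$ with $\gamma_\alpha,\gamma_{1/2}$ independent gamma variables of scale $1$ and shapes $\alpha,1/2$. $\zeta$ is the driftless subordinator with Lévy density $$\rho_\zeta(s)=\frac{2^\alpha\Gamma(\alpha)}{\Gamma(2\alpha)}e^{(A^2-B^2)s/2}s^{-\alpha-1}\mathbb{E}\Big[e^{-s\frac{B^2}{2}\frac{\gamma_\alpha}{\gamma_{1/2}}}\Big]=\frac{2^\alpha\Gamma(\alpha)}{\Gamma(2\alpha)}s^{-\alpha-1}\mathbb{E}[e^{-sV}].$$ The CGMY process is $\chi_{\mathrm{CGMY}}(t)=\widehat W_A(\zeta(t))$, where $\widehat W_A(t)=W(t)+At$, $W$ a standard Brownian motion independent of $\zeta$; its Lévy density (by a result of Madan and Yor) is $2\,e^{Ax-B|x|}|x|^{-2\alpha-1}$, $x\ne 0$. Quantile clock with parameters $(R,L)$: $R$ is a positive random variable with continuous strictly increasing (on its support) c.d.f. $F_R$ and $\mathbb{E}[R]<\infty$, $Q_R(u)=\inf\{t:F_R(t)\ge u\}$, $L$ is an infinite activity driftless subordinator (infinite total Lévy mass), and $T_R(t)=\int_0^tQ_R((1-s/t)_+)L(ds)$, $t\ge0$, $(a)_+=\max(0,a)$. *)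

(* Defs.v *)
From HB Require Import structures.
From mathcomp Require Export all_boot all_order all_algebra.
From mathcomp Require Export all_classical all_reals all_analysis.

Set Implicit Arguments.
Unset Strict Implicit.
Unset Printing Implicit Defensive.

Export Order.TTheory GRing.Theory Num.Theory.
Export numFieldNormedType.Exports.

#[export] Set Implicit Arguments.
#[export] Unset Strict Implicit.
#[export] Unset Printing Implicit Defensive.

Global Open Scope classical_set_scope.
Global Open Scope ring_scope.

(** Processes are families [X : K -> Omega -> K] of which only the times
    [t >= 0] are used.  Path properties are required for every [omega]. *)

Section laws_and_independence.
Context (K : realType).

(* Measurability is part of equality in law, so that all the probabilities
   below are probabilities of events. *)
Definition eq_in_law d d' (O : measurableType d) (P : probability O K)
    (X : O -> K) (O' : measurableType d') (P' : probability O' K)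
    (X' : O' -> K) : Prop :=
  [/\ measurable_fun setT X, measurable_fun setT X' &
      forall E : set K, measurable E -> P (X @^-1` E) = P' (X' @^-1` E)].

Context d (O : measurableType d) (P : probability O K).

Definition independent2 (X Y : O -> K) : Prop :=
  forall E F : set K, measurable E -> measurable F ->
    P (X @^-1` E `&` Y @^-1` F) = (P (X @^-1` E) * P (Y @^-1` F))%E.

Definition mutually_independent n (X : 'I_n -> O -> K) : Prop :=
  forall E : 'I_n -> set K, (forall i, measurable (E i)) ->
    P (\bigcap_(i in [set: 'I_n]) (X i @^-1` E i)) =
    (\prod_(i < n) P (X i @^-1` E i))%E.

Definition generated (I : Type) (D : set I) (X : I -> O -> K) : set (set O) :=
  <<s [set C | exists2 i, D i & exists2 E, measurable E & C = X i @^-1` E] >>.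

Definition independent_families (I J : Type) (D : set I) (X : I -> O -> K)
    (D' : set J) (Y : J -> O -> K) : Prop :=
  forall E F, generated D X E -> generated D' Y F ->
    P (E `&` F) = (P E * P F)%E.

Definition independent_processes (X Y : K -> O -> K) : Prop :=
  independent_families [set t : K | 0 <= t] X [set t : K | 0 <= t] Y.

Definition independent_increments (X : K -> O -> K) : Prop :=
  forall n (t : nat -> K), 0 <= t 0%N ->
    (forall i j, (i <= j)%N -> t i <= t j) ->
    mutually_independent (fun (i : 'I_n) w => X (t i.+1) w - X (t i) w).

Definition ae_positive (X : O -> K) : Prop := {ae P, forall w, 0 < X w}.

(* Real-valued expectation; it is only used for integrable variables. *)
Definition expect (X : O -> K) : K := fine ('E_P[X]).

End laws_and_independence.

Section processes.
Context (K : realType) d (O : measurableType d) (P : probability O K).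

Record brownian_motion (W : K -> O -> K) : Prop := {
  bm_measurable : forall t : K, 0 <= t -> measurable_fun setT (W t) ;
  bm_start : forall w, W 0 w = 0 ;
  bm_continuous : forall w, {within `[0, +oo[, continuous (W ^~ w)} ;
  bm_indep : independent_increments P W ;
  bm_normal : forall s t : K, 0 <= s < t -> forall E : set K, measurable E ->
    P ((fun w => W t w - W s w) @^-1` E) = normal_prob 0 (Num.sqrt (t - s)) E }.

Definition drifted (W : K -> O -> K) (a : K) (t : K) (w : O) : K :=
  W t w + a * t.

(* Driftless subordinator with Levy measure [nu]. *)
Record subordinator (L : K -> O -> K) (nu : {measure set K -> \bar K}) : Prop := {
  sub_measurable : forall t : K, 0 <= t -> measurable_fun setT (L t) ;
  sub_start : forall w, L 0 w = 0 ;
  sub_nondecreasing : forall w (s t : K), 0 <= s <= t -> L s w <= L t w ;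
  sub_right_continuous : forall w (s : K), 0 <= s -> L ^~ w @ s^'+ --> L s w ;
  sub_indep : independent_increments P L ;
  sub_stationary : forall s t : K, 0 <= s -> 0 <= t ->
    eq_in_law P (fun w => L (s + t) w - L s w) P (L t) ;
  sub_levy_supp : nu `]-oo, 0 : K]%classic = 0%E ;
  sub_levy_int :
    (\int[nu]_(x in `]0%R, +oo[) (Num.min 1%R x)%:E < +oo)%E ;
  sub_laplace : forall t theta : K, 0 <= t -> 0 <= theta ->
    ('E_P[fun w => expR (- (theta * L t w))%R] =
    (expR (- (t * \int[nu]_(x in `]0, +oo[) (1 - expR (- (theta * x))))))%:E)%E }.

Record poisson_process (rate : K) (N : K -> O -> nat) : Prop := {
  pp_measurable : forall t : K, 0 <= t -> measurable_fun setT (N t) ;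
  pp_start : forall w, N 0 w = 0%N ;
  pp_nondecreasing : forall w (s t : K), 0 <= s <= t -> (N s w <= N t w)%N ;
  pp_right_continuous : forall w (s : K), 0 <= s ->
    (fun t => (N t w)%:R : K) @ s^'+ --> ((N s w)%:R : K) ;
  pp_indep : independent_increments P (fun t w => (N t w)%:R) ;
  pp_poisson : forall s t : K, 0 <= s < t -> forall k : nat,
    P [set w | N t w = (N s w + k)%N] = (poisson_pmf (rate * (t - s)) k)%:E }.

Definition compound_poisson (X : K -> O -> K) : Prop :=
  exists (rate : K) (N : K -> O -> nat) (J : nat -> O -> K),
    [/\ 0 < rate, poisson_process rate N,
        (forall i, eq_in_law P (J i) P (J 0%N)),
        (forall n, mutually_independent P (fun i : 'I_n => J i)) &
        independent_families P [set: nat] J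
          [set t : K | 0 <= t] (fun t w => (N t w)%:R) /\
        forall (t : K) w, 0 <= t -> X t w = \sum_(i < N t w) J i w].

End processes.

Section levy_densities.
Context (K : realType).

(* [rho] is a density, on the positive half-line, of the Levy measure [nu]. *)
Definition levy_density (nu : {measure set K -> \bar K}) (rho : K -> K) : Prop :=
  [/\ measurable_fun (`]0, +oo[%classic : set K) rho, (forall s, 0 < s -> 0 <= rho s) &
      forall E : set K, measurable E ->
        nu E = (\int[lebesgue_measure]_(s in E `&` `]0%R, +oo[) (rho s)%:E)%E].

Definition compound_poisson_levy_density (rho : K -> K) : Prop :=
  exists d (O : measurableType d) (P : probability O K) (X : K -> O -> K)
    (nu : {measure set K -> \bar K}),
    [/\ subordinator P X nu, compound_poisson P X & levy_density nu rho].

End levy_densities.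

Section quantile_clocks.
Context (K : realType) d (O : measurableType d) (P : probability O K).

Definition support (X : {RV P >-> K}) : set K :=
  [set x | forall e, 0 < e -> (0 < P (X @^-1` ball x e))%E].

(* The set is bounded below and non-empty for [0 < u < 1], the only values that
   matter in the clock; [inf] returns [0] when it is empty or unbounded. *)
Definition quantile (X : {RV P >-> K}) (u : K) : K :=
  inf [set x | (u%:E <= cdf X x)%E].

Context d' (O' : measurableType d') (P' : probability O' K).

(* [T] is the quantile clock with parameters (R, L); [nu] is the Levy measure
   of [L], and [f] is the path of [L] extended by [L 0 = 0] to negative times,
   as Lebesgue-Stieltjes measures are attached to functions on the whole line. *)
Record quantile_clock (R : {RV P >-> K}) (L : K -> O' -> K)
    (nu : {measure set K -> \bar K}) (T : K -> O' -> K) : Prop := {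
  qc_positive : ae_positive P R ;
  qc_cdf_continuous : continuous (cdf R) ;
  qc_cdf_increasing : forall x y, support R x -> support R y ->
    x < y -> (cdf R x < cdf R y)%E ;
  qc_mean : ('E_P[R] < +oo)%E ;
  qc_subordinator : subordinator P' L nu ;
  qc_infinite_activity : nu setT = +oo%E ;
  qc_integral : forall (t : K) w, 0 <= t ->
    exists2 f : cumulative K K, (forall s, f s = L (Num.max 0 s) w) &
      (T t w)%:E = (\int[lebesgue_stieltjes_measure f]_(s in `]0%R, t])
        (quantile R (Num.max 0 (1 - s / t))%R)%:E)%E }.

End quantile_clocks.
Arguments quantile_clock {K d O} P {d' O'} P' R L nu T.

Section gamma_laws.
Context (K : realType).

Definition Gamma (a : K) : K :=
  \int[lebesgue_measure]_(x in `]0, +oo[) (x `^ (a - 1) * expR (- x)).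

Definition gamma_law d (O : measurableType d) (P : probability O K)
    (a : K) (g : {RV P >-> K}) : Prop :=
  forall E : set K, measurable E ->
    P (g @^-1` E) = (\int[lebesgue_measure]_(x in E `&` `]0%R, +oo[)
      (x `^ (a - 1) * expR (- x) / Gamma a)%:E)%E.

(* The law of [Ya] is proportional to [y `^ a F_Y(dy)]. *)
Definition power_biased d (O : measurableType d) (P : probability O K)
    (Y : {RV P >-> K}) (a : K) d' (O' : measurableType d')
    (P' : probability O' K) (Ya : {RV P' >-> K}) : Prop :=
  exists k : K, forall E : set K, measurable E ->
    P' (Ya @^-1` E) =
    (k%:E * \int[distribution P Y]_(y in E) (y `^ a)%:E)%E.

End gamma_laws.
Arguments gamma_law {K d O} P a g.
Arguments power_biased {K d O} P Y a {d' O'} P' Ya.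

Section cgmy.
Context (K : realType).
Implicit Types alpha G M delta s : K.

Definition cgmyA G M : K := (G - M) / 2.
Definition cgmyB G M : K := (G + M) / 2.

Definition cgmy_const alpha : K := 2 `^ alpha * Gamma alpha / Gamma (2 * alpha).

(* [g] and [h] are the gamma variables of shapes [alpha] and [1/2]. *)
Definition cgmyV G M (O : Type) (g h : O -> K) (w : O) : K :=
  (M * G + cgmyB G M ^+ 2 * (g w / h w)) / 2.

Definition rho_zeta alpha G M d (O : measurableType d) (P : probability O K)
    (g h : O -> K) s : K :=
  cgmy_const alpha * expR ((cgmyA G M ^+ 2 - cgmyB G M ^+ 2) * s / 2)
  * s `^ (- alpha - 1)
  * expect P (fun w => expR (- (s * (cgmyB G M ^+ 2 / 2 * (g w / h w))))).

(* Brownian motion with drift [A] evaluated at the independent driftless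
   subordinator of Levy density [rho_zeta]. *)
Definition cgmy_process alpha G M dg (Og : measurableType dg)
    (Pg : probability Og K) (g h : Og -> K) d (O : measurableType d)
    (P : probability O K) (chi : K -> O -> K) : Prop :=
  exists (zeta W : K -> O -> K) (nu : {measure set K -> \bar K}),
    [/\ subordinator P zeta nu, levy_density nu (rho_zeta alpha G M Pg g h),
        brownian_motion P W, independent_processes P W zeta &
        forall t w, 0 <= t -> chi t w = drifted W (cgmyA G M) (zeta t w) w].

(* [c] stands for the moment E[Y^alpha]. *)
Definition rho_L alpha delta (c : K) d (O : measurableType d)
    (P : probability O K) (V Ya : O -> K) s : K :=
  (1 + alpha / delta) * (c * cgmy_const alpha) * s `^ (- alpha - 1)
    * expect P (fun w => expR (- (s * (V w / Ya w))))
  + c * cgmy_const alpha / delta * s `^ (- alpha)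
    * expect P (fun w => V w / Ya w * expR (- (s * (V w / Ya w)))).

Definition rho_Z alpha delta G M dg (Og : measurableType dg)
    (Pg : probability Og K) (g h : Og -> K) d (O : measurableType d)
    (P : probability O K) (V : O -> K) s : K :=
  (1 + alpha / delta) * rho_zeta alpha G M Pg g h s
  + cgmy_const alpha / delta * s `^ (- alpha)
    * expect P (fun w => V w * expR (- (s * V w))).

End cgmy.

(* Main.v *)
From HB Require Import structures.
Require Import Defs.
From mathcomp Require Import measurable_realfun simple_functions.
From mathcomp Require Import lra ring.

(** For a fixed time [t] the law of a Brownian motion run at an independent
    time depends only on the law of that time, so the first claim amounts to
    [T_R t] and [zeta t] having the same law, that is, the same Laplace transform.

    The clock integrates the deterministic function [Q_R (1 - s / t)] against
    the increments of [L].  Independence and stationarity of the increments give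
    the exponent of [T_R t] as the integral over [0 < s <= t] of
    [psi_L (theta Q_R (1 - s / t))], and the quantile transform turns it into
    [t E (psi_L (theta R))] ([clock_laplace]).  What remains is the identity
    [E (psi_L (theta R)) = psi_zeta theta] ([mean_laplace_exponent]).

    Write [C] for the constant [2 ^ alpha Gamma alpha / Gamma (2 alpha)] and
    [k s x] for the kernel
    [((1 + alpha / delta) s ^ (- alpha - 1) + s ^ (- alpha) x / delta) e ^ (- s x)].
    The density of [L] is [C c_alpha E (k s (V / Y_alpha))], and the factor
    [c_alpha] undoes the bias of [Y_alpha], which leaves
    [C E (Y ^ alpha k s (V / Y))] ([rho_L_mixture]).  The kernel is homogeneous,
    [k (s / r) x = r ^ (1 + alpha) k s (x / r)]; hence [psi_L (theta r)] is
    [C E ((r Y) ^ alpha Psi (V / (r Y)))], where [Psi] is the exponent with Levy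
    density [k] ([laplace_exponent_rho_L]).  After averaging over [r = R] only the
    law of [R Y] matters, which is that of [Z = U ^ (1 / delta)], and
    [E (Z ^ alpha k s (v / Z)) = s ^ (- alpha - 1) e ^ (- s v)], because the
    integrand is the derivative in [u] of
    [s ^ (- alpha - 1) u ^ (1 + alpha / delta) e ^ (- s v u ^ (- 1 / delta))]
    ([integral_mixture_kernel]).  The result is the exponent with Levy density
    [C s ^ (- alpha - 1) E (e ^ (- s V))], the density of [zeta] since
    [A ^ 2 - B ^ 2 = - M G].  When [Y = 1], the mean over [Y] of
    [Y ^ alpha k s (V / Y)] is [k s V], and this is the second claim.

    For the third claim, [V >= b gamma_alpha / gamma_half] in law for some [b > 0], and
    [gamma_half], whose density is of order [x ^ (- 1 / 2)] at the origin, has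
    no finite inverse moment of order [1 / 2] or more.  For the last one, a compound
    Poisson subordinator of rate [lambda] stays at [0] up to time [1] with
    probability at least [e ^ (- lambda)], which bounds its exponent, hence the
    mass of its Levy measure, by [lambda]; and the mass of the density
    [s ^ (- alpha) E (X e ^ (- s X))] is at least [e ^ (- 1) E (X ^ alpha)].  With
    [X = V / Y_alpha] this makes [E (V ^ alpha) = c_alpha E (X ^ alpha)] finite. *)

Import HBNNSimple.

(** * Integration with respect to image laws *)

(** One change of variables behind all that follow: image laws, Levy and gamma
    densities, scaling of Lebesgue measure and power biasing are all measures [nu]
    of this form.  Both sides are limits along simple approximations of [f]. *)
Lemma ge0_integral_density d d' (T : measurableType d) (T' : measurableType d')
    (K : realType) (mu : {measure set T -> \bar K})
    (nu : {measure set T' -> \bar K}) (D : set T) (phi : T -> T') (Z : T -> K) :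
  measurable D -> measurable_fun D phi -> measurable_fun D Z ->
  (forall x, D x -> 0 <= Z x) ->
  (forall E, measurable E ->
    nu E = \int[mu]_(x in D `&` phi @^-1` E) (Z x)%:E)%E ->
  forall f : T' -> \bar K, measurable_fun setT f -> (forall y, 0 <= f y)%E ->
  (\int[nu]_y f y = \int[mu]_(x in D) (f (phi x) * (Z x)%:E))%E.
Proof.
move=> mD mphi mZ Z0 nuE f mf f0.
have mpre E : measurable E -> measurable (D `&` phi @^-1` E).
  by move=> mE; exact: mphi.
pose h := nnsfun_approx measurableT mf.
have cvgh y : EFin (h n y) @[n --> \oo] --> f y.
  exact: (@cvg_nnsfun_approx _ _ _ _ measurableT f mf (fun t _ => f0 t) y I).
have mh n : measurable_fun D (fun x => h n (phi x)).
  by apply: (measurable_comp measurableT) => //; exact: measurable_funP.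
transitivity (limn (fun n => \int[nu]_x (h n x)%:E)%E).
  rewrite -monotone_convergence//.
  - by apply: eq_integral => y _; apply/esym/cvg_lim => //; exact: cvgh.
  - by move=> n; exact/measurable_EFinP/measurable_funP.
  - by move=> n y _; rewrite lee_fin.
  - by move=> y _ m n mn; rewrite lee_fin; exact/lefP/nd_nnsfun_approx.
transitivity (limn (fun n => \int[mu]_(x in D) ((h n (phi x))%:E * (Z x)%:E))%E);
    last first.
  rewrite -monotone_convergence//.
  - apply: eq_integral => x _; apply/cvg_lim => //.
    by apply: cvgeZr; [|exact: cvgh].
  - by move=> n; apply: emeasurable_funM; exact/measurable_EFinP.
  - by move=> n x Dx; rewrite mule_ge0 ?lee_fin ?Z0.
  - move=> x Dx m n mn; rewrite lee_wpmul2r ?lee_fin ?Z0//.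
    exact/lefP/nd_nnsfun_approx.
congr (limn _); apply/funext => n.
transitivity (\int[nu]_t
   (\sum_(y \in range (h n)) (y * \1_(h n @^-1` [set y]) t)%:E))%E.
  by apply: eq_integral => t _; rewrite /= fimfunE -fsumEFin.
rewrite ge0_integral_fsum//; last 2 first.
- by move=> r; apply/measurable_EFinP; exact: measurable_funM.
- by move=> r y _; exact: nnfun_muleindic_ge0.
transitivity (\int[mu]_(x in D) (\sum_(y \in range (h n))
    ((y * \1_(h n @^-1` [set y]) (phi x))%:E * (Z x)%:E)))%E; last first.
  apply: eq_integral => x _.
  rewrite -ge0_mule_fsuml => [|y]; last exact: nnfun_muleindic_ge0.
  by rewrite fsumEFin// -fimfunE.
have mind r : measurable_fun D
    (fun x => (r * \1_(h n @^-1` [set r]) (phi x))%:E)%E.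
  apply/measurable_EFinP; apply: measurable_funM => //.
  by apply: (measurable_comp measurableT) => //; exact: measurable_indic.
rewrite ge0_integral_fsum//; last 2 first.
- by move=> r; apply: emeasurable_funM => //; exact/measurable_EFinP.
- by move=> r x Dx; rewrite mule_ge0 ?lee_fin ?Z0//; exact: nnfun_muleindic_ge0.
apply: eq_fsbigr => r /[!inE] -[t _ <-{r}].
set r := h n t; have r0 : 0 <= r by exact: fun_ge0.
under eq_integral do rewrite EFinM.
rewrite ge0_integralZl//; last by apply/measurable_EFinP; exact: measurable_indic.
under [RHS]eq_integral do rewrite EFinM -muleA.
rewrite ge0_integralZl//; last 2 first.
- apply: emeasurable_funM; last exact/measurable_EFinP.
  apply/measurable_EFinP.
  by apply: (measurable_comp measurableT) => //; exact: measurable_indic.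
- by move=> x Dx; rewrite mule_ge0// lee_fin// Z0.
congr (_ * _)%E; rewrite integral_indic// setIT nuE//.
rewrite [LHS]integral_mkcondr.
apply: eq_integral => x _; rewrite patchE.
rewrite indicE.
have -> : (phi x \in h n @^-1` [set r]) = (x \in phi @^-1` (h n @^-1` [set r])).
  by apply/idP/idP => /[!inE].
by case: ifP => _; rewrite ?mul1e ?mul0e.
Qed.

Lemma probability_preimage_indic (K : realType) d (O : measurableType d)
    (P : probability O K) (X : O -> K) (B : set K) :
  measurable_fun setT X -> measurable B ->
  (P (X @^-1` B) = \int[P]_w (\1_B (X w))%:E)%E.
Proof.
move=> mX mB; rewrite -[X in P X]setIT -integral_indic//.
by rewrite -[X in measurable X]setTI; exact: mX.
Qed.

Lemma integral_probability_cst (K : realType) d (O : measurableType d)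
    (P : probability O K) (c : \bar K) : (\int[P]_w cst c w = c)%E.
Proof.
apply: (etrans (integral_cst P measurableT c)).
by rewrite [X in (_ * X)%E]probability_setT mule1.
Qed.

(** * Criteria for equality in law *)

Section laws.
Context (K : realType).

Lemma eq_in_law_rays d d' (O : measurableType d) (P : probability O K)
    (O' : measurableType d') (P' : probability O' K)
    (X : O -> K) (X' : O' -> K) :
  measurable_fun setT X -> measurable_fun setT X' ->
  (forall b, P (X @^-1` `]b, +oo[) = P' (X' @^-1` `]b, +oo[)) ->
  eq_in_law P X P' X'.
Proof.
move=> mX mX' XX'; split => // E mE.
pose XR : {mfun O >-> K} := HB.pack X (isMeasurableFun.Build _ _ _ _ X mX).
pose XR' : {mfun O' >-> K} := HB.pack X' (isMeasurableFun.Build _ _ _ _ X' mX').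
change (distribution P XR E = distribution P' XR' E).
apply: (measure_unique (@RGenOInfty.G K) (fun n => `](- n%:R), +oo[%classic)) => //.
- exact: RGenOInfty.measurableE.
- move=> _ _ [x ->] [y ->]; exists (Num.max x y).
  by apply/seteqP; split => z /=; rewrite !in_itv/= !andbT gt_max => /andP.
- by move=> i; eexists; reflexivity.
- apply/seteqP; split => // x _; exists (Num.truncn `|x|).+1 => //=.
  rewrite in_itv/= andbT ltrNl (le_lt_trans (ler_norm _))// normrN.
  by rewrite truncnS_gt.
- by move=> _ [x ->]; exact: XX'.
- by move=> n; rewrite (le_lt_trans (probability_le1 _ _))// ltry.
Qed.

Lemma bounded_prob_integrable d (O : measurableType d) (P : probability O K)
    (f : O -> K) (c : K) : measurable_fun setT f -> (forall w, `|f w| <= c) ->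
  P.-integrable setT (EFin \o f).
Proof.
move=> mf fc; apply: (@le_integrable _ _ _ P setT _ _ (EFin \o cst c)) => //.
- exact/measurable_EFinP.
- by move=> w _ /=; rewrite lee_fin (le_trans (fc w))// ler_norm.
- exact: finite_measure_integrable_cst.
Qed.

Lemma bounded_prob_cvg d (O : measurableType d) (P : probability O K)
    (f_ : nat -> O -> K) (f : O -> K) (c : K) :
  (forall n, measurable_fun setT (f_ n)) ->
  (forall n w, `|f_ n w| <= c) ->
  (forall w, f_ n w @[n --> \oo] --> f w) ->
  (\int[P]_w (f_ n w)%:E @[n --> \oo] --> \int[P]_w (f w)%:E)%E.
Proof.
move=> mf_ fc cvf.
have mf : measurable_fun setT f.
  by apply: (measurable_fun_cvg mf_) => w _; exact: cvf.
have [] // := @dominated_convergence _ _ _ P setT measurableT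
  (fun n w => (f_ n w)%:E) (fun w => (f w)%:E) (cst c%:E).
- by move=> n; exact/measurable_EFinP.
- exact/measurable_EFinP.
- by apply: aeW => w _; apply: cvg_EFin; [near=> n|exact: cvf].
- exact: finite_measure_integrable_cst.
- by apply: aeW => w n _; rewrite /= lee_fin.
Unshelve. all: by end_near. Qed.

(** The ramps [min 1 (max 0 (n (x - b)))] increase to the indicator of [x > b]. *)
Lemma eq_in_law_continuous d d' (O : measurableType d) (P : probability O K)
    (O' : measurableType d') (P' : probability O' K)
    (X : O -> K) (X' : O' -> K) :
  measurable_fun setT X -> measurable_fun setT X' ->
  (forall g : K -> K, continuous g -> (forall x, 0 <= g x <= 1)%R ->
    \int[P]_w (g (X w))%:E = \int[P']_w (g (X' w))%:E)%E ->
  eq_in_law P X P' X'.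
Proof.
move=> mX mX' XX'; apply: eq_in_law_rays => // b.
pose g (n : nat) (x : K) : K := Num.min 1 (Num.max 0 (n%:R * (x - b))).
have g01 n x : 0 <= g n x <= 1.
  by rewrite /g le_min ler01 le_max lexx/= ge_min lexx.
have cg n : continuous (g n).
  move=> x; apply: (@continuous_min _ _ (cst 1)
    ((cst 0) \max (fun x => n%:R * (x - b)))); first exact: cvg_cst.
  apply: (@continuous_max _ _ (cst 0)); first exact: cvg_cst.
  by apply: cvgM; [exact: cvg_cst|apply: cvgB; [exact: cvg_id|exact: cvg_cst]].
have gcvg x : g n x @[n --> \oo] --> (\1_(`]b, +oo[%classic : set K) x : K).
  rewrite indicE; have [xb|bx] := leP x b.
    rewrite memNset/= ?in_itv/= ?andbT; last by apply/negP; rewrite -leNgt.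
    apply: cvg_near_cst; near=> n; rewrite /g max_l ?min_r//.
    by rewrite mulr_ge0_le0// subr_le0.
  rewrite mem_set/= ?in_itv/= ?andbT//.
  apply: cvg_near_cst; near=> n; rewrite /g min_l// le_max; apply/orP; right.
  rewrite -ler_pdivrMr ?subr_gt0// mul1r.
  by near: n; exact: nbhs_infty_ger.
have lim d1 (O1 : measurableType d1) (P1 : probability O1 K) (X1 : O1 -> K) :
    measurable_fun setT X1 ->
    (\int[P1]_w (g n (X1 w))%:E @[n --> \oo] --> P1 (X1 @^-1` `]b, +oo[))%E.
  move=> mX1; rewrite probability_preimage_indic//.
  apply: (bounded_prob_cvg (c := 1)) => //.
  - move=> n; apply: measurableT_comp => //.
    by apply: continuous_measurable_fun; exact: cg.
  - by move=> n w; have /andP[? ?] := g01 n (X1 w); rewrite ger0_norm.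
have h := lim _ _ P X mX.
have e : (fun n => \int[P]_w (g n (X w))%:E)%E = (fun n => \int[P']_w (g n (X' w))%:E)%E.
  by apply/funext => n; exact: XX'.
rewrite e in h.
exact: (cvg_unique _ h (lim _ _ P' X' mX')).
Unshelve. all: by end_near. Qed.

Lemma bernoulli_inequality (y : K) m : 0 <= y <= 1 -> 1 - m%:R * y <= (1 - y) ^+ m.
Proof.
move=> /andP[y0 y1]; elim: m => [|m IH]; first by rewrite mul0r subr0 expr0.
have : (1 - m%:R * y) * (1 - y) <= (1 - y) ^+ m * (1 - y).
  by rewrite ler_wpM2r// subr_ge0.
rewrite -exprSr; apply: le_trans.
have : 0 <= m%:R * y * y by rewrite !mulr_ge0.
by rewrite -natr1; nra.
Qed.

(** A double-exponential cut-off.  With [N = n + 1] and [m] of order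
    [N e ^ (N b)], the power [(1 - e ^ (- N x)) ^ m] behaves like
    [e ^ (- m e ^ (- N x))], which tends to [1] when [x > b] and to [0] when
    [x <= b], the boundary included thanks to the factor [N] in [m]. *)
Lemma cvg_laplace_kernel (b x : K) : 0 <= b -> 0 <= x ->
  (1 - expR (- (n.+1%:R * x))) ^+ (Num.truncn (n.+1%:R * expR (n.+1%:R * b))).+1
    @[n --> \oo] --> (\1_(`]b, +oo[%classic : set K) x : K).
Proof.
move=> b0 x0.
pose y n := expR (- (n.+1%:R * x)) : K.
pose m n := (Num.truncn (n.+1%:R * expR (n.+1%:R * b) : K)).+1.
have y01 n : 0 <= y n <= 1.
  by rewrite expR_ge0 /y expR_le1 oppr_le0 mulr_ge0.
have mlt n : n.+1%:R * expR (n.+1%:R * b) < (m n)%:R :> K by exact: truncnS_gt.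
have mle n : (m n)%:R <= n.+1%:R * expR (n.+1%:R * b) + 1 :> K.
  by rewrite /m -natr1 lerD2r truncn_le// mulr_ge0// expR_ge0.
rewrite indicE; have [xb|bx] := leP x b.
  rewrite memNset/= ?in_itv/= ?andbT; last by apply/negP; rewrite -leNgt.
  apply: (@squeeze_cvgr _ _ _ _ (cst 0) harmonic); last 2 first.
  - exact: cvg_cst.
  - exact: cvg_harmonic.
  near=> n; have /andP[y0 y1] := y01 n.
  rewrite exprn_ge0 ?subr_ge0//=.
  have le1 : 1 - y n <= expR (- y n) by exact: expR_ge1Dx.
  apply: (@le_trans _ _ (expR (- y n) ^+ m n)).
    by rewrite lerXn2r// ?nnegrE ?subr_ge0// expR_ge0.
  rewrite -expRM_natl mulrN expRN lef_pV2 ?posrE ?expR_gt0//.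
  apply: (@le_trans _ _ (expR n.+1%:R)).
    by rewrite (le_trans _ (expR_ge1Dx _))// lerDr.
  rewrite ler_expR (@le_trans _ _ (n.+1%:R * expR (n.+1%:R * b) * y n))//.
    rewrite -mulrA -expRD ler_peMr// -expR0 ler_expR -mulrBr.
    by rewrite mulr_ge0// subr_ge0.
  by rewrite ler_wpM2r// ltW.
rewrite mem_set/= ?in_itv/= ?andbT//.
have c0 : 0 < x - b by rewrite subr_gt0.
apply: (@squeeze_cvgr _ _ _ _ (fun n => 1 - 4 / (x - b) ^+ 2 * harmonic n) (cst 1));
    last 2 first.
- rewrite -[X in _ --> X]subr0; apply: cvgB; first exact: cvg_cst.
  rewrite -[X in _ --> X](mulr0 (4 / (x - b) ^+ 2)).
  by apply: cvgM; [exact: cvg_cst|exact: cvg_harmonic].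
- exact: cvg_cst.
near=> n; have /andP[y0 y1] := y01 n.
rewrite exprn_ile1 ?subr_ge0//.
rewrite andbT (le_trans _ (bernoulli_inequality _ (y01 n)))// lerD2l lerN2.
set N : K := n.+1%:R; have N1 : 1 <= N by rewrite ler1n.
have N0 : 0 < N by rewrite (lt_le_trans ltr01).
apply: (@le_trans _ _ ((N * expR (N * b) + 1) * y n)).
  by apply: ler_wpM2r => //; exact: mle.
have -> : (N * expR (N * b) + 1) * y n = N * expR (N * (b - x)) + y n.
  by rewrite mulrDl mul1r -mulrA -expRD -mulrBr.
have yle : y n <= N * expR (N * (b - x)).
  rewrite (@le_trans _ _ (expR (N * (b - x))))//; last by rewrite ler_peMl// expR_ge0.
  by rewrite ler_expR mulrBr lerDr mulr_ge0// ltW.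
apply: (@le_trans _ _ (2 * N * expR (N * (b - x)))).
  by rewrite -[2 * N * _]mulrA mulr_natl mulr2n lerD2l.
rewrite -opprB mulrN expRN.
have h : (N * (x - b)) ^+ 2 / 2 <= expR (N * (x - b)).
  rewrite (le_trans _ (@expR_ge1Dxn _ _ 1 _))//; last by rewrite mulr_ge0 ?ltW.
  by rewrite lerDr.
have h0 : 0 < (N * (x - b)) ^+ 2 / 2 by rewrite divr_gt0// exprn_gt0// mulr_gt0.
apply: (@le_trans _ _ (2 * N * ((N * (x - b)) ^+ 2 / 2)^-1)).
  by rewrite ler_wpM2l ?lef_pV2 ?posrE ?expR_gt0// mulr_ge0// ltW.
rewrite /harmonic/= -/N le_eqVlt; apply/orP; left; apply/eqP.
by field; rewrite !gt_eqF//.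
Unshelve. all: by end_near. Qed.

End laws.

(** * Laplace transforms at integers determine laws on the half-line *)

Section laplace_uniqueness.
Context (K : realType).

(** Expanding one factor [1 - e ^ (- n x)] at a time, the extra factor
    [e ^ (- j x)] being what the induction on [m] needs. *)
Let same_laplace_powers d d' (O : measurableType d) (P : probability O K)
    (O' : measurableType d') (P' : probability O' K)
    (X : O -> K) (X' : O' -> K) :
  measurable_fun setT X -> measurable_fun setT X' ->
  (forall w, 0 <= X w) -> (forall w, 0 <= X' w) ->
  (forall n : nat, \int[P]_w (expR (- (n%:R * X w)))%:E =
                   \int[P']_w (expR (- (n%:R * X' w)))%:E)%E ->
  forall n m j : nat,
  (\int[P]_w ((1 - expR (- (n%:R * X w))) ^+ m * expR (- (j%:R * X w)))%:E =
   \int[P']_w ((1 - expR (- (n%:R * X' w))) ^+ m * expR (- (j%:R * X' w)))%:E)%E.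
Proof.
move=> mX mX' X0 X'0 XX' n.
have mf d1 (O1 : measurableType d1) (X1 : O1 -> K) m (j : nat) : measurable_fun setT X1 ->
    measurable_fun setT
      (fun w => (1 - expR (- (n%:R * X1 w))) ^+ m * expR (- (j%:R * X1 w))).
  move=> mX1; apply: measurable_funM.
    apply: measurable_funX; apply: measurable_funB => //.
    by apply: measurableT_comp => //; apply: measurableT_comp => //; exact: measurable_funM.
  by apply: measurableT_comp => //; apply: measurableT_comp => //; exact: measurable_funM.
have e01 (a : nat) (x : K) : 0 <= x -> 0 <= expR (- (a%:R * x)) <= 1.
  by move=> x0; rewrite expR_ge0 expR_le1 oppr_le0 mulr_ge0.
have int d1 (O1 : measurableType d1) (P1 : probability O1 K) (X1 : O1 -> K) m (j : nat) :
    measurable_fun setT X1 -> (forall w, 0 <= X1 w) ->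
    P1.-integrable setT (fun w =>
      ((1 - expR (- (n%:R * X1 w))) ^+ m * expR (- (j%:R * X1 w)))%:E).
  move=> mX1 X10; apply: (@bounded_prob_integrable _ _ _ _ _ 1); first exact: mf.
  move=> w; have /andP[a0 a1] := e01 n _ (X10 w); have /andP[b0 b1] := e01 j _ (X10 w).
  rewrite ger0_norm ?mulr_ge0 ?exprn_ge0 ?subr_ge0//.
  by rewrite mulr_ile1// ?exprn_ge0 ?exprn_ile1 ?subr_ge0// gerBl.
elim=> [|m IH] j.
  under eq_integral do rewrite expr0 mul1r.
  by under [RHS]eq_integral do rewrite expr0 mul1r.
have step d1 (O1 : measurableType d1) (P1 : probability O1 K) (X1 : O1 -> K) :
    measurable_fun setT X1 -> (forall w, 0 <= X1 w) ->
    (\int[P1]_w ((1 - expR (- (n%:R * X1 w))) ^+ m.+1 * expR (- (j%:R * X1 w)))%:E =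
     \int[P1]_w ((1 - expR (- (n%:R * X1 w))) ^+ m * expR (- (j%:R * X1 w)))%:E -
     \int[P1]_w ((1 - expR (- (n%:R * X1 w))) ^+ m * expR (- ((n + j)%:R * X1 w)))%:E)%E.
  move=> mX1 X10; rewrite -integralB//; [|exact: int|exact: int].
  apply: eq_integral => w _; rewrite -EFinB; congr EFin.
  by rewrite natrD mulrDl opprD expRD exprSr; ring.
by rewrite !step// !IH.
Qed.

(** The approximations of the indicator of [x > b] by [cvg_laplace_kernel] are
    polynomials in [e ^ (- x)], so that they have the same mean under both laws. *)
Lemma eq_in_law_laplace d d' (O : measurableType d) (P : probability O K)
    (O' : measurableType d') (P' : probability O' K)
    (X : O -> K) (X' : O' -> K) :
  measurable_fun setT X -> measurable_fun setT X' ->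
  (forall w, 0 <= X w) -> (forall w, 0 <= X' w) ->
  (forall n : nat, \int[P]_w (expR (- (n%:R * X w)))%:E =
                   \int[P']_w (expR (- (n%:R * X' w)))%:E)%E ->
  eq_in_law P X P' X'.
Proof.
move=> mX mX' X0 X'0 XX'; apply: eq_in_law_rays => // b.
have [b0|b0] := ltP b 0.
  have full d1 (O1 : measurableType d1) (P1 : probability O1 K) (X1 : O1 -> K) :
      (forall w, 0 <= X1 w) -> P1 (X1 @^-1` `]b, +oo[) = 1%E.
    move=> X10; rewrite (_ : _ @^-1` _ = setT) ?probability_setT//.
    by apply/seteqP; split => // w _; rewrite /= in_itv/= andbT (lt_le_trans b0).
  by rewrite !full.
pose m n := (Num.truncn (n.+1%:R * expR (n.+1%:R * b) : K)).+1.
pose f n x : K := (1 - expR (- (n.+1%:R * x))) ^+ m n.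
have lim d1 (O1 : measurableType d1) (P1 : probability O1 K) (X1 : O1 -> K) :
    measurable_fun setT X1 -> (forall w, 0 <= X1 w) ->
    (\int[P1]_w (f n (X1 w))%:E @[n --> \oo] --> P1 (X1 @^-1` `]b, +oo[))%E.
  move=> mX1 X10; rewrite probability_preimage_indic//.
  apply: (bounded_prob_cvg (c := 1)) => //.
  - move=> n; apply: measurable_funX; apply: measurable_funB => //.
    by apply: measurableT_comp => //; apply: measurableT_comp => //; exact: measurable_funM.
  - move=> n w; have : 0 <= expR (- (n.+1%:R * X1 w)) <= 1.
      by rewrite expR_ge0 expR_le1 oppr_le0 mulr_ge0.
    move=> /andP[y0 y1]; rewrite /f ger0_norm ?exprn_ge0 ?subr_ge0//.
    by rewrite exprn_ile1 ?subr_ge0// gerBl.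
  - by move=> w; exact: cvg_laplace_kernel.
have h := lim _ _ P X mX X0.
have e : (fun n => \int[P]_w (f n (X w))%:E)%E = (fun n => \int[P']_w (f n (X' w))%:E)%E.
  apply/funext => n; have := same_laplace_powers mX mX' X0 X'0 XX' n.+1 (m n) 0.
  under eq_integral do rewrite mul0r oppr0 expR0 mulr1.
  by under [X in _ = X -> _]eq_integral do rewrite mul0r oppr0 expR0 mulr1.
rewrite e in h.
exact: (cvg_unique _ h (lim _ _ P' X' mX' X'0)).
Qed.

End laplace_uniqueness.

(** * Independence and products *)

Section independence.
Context (K : realType) d (O : measurableType d) (P : probability O K).

(** Indicators are replaced by the functions [f i] one coordinate at a time: the
    product formula for the first [k] functions, read as a statement about an
    arbitrary event [E k] of the next coordinate, identifies a measure, which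
    can then be integrated against [f k]. *)
Lemma expectation_prod_mutually_independent n (X : 'I_n -> O -> K)
    (f : 'I_n -> K -> K) :
  (forall i, measurable_fun setT (X i)) -> (forall i, measurable_fun setT (f i)) ->
  (forall i x, 0 <= f i x <= 1) -> mutually_independent P X ->
  (\int[P]_w (\prod_(i < n) f i (X i w))%:E =
   \prod_(i < n) \int[P]_w (f i (X i w))%:E)%E.
Proof.
move=> mX mf f01 indep.
pose F k (E : 'I_n -> set K) (i : 'I_n) (x : K) : K := if (i < k)%N then f i x else \1_(E i) x.
have F01 k E i x : 0 <= F k E i x <= 1.
  by rewrite /F; case: ifP => // _; rewrite indicE; case: (_ \in _); rewrite /= ?lexx ler01.
have mF k E i : measurable (E i) -> measurable_fun setT (F k E i).
  by move=> mE; rewrite /F; case: (i < k)%N => //; exact: measurable_indic.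
have mFX k E i : measurable (E i) -> measurable_fun setT (fun w => F k E i (X i w)).
  by move=> mE; apply: measurableT_comp; [exact: mF|exact: mX].
have fin (g : K -> K) i : measurable_fun setT g -> (forall x, 0 <= g x <= 1) ->
    (\int[P]_w (g (X i w))%:E \is a fin_num)%E.
  move=> mg g01; apply: integrable_fin_num => //.
  apply: (@bounded_prob_integrable _ _ _ _ _ 1); first exact: measurableT_comp.
  by move=> w; have /andP[? ?] := g01 (X i w); rewrite ger0_norm.
suff H k : forall E : 'I_n -> set K, (k <= n)%N -> (forall i, measurable (E i)) ->
   (\int[P]_w (\prod_(i < n) F k E i (X i w))%:E =
   \prod_(i < n) \int[P]_w (F k E i (X i w))%:E)%E.
  have := H n (fun=> setT) (leqnn _) (fun=> measurableT).
  under eq_integral do under eq_bigr do rewrite /F ltn_ord.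
  by under [X in _ = X -> _]eq_bigr do under eq_integral do rewrite /F ltn_ord.
(* [F k E] uses [f] below rank [k] and the indicators of [E] from [k] on *)
elim: k => [|k IH] E kn mE.
  rewrite /F/=; pose A := \bigcap_(i in [set: 'I_n]) (X i @^-1` E i).
  have mXE i : measurable (X i @^-1` E i).
    by rewrite -[X in measurable X]setTI; exact: mX.
  have mA : measurable A by apply: fin_bigcap_measurable.
  transitivity (P A).
    rewrite -[A in RHS]setIT -integral_indic//; apply: eq_integral => w _.
    congr EFin; rewrite indicE; have [|] := boolP (w \in A).
      rewrite inE => wA; rewrite big1// => i _.
      by rewrite indicE mem_set//; exact: wA.
    rewrite notin_setE => wA; suff [i Ei] : exists i, ~ E i (X i w).
      by rewrite (bigD1 i)//= indicE memNset// mul0r.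
    by apply/existsNP => h; apply: wA => i _; exact: h.
  rewrite indep//; apply: eq_bigr => i _.
  by rewrite probability_preimage_indic.
pose i0 : 'I_n := Ordinal kn.
pose Z w := \prod_(i < n | i != i0) F k E i (X i w).
have Z0 w : 0 <= Z w by apply: prodr_ge0 => i _; have /andP[] := F01 k E i (X i w).
pose c := fine (\prod_(i < n | i != i0) \int[P]_w (F k E i (X i w))%:E)%E.
have c0 : 0 <= c.
  apply/fine_ge0/prode_ge0 => i _; apply: integral_ge0 => w _.
  by rewrite lee_fin; have /andP[] := F01 k E i (X i w).
have cE : (c%:E = \prod_(i < n | i != i0) \int[P]_w (F k E i (X i w))%:E)%E.
  rewrite fineK//; apply: (big_ind (fun x => x \is a fin_num)) => //.
    by move=> x y fx fy; rewrite fin_numM.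
  by move=> i _; apply: fin => //; exact: mF.
have FS i x : i != i0 -> F k.+1 E i x = F k E i x.
  move=> ii0; rewrite /F ltnS leq_eqVlt; have -> // : (i == k :> nat) = false.
  by apply/negbTE; apply: contra ii0 => /eqP ik; apply/eqP/val_inj.
have F0 x : F k.+1 E i0 x = f i0 x by rewrite /F/= ltnSn.
pose XR : {mfun O >-> K} := HB.pack (X i0) (isMeasurableFun.Build _ _ _ _ (X i0) (mX i0)).
(* [nu] is the image by [X i0] of the measure of density [Z] *)
pose nu := mscale (NngNum c0) (distribution P XR).
have nuE B : measurable B -> (nu B = \int[P]_(w in setT `&` X i0 @^-1` B) (Z w)%:E)%E.
  move=> mB; rewrite setTI.
  pose E' i := if i == i0 then B else E i.
  have mE' i : measurable (E' i) by rewrite /E'; case: ifP.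
  have FE' i x : i != i0 -> F k E' i x = F k E i x.
    by move=> ii0; rewrite /F /E' (negbTE ii0).
  have := IH E' (ltnW kn) mE'.
  under eq_integral => w _.
    rewrite (bigD1 i0)//=.
    under eq_bigr => i ii0 do rewrite FE'//.
    rewrite {1}/F /= ltnn {1}/E' eqxx.
  over.
  rewrite [X in _ = X -> _](bigD1 i0)//=.
  under [X in _ = (_ * X)%E -> _]eq_bigr => i ii0 do
    under eq_integral do rewrite FE'//.
  rewrite -cE => IH'.
  transitivity (c%:E * P (X i0 @^-1` B))%E; first by [].
  transitivity (\int[P]_x (\1_B (X i0 x) * \prod_(i < n | i != i0) F k E i (X i x))%:E)%E.
    rewrite IH' muleC; congr (_ * _)%E.
    rewrite probability_preimage_indic//; apply: eq_integral => w _.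
    by rewrite /F /= ltnn /E' eqxx.
  rewrite [RHS]integral_mkcond; apply: eq_integral => w _; rewrite patchE indicE.
  have -> : (X i0 w \in B) = (w \in X i0 @^-1` B) by apply/idP/idP => /[!inE].
  by case: ifP => _; rewrite ?mul1r ?mul0r.
have mZ : measurable_fun setT Z.
  have -> : Z = (fun w => \prod_(i < n) if i != i0 then F k E i (X i w) else 1).
    by apply/funext => w; rewrite /Z big_mkcond.
  apply: measurable_prod => i _; case: (i != i0); last exact: measurable_cst.
  exact: mFX.
have := @ge0_integral_density _ _ _ _ K P nu setT (X i0) Z measurableT (mX i0)
   mZ (fun w _ => Z0 w) nuE (EFin \o f i0) _ _.
have f0 y : (0 <= (EFin \o f i0) y)%E by rewrite lee_fin; have /andP[] := f01 i0 y.
have mf0 : measurable_fun setT (EFin \o f i0) by exact/measurable_EFinP.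
move=> /(_ mf0 f0).
have -> : (\int[nu]_y (EFin \o f i0) y = c%:E * \int[P]_w (f i0 (X i0 w))%:E)%E.
  rewrite /nu ge0_integral_mscale//; congr (_ * _)%E.
  exact: (ge0_integral_distribution XR).
move=> e.
rewrite [RHS](bigD1 i0)//=.
under [X in (_ * X)%E]eq_bigr => i ii0 do under eq_integral do rewrite FS//.
rewrite -cE muleC.
under [X in (_ * X)%E]eq_integral do rewrite F0.
rewrite [RHS]e; apply: eq_integral => w _.
rewrite (bigD1 i0)//= F0 EFinM; congr (_ * (_)%:E)%E.
by apply: eq_bigr => i ii0; rewrite FS.
Qed.

Lemma ge0_integral_independent2 (X Y : {RV P >-> K}) (f : K * K -> \bar K) :
  independent2 P X Y -> measurable_fun setT f -> (forall z, 0 <= f z)%E ->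
  (\int[P]_w f (X w, Y w) = \int[P]_w \int[P]_w' f (X w, Y w'))%E.
Proof.
move=> indep mf f0.
have mXY : measurable_fun setT (fun w => (X w, Y w)) by exact: measurable_fun_pair.
pose XY : {mfun O >-> (K * K)%type} := HB.pack (fun w => (X w, Y w))
  (isMeasurableFun.Build _ _ _ _ _ mXY).
transitivity (\int[distribution P XY]_z f z)%E.
  by rewrite ge0_integral_distribution.
transitivity (\int[distribution P X \x distribution P Y]_z f z)%E.
  apply: eq_measure_integral => A mA _; apply/esym.
  by apply: product_measure_unique => // B C mB mC; exact: indep.
rewrite fubini_tonelli1// ge0_integral_distribution//.
- apply: eq_integral => w _; rewrite /= /fubini_F ge0_integral_distribution//.
  by apply: measurableT_comp => //; exact: measurable_pair1.
- exact: measurable_fun_fubini_tonelli_F.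
- by move=> y; apply: integral_ge0.
Qed.

End independence.

Lemma ge0_integral_eq_in_law (K : realType) d d' (O : measurableType d)
    (P : probability O K) (O' : measurableType d') (P' : probability O' K)
    (X : O -> K) (X' : O' -> K) (f : K -> \bar K) :
  eq_in_law P X P' X' -> measurable_fun setT f -> (forall x, 0 <= f x)%E ->
  (\int[P]_w f (X w) = \int[P']_w f (X' w))%E.
Proof.
move=> [mX mX' XX'] mf f0.
pose XR : {mfun O >-> K} := HB.pack X (isMeasurableFun.Build _ _ _ _ X mX).
pose XR' : {mfun O' >-> K} := HB.pack X' (isMeasurableFun.Build _ _ _ _ X' mX').
have e1 := @ge0_integral_distribution _ _ _ _ _ P XR f mf f0.
have e2 := @ge0_integral_distribution _ _ _ _ _ P' XR' f mf f0.
transitivity (\int[distribution P XR]_y f y)%E; first by rewrite e1.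
transitivity (\int[distribution P' XR']_y f y)%E; last by rewrite e2.
by apply: eq_measure_integral => A mA _; exact: XX'.
Qed.

(** * Brownian motion at an independent random time *)

Section time_change.
Context (K : realType).

(** Rounding the random time down to the grid of mesh [1 / (n + 1)] leaves
    countably many times, on each of which independence of two variables is
    enough; path continuity removes the rounding. *)
Definition grid_floor n (x : K) : K := (Num.truncn (n.+1%:R * x))%:R / n.+1%:R.
Definition grid_cell n k : set K := `[k%:R / n.+1%:R, k.+1%:R / n.+1%:R[%classic.

Lemma grid_floorE n k x : grid_cell n k x -> grid_floor n x = k%:R / n.+1%:R.
Proof.
rewrite /grid_cell/= in_itv/= => /andP[kx xk]; congr (_%:R / _); apply: truncn_def.
by rewrite -ler_pdivrMl// -ltr_pdivlMl// mulrC kx mulrC xk.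
Qed.

Lemma grid_floor_itv n x : 0 <= x -> grid_floor n x <= x < grid_floor n x + harmonic n.
Proof.
move=> x0; have /truncn_itv/andP[h1 h2] : 0 <= n.+1%:R * x by rewrite mulr_ge0.
rewrite /grid_floor ler_pdivrMr// [x * _]mulrC h1/=.
by rewrite -[X in _ < _ + X]div1r -mulrDl natr1 ltr_pdivlMr// [x * _]mulrC.
Qed.

Lemma grid_cell_truncn n x : 0 <= x -> grid_cell n (Num.truncn (n.+1%:R * x)) x.
Proof.
move=> x0; rewrite /grid_cell/= in_itv/=.
have /truncn_itv/andP[h1 h2] : 0 <= n.+1%:R * x by rewrite mulr_ge0.
by rewrite ler_pdivrMr// ltr_pdivlMr// [x * _]mulrC h1.
Qed.

Context d (O : measurableType d) (P : probability O K) (W : K -> O -> K)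
  (S : O -> K) (a : K).
Hypothesis mW : forall t, 0 <= t -> measurable_fun setT (W t).
Hypothesis mS : measurable_fun setT S.
Hypothesis S0 : forall w, 0 <= S w.
Hypothesis indep : forall t, 0 <= t -> independent2 P (W t) S.

Let mcell n k : measurable (S @^-1` grid_cell n k).
Proof. by rewrite -[X in measurable X]setTI; apply: mS => //; exact: measurable_itv. Qed.

Let cellT n : \bigcup_k (S @^-1` grid_cell n k) = setT.
Proof.
apply/seteqP; split => // w _.
by exists (Num.truncn (n.+1%:R * S w)) => //; exact: grid_cell_truncn.
Qed.

Let trivIset_cell n : trivIset setT (fun k => S @^-1` grid_cell n k).
Proof.
apply/trivIsetP => i j _ _ ij; apply/seteqP; split => // w [/= wi wj].
have := grid_floorE wi; rewrite (grid_floorE wj) => /(congr1 ( *%R^~ n.+1%:R)).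
rewrite !divfK// => /eqP; rewrite eqr_nat => /eqP ji.
by rewrite ji eqxx in ij.
Qed.

Let grid_ge0 n k : 0 <= k%:R / n.+1%:R :> K. Proof. by rewrite divr_ge0. Qed.

Let measurable_drifted t : 0 <= t -> measurable_fun setT (drifted W a t).
Proof. by move=> t0; apply: measurable_funD => //; exact: mW. Qed.

Lemma measurable_time_change_grid n :
  measurable_fun setT (fun w => drifted W a (grid_floor n (S w)) w).
Proof.
rewrite -(cellT n); apply/measurable_fun_bigcup => [k|k]; first exact: mcell.
apply: (eq_measurable_fun (drifted W a (k%:R / n.+1%:R))).
  by move=> w /[!inE] wk; rewrite (grid_floorE wk).
by apply: measurable_funTS; exact: measurable_drifted.
Qed.

(** On each cell the time is constant, and the value of [W] at that time is
    independent of the event that [S] falls in the cell. *)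
Lemma integral_time_change_grid n (g : K -> K) :
  measurable_fun setT g -> (forall x, 0 <= g x) ->
  (\int[P]_w (g (drifted W a (grid_floor n (S w)) w))%:E =
   \sum_(k <oo) \int[P]_w (g (drifted W a (k%:R / n.+1%:R) w))%:E * P (S @^-1` grid_cell n k))%E.
Proof.
move=> mg g0; rewrite -{1}(cellT n) ge0_integral_bigcup//; last 2 first.
- rewrite cellT; apply/measurable_EFinP; apply: measurableT_comp => //.
  exact: measurable_time_change_grid.
- by move=> w _; rewrite lee_fin.
apply: eq_eseriesr => k _; set t := k%:R / n.+1%:R.
have t0 : 0 <= t by exact: grid_ge0.
pose WR : {RV P >-> K} := HB.pack (W t) (isMeasurableFun.Build _ _ _ _ _ (mW t0)).
pose SR : {RV P >-> K} := HB.pack S (isMeasurableFun.Build _ _ _ _ _ mS).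
pose f (z : K * K) : \bar K := (g (z.1 + a * t) * \1_(grid_cell n k) z.2)%:E.
have f0 z : (0 <= f z)%E by rewrite lee_fin mulr_ge0.
have mind : measurable_fun setT (\1_(grid_cell n k) : K -> K).
  by apply: measurable_indic; exact: measurable_itv.
have mf : measurable_fun setT f.
  apply/measurable_EFinP; apply: measurable_funM.
    by apply: measurableT_comp => //; apply: measurable_funD.
  exact: (measurableT_comp mind).
transitivity (\int[P]_w f (WR w, SR w))%E.
  (* on the event that [S] is in the cell, the grid time is the constant [t] *)
  rewrite integral_mkcond; apply: eq_integral => w _.
  rewrite patchE /f /= indicE; have -> : (S w \in grid_cell n k) = (w \in S @^-1` grid_cell n k).
    by apply/idP/idP => /[!inE].
  case: ifPn => [|_]; last by rewrite mulr0.
  by rewrite inE => wk; rewrite (grid_floorE wk) mulr1.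
rewrite ge0_integral_independent2//; last exact: indep.
transitivity (\int[P]_w ((g (drifted W a t w))%:E * P (S @^-1` grid_cell n k)))%E.
  apply: eq_integral => w _.
  rewrite probability_preimage_indic//; last exact: measurable_itv.
  rewrite -ge0_integralZl//; first by apply/measurable_EFinP; exact: (measurableT_comp mind).
  by rewrite lee_fin.
rewrite ge0_integralZr//.
  apply/measurable_EFinP; apply: measurableT_comp => //.
  exact: measurable_drifted.
by move=> w _; rewrite lee_fin.
Qed.

Hypothesis cW : forall w, {within `[0, +oo[, continuous (W ^~ w)}.

Lemma cvg_time_change_grid w :
  drifted W a (grid_floor n (S w)) w @[n --> \oo] --> drifted W a (S w) w.
Proof.
have cvg_grid : grid_floor n (S w) @[n --> \oo] --> S w.
  apply: (@squeeze_cvgr _ _ _ _ (fun n => S w - harmonic n) (cst (S w))).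
  - near=> n; have /andP[h1 h2] := grid_floor_itv n (S0 w).
    by rewrite h1 andbT lerBlDr ltW.
  - by rewrite -[X in _ --> X]subr0; apply: cvgB; [exact: cvg_cst|exact: cvg_harmonic].
  - exact: cvg_cst.
rewrite /drifted; apply: cvgD; last by apply: cvgM => //; exact: cvg_cst.
have Sw : `[0, +oo[%classic (S w) by rewrite /= in_itv/= S0.
have /(_ _ Sw) := (subspace_continuousP _ _).1 (@cW w).
apply: cvg_comp => B; rewrite /within /= => AB.
have := cvg_grid _ AB; rewrite /nbhs/=; apply: filterS => n; apply.
by rewrite in_itv/= andbT grid_ge0.
Unshelve. all: by end_near. Qed.

Lemma measurable_time_change : measurable_fun setT (fun w => drifted W a (S w) w).
Proof.
apply: (measurable_fun_cvg measurable_time_change_grid) => w _.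
exact: cvg_time_change_grid.
Qed.

End time_change.

Lemma independent_processes_marginals (K : realType) d (O : measurableType d)
    (P : probability O K) (X Y : K -> O -> K) (s t : K) :
  independent_processes P X Y -> 0 <= s -> 0 <= t -> independent2 P (X s) (Y t).
Proof.
move=> indep s0 t0 E F mE mF; apply: indep; apply: sub_sigma_algebra.
- by exists s => //; exists E.
- by exists t => //; exists F.
Qed.

Section brownian_time_change.
Context (K : realType) d (O : measurableType d) (P : probability O K)
  d' (O' : measurableType d') (P' : probability O' K)
  (W : K -> O -> K) (W' : K -> O' -> K).
Hypotheses (bW : brownian_motion P W) (bW' : brownian_motion P' W').

Lemma eq_in_law_brownian t : 0 <= t -> eq_in_law P (W t) P' (W' t).
Proof.
move=> t0; split; [exact: (bm_measurable bW)|exact: (bm_measurable bW')|].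
move=> E mE; move: t0; rewrite le_eqVlt => /predU1P[<-|t0].
  have W0 : W 0 = cst 0 by apply/funext => w; rewrite (bm_start bW).
  have W'0 : W' 0 = cst 0 by apply/funext => w; rewrite (bm_start bW').
  rewrite W0 W'0 !preimage_cst; case: ifP => _.
    by rewrite !probability_setT.
  by rewrite !measure0.
have t00 : 0 <= (0 : K) < t by rewrite lexx.
have := bm_normal bW t00 mE; have := bm_normal bW' t00 mE.
rewrite [X in P' (X @^-1` _)](_ : _ = W' t); last first.
  by apply/funext => w; rewrite (bm_start bW') subr0.
rewrite [X in P (X @^-1` _)](_ : _ = W t); last first.
  by apply/funext => w; rewrite (bm_start bW) subr0.
by move=> -> ->.
Qed.

(** The law at an independent time involves only the one-dimensional laws of
    the Brownian motion and the law of the time. *)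
Lemma eq_in_law_brownian_time_change (S : O -> K) (S' : O' -> K) (a : K) :
  eq_in_law P S P' S' -> (forall w, 0 <= S w) -> (forall w, 0 <= S' w) ->
  (forall t, 0 <= t -> independent2 P (W t) S) ->
  (forall t, 0 <= t -> independent2 P' (W' t) S') ->
  eq_in_law P (fun w => drifted W a (S w) w) P' (fun w => drifted W' a (S' w) w).
Proof.
move=> SS' S0 S'0 iS iS'; have [mS mS' SS'E] := SS'.
have mWt := bm_measurable bW; have mWt' := bm_measurable bW'.
apply: eq_in_law_continuous.
- exact: (measurable_time_change _ mWt mS S0 (bm_continuous bW)).
- exact: (measurable_time_change _ mWt' mS' S'0 (bm_continuous bW')).
move=> g cg g01.
have g0 x : 0 <= g x by have /andP[] := g01 x.
have mg : measurable_fun setT g by exact: continuous_measurable_fun.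
have gle1 x : `|g x| <= 1 by rewrite ger0_norm//; have /andP[] := g01 x.
have lim d1 (O1 : measurableType d1) (P1 : probability O1 K) (W1 : K -> O1 -> K)
    (S1 : O1 -> K) : brownian_motion P1 W1 -> measurable_fun setT S1 -> (forall w, 0 <= S1 w) ->
    (\int[P1]_w (g (drifted W1 a (grid_floor n (S1 w)) w))%:E
      @[n --> \oo] --> \int[P1]_w (g (drifted W1 a (S1 w) w))%:E)%E.
  move=> b1 mS1 S10; apply: (bounded_prob_cvg (c := 1)) => // [n|w].
    apply: measurableT_comp => //.
    exact: (measurable_time_change_grid _ (bm_measurable b1) mS1 S10).
  apply: cvg_comp; last exact: cg.
  by apply: cvg_time_change_grid => //; exact: bm_continuous b1.
have h := lim _ _ _ _ _ bW mS S0.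
apply: (cvg_unique _ h) => //.
suff -> : (fun n => \int[P]_w (g (drifted W a (grid_floor n (S w)) w))%:E)%E =
   (fun n => \int[P']_w (g (drifted W' a (grid_floor n (S' w)) w))%:E)%E.
  exact: lim.
apply/funext => n.
rewrite (integral_time_change_grid _ mWt mS S0 iS)//.
rewrite (integral_time_change_grid _ mWt' mS' S'0 iS')//.
apply: eq_eseriesr => k _; rewrite SS'E; last exact: measurable_itv.
congr (_ * _)%E; set t := k%:R / n.+1%:R.
have t0 : 0 <= t by rewrite /t divr_ge0.
apply: (ge0_integral_eq_in_law (f := fun x => (g (x + a * t))%:E) (eq_in_law_brownian t0)).
- by apply/measurable_EFinP; apply: measurableT_comp => //; exact: measurable_funD.
- by move=> x; rewrite lee_fin.
Qed.

End brownian_time_change.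

(** * The quantile transform *)

Section quantile_function.
Context (K : realType) d (O : measurableType d) (P : probability O K)
  (R : {RV P >-> K}).
Hypothesis R0 : ae_positive P R.

Lemma cdf_eq0 x : x <= 0 -> cdf R x = 0%E.
Proof.
move=> x0; apply/eqP; rewrite eq_le cdf_ge0 andbT.
have [N [mN N0 subN]] := R0.
rewrite -N0 [cdf R x](_ : _ = P (R @^-1` `]-oo, x]%classic))//.
apply: le_measure; rewrite ?inE//.
  by rewrite -[X in measurable X]setTI; exact: measurable_funP.
move=> w; rewrite /= in_itv/= => Rx; apply: subN => /=.
by apply/negP; rewrite -leNgt (le_trans Rx).
Qed.

Lemma quantile_ge0 u : 0 <= quantile R u.
Proof.
rewrite /quantile; have [u0|u0] := ltP 0 u.
  have [->|/set0P A0] := eqVneq [set x | (u%:E <= cdf R x)%E] set0; first by rewrite inf0.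
  apply: lb_le_inf => // x /= ux; rewrite leNgt; apply/negP => x0.
  by have : (0 < cdf R x)%E by [rewrite (lt_le_trans _ ux)]; rewrite cdf_eq0 ?ltxx// ltW.
rewrite (_ : [set x | _] = setT) ?inf_out//.
  by move=> [_ [y /(_ (y - 1) I)]]; rewrite leNgt ltrBlDr ltrDl ltr01.
by apply/seteqP; split => // x _ /=; rewrite (le_trans _ (cdf_ge0 R x))// lee_fin.
Qed.

(** The Galois connection between the quantile function and the distribution
    function; attainment of the infimum is right continuity of the latter. *)
Lemma quantile_le u x : 0 < u < 1 -> (quantile R u <= x) = (u%:E <= cdf R x)%E.
Proof.
move=> /andP[u0 u1].
pose A : set K := [set x | (u%:E <= cdf R x)%E].
have A0 : A !=set0.
  have := cvg_cdfy1 R => /(_ [set y | (u%:E < y)%E]) /=.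
  have nb : nbhs 1%E [set y | (u%:E < y)%E].
    by apply: open_nbhs_nbhs; split; [exact: open_ereal_gt_ereal|rewrite /= lte_fin].
  move=> /(_ nb)[y [_ hy]]; exists (y + 1); rewrite /A/=; apply/ltW/hy.
  by rewrite ltrDl.
have lbA : lbound A 0.
  move=> y /= uy; rewrite leNgt; apply/negP => y0.
  by have : (0 < cdf R y)%E by [rewrite (lt_le_trans _ uy)]; rewrite cdf_eq0 ?ltxx// ltW.
have hA : has_inf A by split => //; exists 0.
apply/idP/idP => [qx|ux]; last by apply: ge_inf => //; case: hA.
have h z : x < z -> (u%:E <= cdf R z)%E.
  move=> xz; have [y Ay yz] := inf_lt A0 (le_lt_trans qx xz).
  by rewrite (le_trans Ay)// cdf_nondecreasing// ltW.
rewrite leNgt; apply/negP => xu.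
have nb : nbhs (cdf R x) [set y | (y < u%:E)%E].
  by apply: open_nbhs_nbhs; split; [exact: open_ereal_lt_ereal|].
suff : \forall z \near x^'+, False by move=> /filter_ex[].
have := cdf_right_continuous nb; rewrite /= => hz.
near=> z; suff : (cdf R z < u%:E)%E.
  by rewrite ltNge h//; near: z; exact: nbhs_right_gt.
by near: z; exact: hz.
Unshelve. all: by end_near. Qed.

End quantile_function.

Section clock_quantile.
Context (K : realType) d (O : measurableType d) (P : probability O K)
  (R : {RV P >-> K}) (t : K).
Hypotheses (R0 : ae_positive P R) (t0 : 0 < t).

Definition clock_quantile (s : K) : K := quantile R (Num.max 0 (1 - s / t)).

Lemma clock_quantile_ge0 s : 0 <= clock_quantile s.
Proof. exact: quantile_ge0. Qed.

Lemma cdf_fin x : cdf R x = (fine (cdf R x))%:E.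
Proof. by rewrite fineK// fin_num_measure. Qed.

Lemma fine_cdf_itv x : 0 <= fine (cdf R x) <= 1.
Proof. by rewrite -!lee_fin -cdf_fin cdf_ge0 cdf_le1. Qed.

Lemma clock_quantile_gt s x : 0 < s < t ->
  (x < clock_quantile s) = (s < t * (1 - fine (cdf R x))).
Proof.
move=> /andP[s0 st]; have u01 : 0 < 1 - s / t < 1.
  by rewrite subr_gt0 ltr_pdivrMr// mul1r st/= gtrBl divr_gt0.
rewrite /clock_quantile max_r; last by case/andP: u01 => /ltW.
rewrite ltNge quantile_le// cdf_fin lee_fin -ltNge.
by rewrite ltrBrDr -ltrBrDl ltr_pdivrMr// mulrC.
Qed.

Lemma clock_quantile_out s : t <= s -> clock_quantile s = 0.
Proof.
move=> ts; rewrite /clock_quantile max_l; last by rewrite subr_le0 ler_pdivlMr// mul1r.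
rewrite /quantile (_ : [set x | _] = setT) ?inf_out//.
  by move=> [_ [y /(_ (y - 1) I)]]; rewrite leNgt ltrBlDr ltrDl ltr01.
by apply/seteqP; split => // x _ /=; exact: cdf_ge0.
Qed.

Lemma clock_quantile_lt0 s : s < 0 -> clock_quantile s = 0.
Proof.
move=> s0; have h : 1 < 1 - s / t by rewrite ltrDl oppr_gt0 pmulr_llt0// invr_gt0.
rewrite /clock_quantile max_r; last by rewrite ltW// (lt_trans ltr01).
rewrite /quantile (_ : [set x | _] = set0) ?inf0//.
apply/seteqP; split => // x /=; apply/negP; rewrite -ltNge.
by rewrite (le_lt_trans (cdf_le1 R x))// lte_fin.
Qed.

(** The point [0] is kept apart: the quantile at level [1] depends on whether
    the law of [R] is bounded, and it carries no mass. *)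
Lemma preimage_clock_quantile x : 0 <= x ->
  clock_quantile @^-1` `]x, +oo[ =
  `]0, t * (1 - fine (cdf R x))[%classic `|`
    ([set 0] `&` clock_quantile @^-1` `]x, +oo[).
Proof.
move=> x0; apply/seteqP; split => s /=.
  rewrite !in_itv/= !andbT => xs.
  have [s0|s0|<-] := ltgtP s 0; last by right.
    by move: xs; rewrite clock_quantile_lt0// ltNge x0.
  have [ts|st] := leP t s; first by move: xs; rewrite clock_quantile_out// ltNge x0.
  by left; rewrite -clock_quantile_gt ?s0.
case=> [|[-> //]]; rewrite !in_itv/= andbT => /andP[s0 sc].
rewrite clock_quantile_gt// s0/= (lt_le_trans sc)// ger_pMr//.
by rewrite gerBl; have /andP[] := fine_cdf_itv x.
Qed.

Lemma measurable_set1I (a : K) (A : set K) : measurable ([set a] `&` A).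
Proof.
have [aA|aA] := pselect (A a).
  by rewrite setIidl// => _ ->.
by rewrite (_ : _ `&` _ = set0)//; apply/seteqP; split => // s [->].
Qed.

Lemma measurable_clock_quantile : measurable_fun setT clock_quantile.
Proof.
move=> mT; apply: (measurability _ (@RGenOInfty.measurableE K)) => //.
move=> _ [_ [x ->] <-]; rewrite setTI.
have [x0|x0] := ltP x 0.
  rewrite (_ : _ @^-1` _ = setT)//; apply/seteqP; split => // s _ /=.
  by rewrite in_itv/= andbT (lt_le_trans x0)// clock_quantile_ge0.
rewrite preimage_clock_quantile//; apply: measurableU; first exact: measurable_itv.
exact: measurable_set1I.
Qed.

(** The set where the integrand exceeds [x >= 0] is an interval of length
    [t P (R > x)], up to the point [0]. *)
Lemma clock_quantile_law : eq_in_law (uniform_prob t0) clock_quantile P R.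
Proof.
apply: eq_in_law_rays => //; first exact: measurable_clock_quantile.
move=> x.
have mR : measurable (R @^-1` `]x, +oo[).
  by rewrite -[X in measurable X]setTI; exact: measurable_funP.
have RE : (P (R @^-1` `]x, +oo[) = (1 - fine (cdf R x))%:E)%E.
  rewrite EFinB -cdf_fin [cdf R x](_ : _ = P (R @^-1` `]-oo, x]%classic))//.
  rewrite -probability_setC; last first.
    by rewrite -[X in measurable X]setTI; exact: measurable_funP.
  congr (P _); apply/seteqP; split => w; rewrite /= !in_itv/= andbT.
    by move=> xR; apply/negP; rewrite -ltNge.
  by move=> /negP; rewrite -ltNge.
have [x0|x0] := ltP x 0.
  rewrite RE cdf_eq0 ?ltW//= subr0.
  rewrite (_ : _ @^-1` _ = setT) ?probability_setT//; apply/seteqP; split => // s _ /=.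
  by rewrite in_itv/= andbT (lt_le_trans x0)// clock_quantile_ge0.
have /andP[F0 F1] := fine_cdf_itv x.
rewrite RE preimage_clock_quantile// measureU0//; last 2 first.
- exact: measurable_set1I.
- apply/eqP; rewrite eq_le measure_ge0 andbT.
  apply: (@le_trans _ _ (uniform_prob t0 [set 0])).
    by apply: le_measure; rewrite ?inE//; exact: measurable_set1I.
  have := dominates_uniform_prob t0 => /null_content_dominatesP ->//.
  exact: lebesgue_measure_set1.
transitivity (\int[lebesgue_measure]_(s in `]0%R, (t * (1 - fine (cdf R x)))%R[)
    (t^-1)%:E)%E.
  apply: eq_integral => s /[!inE]/=; rewrite in_itv/= => /andP[s0 sc].
  rewrite /uniform_pdf subr0 ltW//= (ltW (lt_le_trans sc _))//.
  by rewrite ger_pMr// gerBl.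
rewrite integral_cst//= lebesgue_measure_itv/= lte_fin sube0.
have [c0|c0] := ltP 0 (t * (1 - fine (cdf R x))).
  by rewrite -EFinM mulrA mulVf ?mul1r// gt_eqF.
rewrite mule0; congr EFin; apply/esym/eqP; rewrite eq_le subr_ge0 F1 andbT.
by rewrite -(pmulr_rle0 _ t0).
Qed.

(** The half-open interval is the domain of the clock integral, in which
    [clock_quantile] is evaluated at levels below [1]. *)
Lemma ge0_integral_clock_quantile (f : K -> \bar K) :
  measurable_fun setT f -> (forall x, 0 <= f x)%E ->
  (\int[lebesgue_measure]_(s in `]0%R, t]) f (clock_quantile s) =
   t%:E * \int[P]_w f (R w))%E.
Proof.
move=> mf f0; rewrite -(ge0_integral_eq_in_law clock_quantile_law mf f0).
rewrite integral_uniform//; last by apply: measurableT_comp => //; exact: measurable_clock_quantile.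
rewrite subr0 muleA -EFinM mulfV ?gt_eqF// mul1e.
apply: integral_itv_obnd_cbnd; apply: measurable_funTS.
by apply: measurableT_comp => //; exact: measurable_clock_quantile.
Qed.

End clock_quantile.

(** * Riemann sums of the clock integrand *)

Section riemann_sums.
Context (K : realType) (t : K).
Hypothesis t0 : 0 < t.

Definition node n k : K := t * k%:R / n.+1%:R.
Definition cell n k : set K := `]node n k, node n k.+1]%classic.
(** Sampling at the right end of a cell: the nonincreasing integrand to which this
    is applied then dominates its step approximations. *)
Definition step n (G : K -> K) (s : K) : K :=
  \sum_(k < n.+1) G (node n k.+1) * \1_(cell n k) s.

Lemma node_ge0 n k : 0 <= node n k.
Proof. by rewrite /node divr_ge0// mulr_ge0// ltW. Qed.

Lemma le_node n i j : (i <= j)%N -> node n i <= node n j.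
Proof. by move=> ij; rewrite /node ler_pM2r// ler_pM2l// ler_nat. Qed.

Lemma node_last n : node n n.+1 = t.
Proof. by rewrite /node mulfK. Qed.

Lemma nodeS n k : node n k.+1 = node n k + t / n.+1%:R.
Proof. by rewrite /node -natr1 mulrDr mulr1 mulrDl. Qed.

Lemma cell_subset n k : (k < n.+1)%N -> cell n k `<=` `]0, t].
Proof.
move=> kn s; rewrite /cell/= !in_itv/= => /andP[h1 h2].
by rewrite (le_lt_trans (node_ge0 n k) h1) (le_trans h2)// -(node_last n) le_node.
Qed.

Lemma measurable_cell n k : measurable (cell n k).
Proof. exact: measurable_itv. Qed.

Lemma measurable_step n G : measurable_fun setT (step n G).
Proof.
apply: measurable_sum => k; apply: measurable_funM => //.
by apply: measurable_indic; exact: measurable_cell.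
Qed.

Lemma stepE n G k s : (k < n.+1)%N -> cell n k s -> step n G s = G (node n k.+1).
Proof.
move=> kn ks; rewrite /step (bigD1 (Ordinal kn))//= indicE mem_set// mulr1.
rewrite big1 ?addr0// => i /eqP ik; rewrite indicE memNset ?mulr0// => is_.
apply: ik; apply/val_inj => /=; move: ks is_; rewrite /cell/= !in_itv/=.
move=> /andP[h1 h2] /andP[h3 h4]; apply/eqP; rewrite eqn_leq; apply/andP; split.
  rewrite leqNgt; apply/negP => /(le_node n) h.
  by have := lt_le_trans h3 (le_trans h2 h); rewrite ltxx.
rewrite leqNgt; apply/negP => /(le_node n) h.
by have := lt_le_trans h1 (le_trans h4 h); rewrite ltxx.
Qed.

Lemma cell_cover n s : 0 < s <= t -> exists2 k, (k < n.+1)%N & cell n k s.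
Proof.
move=> /andP[s0 st].
have ex : exists j, s <= node n j by exists n.+1; rewrite node_last.
case: (ex_minnP ex) => -[|k] sk kmin.
  by move: sk; rewrite /node mulr0 mul0r leNgt s0.
exists k; first by apply: kmin; rewrite node_last.
rewrite /cell/= in_itv/= sk andbT ltNge; apply/negP => /kmin.
by rewrite ltnn.
Qed.

Lemma step_node n s : 0 < s <= t -> exists2 r, s <= r <= t & r < s + t / n.+1%:R /\
  forall G, step n G s = G r.
Proof.
move=> /(cell_cover n)[k kn ks]; exists (node n k.+1).
  by move: ks; rewrite /cell/= in_itv/= => /andP[_ ->]/=; rewrite -[leRHS](node_last n) le_node.
split; last by move=> G; exact: stepE.
by move: ks; rewrite /cell/= in_itv/= nodeS ltrD2r => /andP[].
Qed.

Lemma integral_step (mu : {measure set (measurableTypeR K) -> \bar K}) n G : (forall s, 0 <= G s) ->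
  (\int[mu]_(s in `]0%R, t]) (step n G s)%:E =
   \sum_(k < n.+1) (G (node n k.+1))%:E * mu (cell n k))%E.
Proof.
move=> G0; under eq_integral do rewrite /step -sumEFin.
rewrite ge0_integral_sum//; last 2 first.
- move=> k; apply/measurable_EFinP; apply: measurable_funM => //.
  by apply: measurable_indic; exact: measurable_cell.
- by move=> k s _; rewrite lee_fin mulr_ge0.
apply: eq_bigr => k _; under eq_integral do rewrite EFinM.
rewrite ge0_integralZl//; last 2 first.
- by apply/measurable_EFinP; apply: measurable_indic; exact: measurable_cell.
- by rewrite lee_fin.
rewrite integral_indic//; last exact: measurable_cell.
by rewrite setIidl//; exact: cell_subset.
Qed.

End riemann_sums.

Section clock_quantile_riemann_sums.
Context (K : realType) d (O : measurableType d) (P : probability O K)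
  (R : {RV P >-> K}) (t : K).
Hypotheses (R0 : ae_positive P R) (t0 : 0 < t).
Let q := clock_quantile R t.

Lemma clock_quantile_nonincreasing s r : 0 < s -> s <= r -> q r <= q s.
Proof.
move=> s0 sr; have [tr|rt] := leP t r.
  by rewrite /q clock_quantile_out// clock_quantile_ge0.
rewrite leNgt; apply/negP => h.
have r01 : 0 < r < t by rewrite rt (lt_le_trans s0).
have s01 : 0 < s < t by rewrite s0 (le_lt_trans sr).
have : q s < q s by rewrite {2}/q clock_quantile_gt// (le_lt_trans sr)// -clock_quantile_gt.
by rewrite ltxx.
Qed.

Lemma step_clock_quantile_le n s : 0 < s <= t -> 0 <= step t n q s <= q s.
Proof.
move=> s0t; have [r /andP[sr rt] [_ ->]] := step_node t0 n s0t.
rewrite clock_quantile_ge0//= clock_quantile_nonincreasing//.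
by case/andP: s0t.
Qed.

(** The quantile function is left continuous, hence its reflection is right
    continuous, and the nodes approach [s] from the right. *)
Lemma cvg_step_clock_quantile s : 0 < s <= t ->
  step t n q s @[n --> \oo] --> q s.
Proof.
move=> s0t; have /andP[s0 st] := s0t.
have [{}st|ts] := ltP s t; last first.
  have -> : q s = 0 by exact: clock_quantile_out.
  apply: cvg_near_cst; near=> n; have := step_clock_quantile_le n s0t.
  by rewrite [q s]clock_quantile_out// -eq_le eq_sym => /eqP.
apply/cvgrPdist_lt => e e0.
have h : q s - e < q s by rewrite ltrBlDr ltrDl.
have sc : s < t * (1 - fine (cdf R (q s - e))).
  by rewrite -clock_quantile_gt// s0.
have cvr : s + t / n.+1%:R @[n --> \oo] --> s.
  rewrite -[X in _ --> X]addr0; apply: cvgD; first exact: cvg_cst.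
  by rewrite -[X in _ --> X](mulr0 t); apply: cvgM; [exact: cvg_cst|exact: cvg_harmonic].
have near1 := cvgr_lt _ cvr _ sc.
near=> n.
have /andP[h0 h1] := step_clock_quantile_le n s0t.
rewrite ger0_norm ?subr_ge0// ltrBlDr -ltrBlDl.
have [r /andP[sr rt] [rs ->]] := step_node t0 n s0t.
have rc : r < t * (1 - fine (cdf R (q s - e))).
  by rewrite (lt_trans rs)//; near: n; exact: near1.
rewrite clock_quantile_gt// (lt_le_trans s0 sr)/= (lt_le_trans rc)//.
by rewrite ger_pMr// gerBl; have /andP[] := fine_cdf_itv R (q s - e).
Unshelve. all: by end_near. Qed.

(** Stated for a general measure [mu] and function [g], because it serves twice:
    pathwise, with [mu] the Stieltjes measure of a path of [L], and for the
    Laplace exponent, with [mu] the Lebesgue measure. *)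
Lemma cvg_riemann_sums_clock_quantile
    (mu : {measure set (measurableTypeR K) -> \bar K}) (g : K -> K) :
  measurable_fun setT g -> (forall y, 0 <= g y) ->
  (forall x y, 0 <= x -> x <= y -> g x <= g y) ->
  (forall (u : nat -> K) y, (forall n, 0 <= u n) ->
    u n @[n --> \oo] --> y -> g (u n) @[n --> \oo] --> g y) ->
  (\int[mu]_(s in `]0%R, t]) (g (q s))%:E < +oo)%E ->
  (\sum_(k < n.+1) (g (q (node t n k.+1)))%:E * mu (cell t n k) @[n --> \oo] -->
   \int[mu]_(s in `]0%R, t]) (g (q s))%:E)%E.
Proof.
move=> mg g0 gnd gcvg fin.
have mgq : measurable_fun setT (g \o q).
  by apply: measurableT_comp => //; exact: measurable_clock_quantile.
have mgq' : measurable_fun (`]0%R, t]%classic : set K) (fun s => (g (q s))%:E).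
  by apply: measurable_funTS; exact/measurable_EFinP.
have stepg n s : 0 < s <= t -> step t n (g \o q) s = g (step t n q s).
  by move=> s0t; have [r _ [_ e]] := step_node t0 n s0t; rewrite !e.
have [] := @dominated_convergence _ _ _ mu `]0%R, t]%classic (measurable_itv _)
  (fun n s => (step t n (g \o q) s)%:E) (fun s => (g (q s))%:E) (fun s => (g (q s))%:E).
- by move=> n; apply: measurable_funTS; apply/measurable_EFinP; exact: measurable_step.
- exact: mgq'.
- apply: aeW => s /=; rewrite in_itv/= => s0t; apply: cvg_EFin; first by near=> n.
  rewrite (_ : _ \o _ = fun n => g (step t n q s)); last first.
    by apply/funext => n; rewrite /= stepg.
  apply: gcvg; last exact: cvg_step_clock_quantile.
  by move=> n; have /andP[] := step_clock_quantile_le n s0t.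
- apply/integrableP; split => //.
  by under eq_integral do rewrite gee0_abs ?lee_fin//.
- apply: aeW => s n /=; rewrite in_itv/= => s0t; rewrite lee_fin.
  have /andP[h0 h1] := step_clock_quantile_le n s0t.
  by rewrite stepg// ger0_norm// gnd.
move=> _ _; rewrite [X in X @ \oo --> _ -> _](_ : _ =
    fun n => \sum_(k < n.+1) (g (q (node t n k.+1)))%:E * mu (cell t n k))%E//.
by apply/funext => n; rewrite /= integral_step// => s; exact: g0.
Unshelve. all: by end_near. Qed.

End clock_quantile_riemann_sums.

(** * Laplace exponents of subordinators *)

Definition laplace_exponent (K : realType) (nu : {measure set K -> \bar K})
    (theta : K) : K :=
  \int[nu]_(x in `]0, +oo[) (1 - expR (- (theta * x))).

Section subordinators.
Context (K : realType) d (O : measurableType d) (P : probability O K)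
  (L : K -> O -> K) (nu : {measure set K -> \bar K}).
Hypothesis sL : subordinator P L nu.

Lemma subordinator_ge0 t w : 0 <= t -> 0 <= L t w.
Proof.
by move=> t0; rewrite -[leLHS](sub_start sL w) (sub_nondecreasing sL)// lexx.
Qed.

Lemma one_minus_expR_ge0 (theta x : K) : 0 <= theta -> 0 <= x ->
  0 <= 1 - expR (- (theta * x)).
Proof. by move=> h x0; rewrite subr_ge0 expR_le1 oppr_le0 mulr_ge0. Qed.

Lemma measurable_one_minus_expR (theta : K) (D : set K) :
  measurable_fun D (fun x : K => 1 - expR (- (theta * x))).
Proof.
apply: measurable_funTS; apply: measurable_funB => //.
by apply: measurableT_comp => //; apply: measurableT_comp => //; exact: measurable_funM.
Qed.

(** Finiteness comes from [1 - e ^ (- theta x) <= (1 + theta) min 1 x]. *)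
Lemma laplace_exponentE theta : 0 <= theta ->
  ((laplace_exponent nu theta)%:E =
   \int[nu]_(x in `]0%R, +oo[) (1 - expR (- (theta * x)))%:E)%E.
Proof.
move=> h0; rewrite /laplace_exponent /Rintegral fineK// ge0_fin_numE; last first.
  apply: integral_ge0 => x /=; rewrite in_itv/= andbT => x0.
  by rewrite lee_fin one_minus_expR_ge0// ltW.
have h1 : 0 <= 1 + theta by rewrite addr_ge0.
apply: (@le_lt_trans _ _
   ((1 + theta)%:E * \int[nu]_(x in `]0%R, +oo[) (Num.min 1%R x)%:E)%E); last first.
  by rewrite lte_mul_pinfty// ?lee_fin// (sub_levy_int sL).
have mmin : measurable_fun (`]0%R, +oo[%classic : set K) (fun x : K => (Num.min 1%R x)%:E).
  by apply: measurable_funTS; apply/measurable_EFinP; exact: measurable_minr.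
rewrite -ge0_integralZl//; last first.
- move=> x /=; rewrite in_itv/= andbT => x0.
  by rewrite lee_fin le_min ler01 ltW.
apply: ge0_le_integral => //.
- move=> x /=; rewrite in_itv/= andbT => x0.
  by rewrite lee_fin one_minus_expR_ge0// ltW.
- by apply/measurable_EFinP; exact: measurable_one_minus_expR.
- by apply: emeasurable_funM => //; exact: measurable_cst.
- move=> x /=; rewrite in_itv/= andbT => x0; rewrite -EFinM lee_fin.
  have [x1|x1] := leP 1 x.
    by rewrite mulr1 lerD2l (le_trans _ h0)// oppr_le0 expR_ge0.
  rewrite mulrDl mul1r; have := expR_ge1Dx (- (theta * x)).
  by have := ltW x0; lra.
Qed.

Lemma laplace_exponent_ge0 theta : 0 <= theta -> 0 <= laplace_exponent nu theta.
Proof.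
move=> h0; apply: fine_ge0; apply: integral_ge0 => x /=.
rewrite in_itv/= andbT => x0.
by rewrite lee_fin one_minus_expR_ge0// ltW.
Qed.

Lemma le_laplace_exponent x y : 0 <= x -> x <= y ->
  laplace_exponent nu x <= laplace_exponent nu y.
Proof.
move=> x0 xy; have y0 := le_trans x0 xy.
rewrite -lee_fin !laplace_exponentE//; apply: ge0_le_integral => //.
- move=> z /=; rewrite in_itv/= andbT => z0.
  by rewrite lee_fin one_minus_expR_ge0// ltW.
- by apply/measurable_EFinP; exact: measurable_one_minus_expR.
- by apply/measurable_EFinP; exact: measurable_one_minus_expR.
- move=> z /=; rewrite in_itv/= andbT => z0.
  by rewrite lee_fin lerD2l lerN2 ler_expR lerN2 ler_wpM2r// ltW.
Qed.

Lemma subordinator_laplace t theta : 0 <= t -> 0 <= theta ->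
  (\int[P]_w (expR (- (theta * L t w)))%:E =
   (expR (- (t * laplace_exponent nu theta)))%:E)%E.
Proof. by move=> t0 h0; rewrite -(sub_laplace sL t0 h0) unlock. Qed.

Lemma measurable_laplace t (theta : K) : 0 <= t ->
  measurable_fun setT (fun w => expR (- (theta * L t w))).
Proof.
move=> t0; apply: measurableT_comp => //; apply: measurableT_comp => //.
by apply: measurable_funM => //; exact: (sub_measurable sL).
Qed.

(** Continuity of the exponent is read off the Laplace transform of [L 1], for
    which dominated convergence is immediate. *)
Lemma laplace_exponent_cvg (u : nat -> K) y : (forall n, 0 <= u n) ->
  u n @[n --> \oo] --> y ->
  laplace_exponent nu (u n) @[n --> \oo] --> laplace_exponent nu y.
Proof.
move=> u0 uy.
have y0 : 0 <= y.
  rewrite -(cvg_lim _ uy)//; apply: limr_ge; first by apply/cvg_ex; exists y.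
  exact: nearW.
have lnE x : 0 <= x ->
    laplace_exponent nu x = - ln (fine (\int[P]_w (expR (- (x * L 1 w)))%:E)%E).
  by move=> x0; rewrite subordinator_laplace//= expRK mul1r opprK.
rewrite lnE//; under eq_fun do rewrite lnE//.
apply: cvgN; apply: continuous_cvg.
  apply: continuous_ln; rewrite subordinator_laplace//=; exact: expR_gt0.
apply: fine_cvg; rewrite fineK; last by rewrite subordinator_laplace.
apply: (bounded_prob_cvg (c := 1)).
- by move=> n; exact: measurable_laplace.
- move=> n w; rewrite ger0_norm ?expR_ge0// expR_le1 oppr_le0 mulr_ge0//.
  exact: subordinator_ge0.
- move=> w; apply: continuous_cvg; first exact: continuous_expR.
  by apply: cvgN; apply: cvgM => //; exact: cvg_cst.
Qed.

End subordinators.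

Lemma lebesgue_stieltjes_measure_oc (K : realType) (f : cumulative K K) (a b : K) :
  a <= b -> lebesgue_stieltjes_measure f `]a, b] = (f b - f a)%:E.
Proof.
move=> ab; rewrite /lebesgue_stieltjes_measure /measure_extension/=.
by rewrite measurable_mu_extE/= ?wlength_itv_bnd//; exact: is_ocitv.
Qed.

(** * The Laplace transform of a quantile clock *)

Section clock_laplace_transform.
Context (K : realType) dR (OR : measurableType dR) (PR : probability OR K)
  (R : {RV PR >-> K}) d (O : measurableType d) (P : probability O K)
  (L T : K -> O -> K) (nu : {measure set K -> \bar K}).
Hypothesis cT : quantile_clock PR P R L nu T.
Let sL := qc_subordinator cT.
Let R0 := qc_positive cT.

Lemma clock_ge0 t w : 0 <= t -> 0 <= T t w.
Proof.
move=> t0; have [f fL TE] := qc_integral cT w t0.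
rewrite -lee_fin TE; apply: integral_ge0 => s _.
by rewrite lee_fin quantile_ge0.
Qed.

Lemma clock0 w : T 0 w = 0.
Proof.
have [f fL] := qc_integral cT w (lexx 0).
by rewrite set_itv_ge ?integral_set0 ?bnd_simp ?ltxx// => -[].
Qed.

Context (t : K).
Hypothesis t0 : 0 < t.
Let q := clock_quantile R t.

(** A Riemann sum of the clock integral: a linear combination of independent
    increments of [L]. *)
Definition clock_sum n (w : O) : K := \sum_(k < n.+1)
  q (node t n k.+1) * (L (node t n k.+1) w - L (node t n k) w).

Lemma measurable_clock_sum n : measurable_fun setT (clock_sum n).
Proof.
apply: measurable_sum => k; apply: measurable_funM => //.
by apply: measurable_funB; apply: (sub_measurable sL); exact: node_ge0.
Qed.

Lemma cvg_clock_sum w : clock_sum n w @[n --> \oo] --> T t w.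
Proof.
have [f fL TE] := qc_integral cT w (ltW t0).
pose g (y : K) := Num.max 0 y.
have g0 y : 0 <= g y by rewrite le_max lexx.
have gE y : 0 <= y -> g y = y by move=> y0; rewrite /g max_r.
have mg : measurable_fun setT g by exact: measurable_maxr.
have TE' : (\int[lebesgue_stieltjes_measure f]_(s in `]0%R, t]) (g (q s))%:E = (T t w)%:E)%E.
  by rewrite TE; apply: eq_integral => s _; rewrite gE// clock_quantile_ge0.
have fin : (\int[lebesgue_stieltjes_measure f]_(s in `]0%R, t]) (g (q s))%:E < +oo)%E.
  by rewrite TE' ltry.
have gnd x y : 0 <= x -> x <= y -> g x <= g y.
  by move=> x0 xy; rewrite !gE// (le_trans x0).
have gcvg (u : nat -> K) y : (forall n, 0 <= u n) ->
    u n @[n --> \oo] --> y -> g (u n) @[n --> \oo] --> g y.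
  move=> _ uy; apply: (continuous_cvg _ _ uy).
  by apply: (@continuous_max _ _ (cst 0) idfun); [exact: cvg_cst|exact: cvg_id].
have := cvg_riemann_sums_clock_quantile R0 t0 mg g0 gnd gcvg fin.
rewrite TE' => h.
suff h1 : ((clock_sum n w)%:E @[n --> \oo] --> (T t w)%:E)%E by exact: (fine_cvg h1).
apply: cvg_trans h; apply: near_eq_cvg; near=> n.
rewrite /clock_sum -sumEFin; apply: eq_bigr => k _.
rewrite [X in (_ * X)%E](_ : _ = (f (node t n k.+1) - f (node t n k))%:E)%E; last first.
  by apply: lebesgue_stieltjes_measure_oc; exact: le_node.
rewrite gE ?clock_quantile_ge0// -EFinM !fL !max_r//; exact: node_ge0.
Unshelve. all: by end_near. Qed.

Lemma measurable_clock : measurable_fun setT (T t).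
Proof.
apply: (measurable_fun_cvg measurable_clock_sum) => w _; exact: cvg_clock_sum.
Qed.

Lemma clock_sum_laplace n theta : 0 <= theta ->
  (\int[P]_w (expR (- (theta * clock_sum n w)))%:E =
   (expR (- \sum_(k < n.+1) t / n.+1%:R *
     laplace_exponent nu (theta * q (node t n k.+1))))%:E)%E.
Proof.
move=> h0; pose N := n.+1.
have q0 s : 0 <= q s by exact: clock_quantile_ge0.
pose X (k : 'I_N) w := L (node t n k.+1) w - L (node t n k) w.
(* the truncation makes [f k] bounded by [1] on the whole line *)
pose f (k : 'I_N) (x : K) := expR (- (theta * q (node t n k.+1) * Num.max 0 x)).
have X0 k w : 0 <= X k w.
  by rewrite subr_ge0 (sub_nondecreasing sL)// node_ge0//= le_node.
have mX k : measurable_fun setT (X k).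
  by apply: measurable_funB; apply: (sub_measurable sL); exact: node_ge0.
have mf k : measurable_fun setT (f k).
  apply: measurableT_comp => //; apply: measurableT_comp => //.
  by apply: measurable_funM => //; exact: measurable_maxr.
have f01 k x : 0 <= f k x <= 1.
  by rewrite expR_ge0 expR_le1 oppr_le0 !mulr_ge0// le_max lexx.
have indep : mutually_independent P X.
  apply: (sub_indep sL (t := node t n)); first exact: node_ge0.
  by move=> i j; exact: le_node.
have := expectation_prod_mutually_independent mX mf f01 indep.
rewrite (_ : (\int[P]_w _ = _) = (\int[P]_w (expR (- (theta * clock_sum n w)))%:E =
   \prod_(i < N) \int[P]_w (f i (X i w))%:E))%E; last first.
  congr (_ = _); apply: eq_integral => w _; congr EFin.
  rewrite /f -expR_sum; congr expR.
  rewrite /clock_sum mulr_sumr -sumrN; apply: eq_bigr => k _.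
  by rewrite max_r// mulrA.
move=> ->.
have h1 : 0 <= t / n.+1%:R by rewrite divr_ge0// ltW.
rewrite (eq_bigr (fun k : 'I_N => (expR (- (t / n.+1%:R *
     laplace_exponent nu (theta * q (node t n k.+1)))))%:E)); last first.
  move=> k _; have hq : 0 <= theta * q (node t n k.+1) by rewrite mulr_ge0.
  rewrite -(subordinator_laplace sL h1 hq).
  have st := sub_stationary sL (node_ge0 t0 n k) h1.
  rewrite -nodeS in st.
  have e := @ge0_integral_eq_in_law _ _ _ _ _ _ _ _ _ (EFin \o f k) st.
  rewrite /= in e; rewrite e => [|//|].
  - by apply: eq_integral => w _; rewrite /f max_r// (subordinator_ge0 sL).
  - exact/measurable_EFinP.
  - by move=> x; rewrite lee_fin; have /andP[] := f01 k x.
rewrite prodEFin -expR_sum; congr (expR _)%:E.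
by rewrite sumrN.
Qed.

(** The mean of the exponent is taken over [max 0 R], equal to [R] almost surely,
    so that exponents are only evaluated at nonnegative arguments. *)
Lemma clock_laplace theta (M : K) : 0 <= theta ->
  (\int[PR]_w (laplace_exponent nu (theta * Num.max 0 (R w)))%:E = M%:E)%E ->
  (\int[P]_w (expR (- (theta * T t w)))%:E = (expR (- (t * M)))%:E)%E.
Proof.
move=> h0 ME.
pose g (y : K) := laplace_exponent nu (theta * Num.max 0 y).
have max0 (y : K) : 0 <= Num.max 0 y by rewrite le_max lexx.
have g0 y : 0 <= g y by apply: laplace_exponent_ge0; rewrite mulr_ge0.
have gnd x y : x <= y -> g x <= g y.
  move=> xy; apply: (le_laplace_exponent sL); first by rewrite mulr_ge0.
  by rewrite ler_wpM2l// ge_max max0/= le_max xy orbT.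
have mg : measurable_fun setT g by apply: nondecreasing_measurable.
have gcvg (u : nat -> K) y : (forall n, 0 <= u n) ->
    u n @[n --> \oo] --> y -> g (u n) @[n --> \oo] --> g y.
  move=> _ uy; apply: (laplace_exponent_cvg sL); first by move=> n; rewrite mulr_ge0.
  apply: cvgM; first exact: cvg_cst.
  apply: (continuous_cvg _ _ uy).
  by apply: (@continuous_max _ _ (cst 0) idfun); [exact: cvg_cst|exact: cvg_id].
have gE : (\int[lebesgue_measure]_(s in `]0%R, t]) (g (q s))%:E = (t * M)%:E)%E.
  have -> := @ge0_integral_clock_quantile _ _ _ _ R t R0 t0 (EFin \o g).
  - by rewrite /= ME EFinM.
  - exact/measurable_EFinP.
  - by move=> x; rewrite lee_fin.
have fin : (\int[lebesgue_measure]_(s in `]0%R, t]) (g (q s))%:E < +oo)%E.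
  by rewrite gE ltry.
have := cvg_riemann_sums_clock_quantile R0 t0 mg g0 (fun x y _ => @gnd x y) gcvg fin.
rewrite gE => h.
have {}h : \sum_(k < n.+1) t / n.+1%:R *
     laplace_exponent nu (theta * q (node t n k.+1)) @[n --> \oo] --> t * M.
  suff h1 : ((\sum_(k < n.+1) t / n.+1%:R *
      laplace_exponent nu (theta * q (node t n k.+1)))%:E @[n --> \oo] --> (t * M)%:E)%E.
    exact: (fine_cvg h1).
  apply: cvg_trans h; apply: near_eq_cvg; near=> n.
  rewrite -sumEFin; apply: eq_bigr => k _.
  have e : lebesgue_measure (cell t n k) = (t / n.+1%:R)%:E.
    rewrite /cell lebesgue_measure_itv/= lte_fin nodeS ltrDl divr_gt0//.
    by rewrite -EFinD addrAC subrr add0r.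
  rewrite [X in (_ * X)%E](_ : _ = (t / n.+1%:R)%:E)%E; last exact: e.
  by rewrite -EFinM mulrC /g max_r// clock_quantile_ge0.
have lim1 : (\int[P]_w (expR (- (theta * clock_sum n w)))%:E @[n --> \oo] -->
    (expR (- (t * M)))%:E)%E.
  under eq_fun do rewrite clock_sum_laplace//.
  apply: cvg_EFin; first by near=> n.
  apply: continuous_cvg; first exact: continuous_expR.
  exact: cvgN.
apply: (cvg_unique _ _ lim1) => //.
apply: (bounded_prob_cvg (c := 1)).
- move=> n; apply: measurableT_comp => //; apply: measurableT_comp => //.
  by apply: measurable_funM => //; exact: measurable_clock_sum.
- move=> n w; rewrite ger0_norm ?expR_ge0// expR_le1 oppr_le0 mulr_ge0//.
  apply: sumr_ge0 => k _; rewrite mulr_ge0 ?clock_quantile_ge0// subr_ge0.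
  by rewrite (sub_nondecreasing sL)// node_ge0//= le_node.
- move=> w; apply: continuous_cvg; first exact: continuous_expR.
  by apply: cvgN; apply: cvgM; [exact: cvg_cst|exact: cvg_clock_sum].
Unshelve. all: by end_near. Qed.

End clock_laplace_transform.

(** * The kernel of the Levy density of L *)

Section lebesgue_scaling.
Context (K : realType).

Lemma lebesgue_measure_scale (r : K) (E : set K) : 0 < r -> measurable E ->
  lebesgue_measure E = (r%:E * lebesgue_measure ((fun s : K => r * s)%R @^-1` E))%E.
Proof.
move=> r0 mE.
have mr : measurable_fun setT (fun s : measurableTypeR K => (r * s : measurableTypeR K)).
  exact: measurable_funM.
pose f := (fun s : measurableTypeR K => (r * s : measurableTypeR K)).
pose mu := mscale (NngNum (ltW r0)) (pushforward (@lebesgue_measure K) f).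
have -> // : lebesgue_measure E = mu mr E.
apply: lebesgue_measure_unique => // _ [[a b] /= _ <-].
rewrite /mu /mscale/= /pushforward.
rewrite (_ : f @^-1` `]a, b] = `]a / r, b / r]%classic); last first.
  apply/seteqP; split => s; rewrite /= !in_itv/= ltr_pdivrMr// ler_pdivlMr//.
    by rewrite mulrC.
  by rewrite mulrC.
rewrite !lebesgue_measure_itv/= !lte_fin ltr_pM2r ?invr_gt0//.
case: ifPn => ab; last by rewrite mule0.
by rewrite -EFinB -EFinM -mulrBl mulrC divfK// gt_eqF.
Qed.

Lemma ge0_integral_lebesgue_scale (r : K) (f : K -> \bar K) : 0 < r ->
  measurable_fun setT f -> (forall s, 0 <= f s)%E ->
  (\int[lebesgue_measure]_s f s = r%:E * \int[lebesgue_measure]_s f (r * s)%R)%E.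
Proof.
move=> r0 mf f0.
have mr : measurable_fun setT (fun s : measurableTypeR K => (r * s : measurableTypeR K)).
  exact: measurable_funM.
have := @ge0_integral_density _ _ (measurableTypeR K) (measurableTypeR K) K
  (@lebesgue_measure K) (@lebesgue_measure K) setT (fun s => r * s)%R (cst r)
  measurableT mr (measurable_cst _) (fun _ _ => ltW r0) _ f mf f0.
move=> -> => [|E mE].
  rewrite -ge0_integralZl//; [|exact: (measurableT_comp mf mr)|by rewrite lee_fin ltW].
  by apply: eq_integral => s _; rewrite muleC.
rewrite setTI (eq_integral (cst r%:E))// integral_cst; last first.
  by rewrite -[X in measurable X]setTI; exact: mr.
exact: lebesgue_measure_scale.
Qed.

End lebesgue_scaling.

Section mixture_kernel.
Context (K : realType) (alpha delta : K).
Hypotheses (alpha0 : 0 < alpha) (delta0 : 0 < delta).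

(** The Levy density of [L] at [s], for [V / Y_alpha] equal to the constant [x]
    and up to a constant factor.  The truncation makes it nonnegative for all [x]. *)
Definition mixture_kernel (s x : K) : K :=
  ((1 + alpha / delta) * s `^ (- alpha - 1) + delta^-1 * s `^ (- alpha) * Num.max 0 x)
    * expR (- (s * Num.max 0 x)).

Lemma mixture_kernel_ge0 s x : 0 <= mixture_kernel s x.
Proof.
apply: mulr_ge0; last exact: expR_ge0.
apply: addr_ge0; apply: mulr_ge0; rewrite ?powR_ge0//.
- by rewrite addr_ge0// divr_ge0// ltW.
- by rewrite mulr_ge0 ?powR_ge0// invr_ge0 ltW.
- by rewrite le_max lexx.
Qed.

Lemma measurable_mixture_kernel d (T : measurableType d) (f g : T -> K) :
  measurable_fun setT f -> measurable_fun setT g ->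
  measurable_fun setT (fun z => mixture_kernel (f z) (g z)).
Proof.
move=> mf mg.
have mmax : measurable_fun setT (fun z => Num.max 0 (g z)) by exact: measurable_maxr.
have mp p : measurable_fun setT (fun z => f z `^ p).
  exact: (measurableT_comp (@measurable_powR K p)).
apply: measurable_funM; last first.
  by apply: measurableT_comp => //; apply: measurableT_comp => //; exact: measurable_funM.
apply: measurable_funD; first exact: measurable_funM.
by apply: measurable_funM => //; exact: measurable_funM.
Qed.

(** The indicator lets all the exponents be integrals over the whole line, as
    the exchange of integrals requires. *)
Definition exponent_kernel (theta s : K) : K :=
  \1_(`]0, +oo[%classic : set K) s * (1 - expR (- (theta * s))).

Lemma exponent_kernel_ge0 theta s : 0 <= theta -> 0 <= exponent_kernel theta s.
Proof.
move=> h0; rewrite /exponent_kernel indicE.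
have [|] := boolP (s \in `]0, +oo[%classic); last by rewrite mul0r.
rewrite inE/= in_itv/= andbT => s0.
by rewrite mul1r one_minus_expR_ge0// ltW.
Qed.

Lemma measurable_exponent_kernel theta : measurable_fun setT (exponent_kernel theta).
Proof.
apply: measurable_funM; last exact: measurable_one_minus_expR.
by apply: measurable_indic; exact: measurable_itv.
Qed.

Definition mixture_exponent (theta x : K) : \bar K :=
  (\int[lebesgue_measure]_s (exponent_kernel theta s * mixture_kernel s x)%:E)%E.

Lemma mixture_exponent_ge0 theta x : 0 <= theta -> (0 <= mixture_exponent theta x)%E.
Proof.
move=> h0; apply: integral_ge0 => s _.
by rewrite lee_fin mulr_ge0 ?exponent_kernel_ge0 ?mixture_kernel_ge0.
Qed.

Lemma measurable_exponent_mixture_kernel d (T : measurableType d) (f g : T -> K) theta :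
  measurable_fun setT f -> measurable_fun setT g ->
  measurable_fun setT (fun z => (exponent_kernel theta (f z) * mixture_kernel (f z) (g z))%:E).
Proof.
move=> mf mg; apply/measurable_EFinP; apply: measurable_funM.
  exact: (measurableT_comp (measurable_exponent_kernel theta)).
exact: measurable_mixture_kernel.
Qed.

Lemma measurable_mixture_exponent theta : 0 <= theta ->
  measurable_fun setT (mixture_exponent theta).
Proof.
move=> h0; pose F (z : K * measurableTypeR K) :=
  (exponent_kernel theta z.2 * mixture_kernel z.2 z.1)%:E.
have mF : measurable_fun setT F.
  by apply: measurable_exponent_mixture_kernel; [exact: measurable_snd|exact: measurable_fst].
apply: (measurable_fun_fubini_tonelli_F (m2 := lebesgue_measure) F mF) => z.
by rewrite lee_fin mulr_ge0 ?exponent_kernel_ge0 ?mixture_kernel_ge0.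
Qed.

Lemma mixture_kernel_scale r s x : 0 < r -> 0 < s ->
  mixture_kernel (s / r) x = r * r `^ alpha * mixture_kernel s (x / r).
Proof.
move=> r0 s0; rewrite /mixture_kernel.
have -> : Num.max 0 (x / r) = Num.max 0 x / r.
  by rewrite maxr_pMl ?invr_ge0 ?ltW// mul0r.
set y := Num.max 0 x.
have sr p : (s / r) `^ (- p) = s `^ (- p) * r `^ p.
  rewrite powRM ?invr_ge0 ?ltW//; congr (_ * _).
  by rewrite -powR_inv1 ?ltW// -powRrM mulN1r opprK.
have -> : - alpha - 1 = - (alpha + 1) by rewrite opprD.
have ra1 : r `^ (alpha + 1) = r `^ alpha * r.
  by rewrite powRD ?(gt_eqF r0) ?implybT// powRr1// ltW.
rewrite !sr ra1.
have -> : s / r * y = s * (y / r) by rewrite mulrAC mulrA.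
rewrite [RHS]mulrA; congr (_ * _).
by field; rewrite !gt_eqF.
Qed.

(** Substituting [s / r] for [s]: homogeneity of the kernel moves a factor [r]
    of the argument [theta] to the parameter [x]. *)
Lemma mixture_exponent_scale r theta x : 0 < r -> 0 <= theta ->
  mixture_exponent (theta * r) x = ((r `^ alpha)%:E * mixture_exponent theta (x / r))%E.
Proof.
move=> r0 h0; have ri0 : 0 < r^-1 by rewrite invr_gt0.
have hr0 : 0 <= theta * r by rewrite mulr_ge0// ltW.
pose F th y (s : measurableTypeR K) : \bar K :=
  (exponent_kernel th s * mixture_kernel s y)%:E.
have mF th y : measurable_fun setT (F th y).
  by apply: measurable_exponent_mixture_kernel => //; exact: measurable_id.
have F0 th y s : 0 <= th -> (0 <= F th y s)%E.
  by move=> th0; rewrite lee_fin mulr_ge0 ?exponent_kernel_ge0 ?mixture_kernel_ge0.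
have mr : measurable_fun setT (fun s : measurableTypeR K => (r^-1 * s : measurableTypeR K)).
  exact: measurable_funM.
transitivity (\int[lebesgue_measure]_s (r^-1%:E * F (theta * r)%R x (r^-1 * s)%R))%E.
  rewrite [LHS](ge0_integral_lebesgue_scale ri0 (mF _ x) (fun s => F0 _ x s hr0)).
  rewrite ge0_integralZl//; [exact: (measurableT_comp (mF _ x) mr)| |].
  - by move=> s _; exact: F0.
  - by rewrite lee_fin ltW.
transitivity (\int[lebesgue_measure]_s ((r `^ alpha)%:E * F theta (x / r)%R s))%E; last first.
  rewrite ge0_integralZl//; first by move=> s _; exact: F0.
  by rewrite lee_fin powR_ge0.
apply: eq_integral => s _; rewrite -!EFinM; congr EFin.
rewrite /exponent_kernel !indicE.
have -> : (r^-1 * s \in `]0, +oo[%classic) = (s \in `]0, +oo[%classic).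
  by apply/idP/idP; rewrite !inE/= !in_itv/= !andbT pmulr_rgt0.
have [|] := boolP (s \in `]0, +oo[%classic); last by rewrite !mul0r !mulr0.
rewrite inE/= in_itv/= andbT => s0; rewrite !mul1r.
rewrite [r^-1 * s]mulrC mixture_kernel_scale//.
have -> : theta * r * (s / r) = theta * s by field; rewrite gt_eqF.
by field; rewrite gt_eqF.
Qed.

End mixture_kernel.

(** * Averaging the kernel over a power of a uniform variable *)

Section mixture_kernel_mean.
Context (K : realType) (alpha delta : K).
Hypotheses (alpha0 : 0 < alpha) (delta0 : 0 < delta).
Variables s v : K.
Hypotheses (s0 : 0 < s) (v0 : 0 < v).

Let p := alpha / delta.
Let e (u : K) := expR (- (s * v * u `^ (- delta^-1))).
Let f (u : K) := s `^ (- alpha - 1) *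
  (u `^ p * (1 + p + s * v * delta^-1 * u `^ (- delta^-1)) * e u).
Let F (u : K) := s `^ (- alpha - 1) * (u `^ (1 + p) * e u).

Let p0 : 0 < p. Proof. exact: divr_gt0. Qed.

Let p10 : 0 < 1 + p. Proof. by rewrite addr_gt0. Qed.

(** The two terms of the kernel are the two terms of this derivative. *)
Let derivF (u : K) : 0 < u -> is_derive u 1 F (f u).
Proof.
move=> u0; rewrite /F /f /e.
have h1 := is_derive1_powR (1 + p) u0.
have h2 := is_derive1_powR (- delta^-1) u0.
apply: is_derive_eq.
rewrite /GRing.scale/=.
rewrite [1 + p]addrC addrK.
have -> : u `^ (p + 1) = u `^ p * u.
  by rewrite powRD ?(gt_eqF u0) ?implybT// powRr1// ltW.
have -> : u `^ (- delta^-1 - 1) = u `^ (- delta^-1) / u.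
  by rewrite powRB ?(gt_eqF u0) ?implybT// powRr1// ltW.
by field; rewrite !gt_eqF.
Qed.

Let fE (u : K) : 0 <= u -> (u `^ delta^-1) `^ alpha *
  mixture_kernel alpha delta s (v / u `^ delta^-1) = f u.
Proof.
rewrite le_eqVlt => /predU1P[<-|u0].
  rewrite powR0 ?invr_eq0 ?gt_eqF// powR0 ?gt_eqF// mul0r /f powR0 ?gt_eqF//.
  by rewrite !mul0r mulr0.
have z0 : 0 < u `^ delta^-1 by rewrite powR_gt0.
rewrite /mixture_kernel max_r; last by rewrite ltW// divr_gt0.
rewrite -powRrM -powRN.
have -> : delta^-1 * alpha = p by rewrite mulrC.
have -> : s `^ (- alpha) = s `^ (- alpha - 1) * s.
  by rewrite -[X in _ = _ * X](powRr1 (ltW s0)) -powRD ?subrK// (gt_eqF s0) implybT.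
rewrite /f /e -/p.
have -> : s * (v * u `^ (- delta^-1)) = s * v * u `^ (- delta^-1) by rewrite mulrA.
by ring.
Qed.

Let f_ge0 (u : K) : 0 <= u -> 0 <= f u.
Proof.
by move=> u0; rewrite -fE// mulr_ge0 ?powR_ge0// mixture_kernel_ge0.
Qed.

(** From [x e ^ (- x) <= 1]; it gives continuity at [0], where
    [u ^ (- 1 / delta)] is unbounded. *)
Let f_le (u : K) : f u <= s `^ (- alpha - 1) * ((1 + p + delta^-1) * u `^ p).
Proof.
rewrite /f ler_wpM2l ?powR_ge0// -mulrA [leRHS]mulrC ler_wpM2l ?powR_ge0//.
set x := s * v * u `^ (- delta^-1).
have x0 : 0 <= x by rewrite /x !mulr_ge0 ?powR_ge0// ltW.
have -> : s * v * delta^-1 * u `^ (- delta^-1) = delta^-1 * x by rewrite /x; ring.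
rewrite mulrDl lerD//.
  by rewrite ler_piMr ?(ltW p10)// /e expR_le1 oppr_le0.
rewrite -mulrA ler_piMr ?invr_ge0 ?(ltW delta0)//.
rewrite /e -/x expRN ler_pdivrMr ?expR_gt0// mul1r.
by rewrite (le_trans _ (expR_ge1Dx x))// lerDr.
Qed.

Let F_ge0 (u : K) : 0 <= F u.
Proof. by rewrite !mulr_ge0 ?powR_ge0 ?expR_ge0. Qed.

Let F_le (u : K) : F u <= s `^ (- alpha - 1) * u `^ (1 + p).
Proof.
rewrite ler_wpM2l ?powR_ge0// ler_piMr ?powR_ge0//.
by rewrite expR_le1 oppr_le0 !mulr_ge0 ?powR_ge0// ltW.
Qed.

Let cvg_powR_cst (c a : K) : 0 < a -> c * u `^ a @[u --> 0^'+] --> (0 : K).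
Proof.
move=> a0; rewrite -[X in _ --> X](mulr0 c).
by apply: cvgM; [exact: cvg_cst|exact: powR_cvg0].
Qed.

Let F0 : F 0 = 0.
Proof. by rewrite /F powR0 ?gt_eqF// mul0r mulr0. Qed.

Let f0 : f 0 = 0.
Proof. by rewrite /f powR0 ?gt_eqF// !mul0r mulr0. Qed.

Let cvgF0 : F u @[u --> 0^'+] --> F 0.
Proof.
rewrite F0; apply: (squeeze_cvgr _ (cvg_cst 0) (cvg_powR_cst (s `^ (- alpha - 1)) p10)).
by near=> u; rewrite F_ge0 F_le.
Unshelve. all: by end_near. Qed.

Let cvgf0 : f u @[u --> 0^'+] --> f 0.
Proof.
rewrite f0; apply: (squeeze_cvgr _ (cvg_cst 0)
  (cvg_powR_cst (s `^ (- alpha - 1) * (1 + p + delta^-1)) p0)).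
near=> u; have u0 : 0 < u by near: u; exact: nbhs_right_gt.
by rewrite f_ge0 ?(ltW u0)//=; have := f_le u; rewrite mulrA.
Unshelve. all: by end_near. Qed.

Let continuousF (u : K) : 0 < u -> {for u, continuous F}.
Proof.
move=> u0; apply: differentiable_continuous; apply/derivable1_diffP.
by have [] := derivF u0.
Qed.

Let continuousf (u : K) : 0 < u -> {for u, continuous f}.
Proof.
move=> u0; apply: differentiable_continuous; apply/derivable1_diffP.
have h1 := is_derive1_powR p u0.
have h2 := is_derive1_powR (- delta^-1) u0.
by apply: ex_derive.
Qed.

(** For [Z = U ^ (1 / delta)]: [E (Z ^ alpha k s (v / Z))] is the increment of
    [F] over the unit interval, and [F 0 = 0]. *)
Lemma integral_mixture_kernel :
  (\int[uniform_prob (@ltr01 K)]_u ((u `^ delta^-1) `^ alpha *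
     mixture_kernel alpha delta s (v / u `^ delta^-1))%:E =
   (s `^ (- alpha - 1) * expR (- (s * v)))%:E)%E.
Proof.
have mz : measurable_fun setT (fun u : K => u `^ delta^-1) by exact: measurable_powR.
rewrite integral_uniform; last 2 first.
- apply/measurable_EFinP; apply: measurable_funM.
    exact: (measurableT_comp (@measurable_powR K alpha)).
  apply: measurable_mixture_kernel; first exact: measurable_cst.
  rewrite (_ : (fun u => _) = fun u => v * u `^ (- delta^-1)).
    by apply: measurable_funM => //; exact: measurable_powR.
  by apply/funext => u; rewrite powRN.
- move=> u; rewrite lee_fin mulr_ge0 ?powR_ge0// mixture_kernel_ge0//.
rewrite subr0 invr1 mul1e.
transitivity (\int[lebesgue_measure]_(u in `[0%R, 1%R]) (f u)%:E)%E.
  by apply: eq_integral => u; rewrite inE/= in_itv/= => /andP[u0 _]; rewrite fE.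
transitivity ((F 1)%:E - (F 0)%:E)%E; last first.
  by rewrite F0 sube0 /F /e !powR1 !mulr1 mul1r.
apply: continuous_FTC2; first exact: ltr01.
- apply/continuous_within_itvP; first exact: ltr01.
  split; [|exact: cvgf0|].
  + by move=> u; rewrite in_itv/= => /andP[u0 _]; exact: continuousf.
  + by apply: cvg_at_left_filter; apply: continuousf; exact: ltr01.
- split; [|exact: cvgF0|].
  + by move=> u; rewrite in_itv/= => /andP[u0 _]; have [] := derivF u0.
  + by apply: cvg_at_left_filter; apply: continuousF; exact: ltr01.
- move=> u; rewrite in_itv/= => /andP[u0 _].
  by rewrite derive1E; have [_ ->] := derivF u0.
Qed.

End mixture_kernel_mean.

(** Inversion is written with a power of the square, which covers all signs, and
    [0], whose inverse is [0]. *)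
Lemma measurable_fun_inv (K : realType) d (T : measurableType d) (f : T -> K) :
  measurable_fun setT f -> measurable_fun setT (fun x => (f x)^-1).
Proof.
move=> mf; rewrite (_ : (fun x => _) = fun x => f x * ((f x) ^+ 2) `^ (-1)).
  apply: measurable_funM => //.
  apply: (measurableT_comp (@measurable_powR K (-1))).
  exact: measurable_funX.
apply/funext => x; rewrite powR_inv1 ?sqr_ge0//.
have [->|fx0] := eqVneq (f x) 0; first by rewrite invr0 mul0r.
by rewrite expr2 invfM mulrA mulfV// mul1r.
Qed.

(** * Averaging the exponent of L over R *)

Section mixture_identity.
Context (K : realType) (alpha delta : K).
Hypotheses (alpha0 : 0 < alpha) (delta0 : 0 < delta).
Variable theta : K.
Hypothesis theta0 : 0 <= theta.

Local Notation Psi := (mixture_exponent alpha delta theta).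

(** For [z = r Y] and [v = V], its mean is, up to a constant factor, the exponent
    of [L] at [theta r]. *)
Definition biased_exponent (v z : K) : \bar K := ((z `^ alpha)%:E * Psi (v / z))%E.

Lemma biased_exponent_ge0 v z : (0 <= biased_exponent v z)%E.
Proof. by rewrite mule_ge0 ?lee_fin ?powR_ge0 ?mixture_exponent_ge0. Qed.

Lemma measurable_biased_exponent d (T : measurableType d) (f g : T -> K) :
  measurable_fun setT f -> measurable_fun setT g ->
  measurable_fun setT (fun x => biased_exponent (f x) (g x)).
Proof.
move=> mf mg; apply: emeasurable_funM.
  by apply/measurable_EFinP; exact: (measurableT_comp (@measurable_powR K alpha)).
apply: (measurableT_comp (measurable_mixture_exponent alpha0 delta0 theta0)).
by apply: measurable_funM => //; exact: measurable_fun_inv.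
Qed.

(** The exponent of the exponentially tilted stable density
    [s ^ (- alpha - 1) e ^ (- s v)], whose mean over [v = V] is
    that of [zeta], up to a constant factor. *)
Definition stable_exponent (v : K) : \bar K :=
  (\int[lebesgue_measure]_s (exponent_kernel theta s *
     (s `^ (- alpha - 1) * expR (- (s * v))))%:E)%E.

Lemma stable_exponent_ge0 v : (0 <= stable_exponent v)%E.
Proof.
apply: integral_ge0 => s _.
by rewrite lee_fin mulr_ge0 ?exponent_kernel_ge0 ?mulr_ge0 ?powR_ge0 ?expR_ge0.
Qed.

Lemma measurable_stable_kernel d (T : measurableType d) (f g : T -> K) :
  measurable_fun setT f -> measurable_fun setT g ->
  measurable_fun setT (fun x => (exponent_kernel theta (f x) *
     (f x `^ (- alpha - 1) * expR (- (f x * g x))))%:E).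
Proof.
move=> mf mg; apply/measurable_EFinP; apply: measurable_funM.
  exact: (measurableT_comp (measurable_exponent_kernel theta)).
apply: measurable_funM; first exact: (measurableT_comp (@measurable_powR K _)).
by apply: measurableT_comp => //; apply: measurableT_comp => //; exact: measurable_funM.
Qed.

Lemma measurable_stable_exponent d (T : measurableType d) (f : T -> K) :
  measurable_fun setT f -> measurable_fun setT (fun x => stable_exponent (f x)).
Proof.
move=> mf; pose F (z : T * measurableTypeR K) := (exponent_kernel theta z.2 *
     (z.2 `^ (- alpha - 1) * expR (- (z.2 * f z.1))))%:E.
have mF : measurable_fun setT F.
  by apply: measurable_stable_kernel; [exact: measurable_snd|
    exact: (measurableT_comp mf measurable_fst)].
apply: (measurable_fun_fubini_tonelli_F (m2 := lebesgue_measure) F mF) => z.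
by rewrite lee_fin mulr_ge0 ?exponent_kernel_ge0 ?mulr_ge0 ?powR_ge0 ?expR_ge0.
Qed.

Lemma uniform_biased_exponent v : 0 < v ->
  (\int[uniform_prob (@ltr01 K)]_u biased_exponent v (u `^ delta^-1) =
   stable_exponent v)%E.
Proof.
move=> v0.
pose U := uniform_prob (@ltr01 K).
pose F (z : measurableTypeR K * measurableTypeR K) :=
  (exponent_kernel theta z.2 * ((z.1 `^ delta^-1) `^ alpha *
    mixture_kernel alpha delta z.2 (v / z.1 `^ delta^-1)))%:E.
have mz : measurable_fun setT (fun u : K => u `^ delta^-1) by exact: measurable_powR.
have mz1 : measurable_fun setT
    (fun z : measurableTypeR K * measurableTypeR K => z.1 `^ delta^-1).
  by apply: (measurableT_comp (@measurable_powR K _)); exact: measurable_fst.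
have F0 z : (0 <= F z)%E.
  rewrite lee_fin; apply: mulr_ge0; first exact: exponent_kernel_ge0.
  by apply: mulr_ge0; [exact: powR_ge0|exact: mixture_kernel_ge0].
have mF : measurable_fun setT F.
  apply/measurable_EFinP; apply: measurable_funM.
    by apply: (measurableT_comp (measurable_exponent_kernel theta)); exact: measurable_snd.
  apply: measurable_funM; first exact: (measurableT_comp (@measurable_powR K alpha)).
  apply: measurable_mixture_kernel; first exact: measurable_snd.
  by apply: measurable_funM => //; exact: measurable_fun_inv.
transitivity (\int[U]_u \int[lebesgue_measure]_s F (u, s))%E.
  apply: eq_integral => u _; rewrite /biased_exponent /mixture_exponent.
  rewrite -ge0_integralZl//; last 3 first.
  - by apply: measurable_exponent_mixture_kernel => //; exact: measurable_id.
  - by move=> s _; rewrite lee_fin mulr_ge0 ?exponent_kernel_ge0 ?mixture_kernel_ge0.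
  - by rewrite lee_fin powR_ge0.
  by apply: eq_integral => s _; rewrite /F -EFinM mulrCA.
rewrite (fubini_tonelli F mF F0); apply: eq_integral => s _.
have mFs : measurable_fun setT (fun u : K => ((u `^ delta^-1) `^ alpha *
    mixture_kernel alpha delta s (v / u `^ delta^-1))%:E).
  apply/measurable_EFinP.
  apply: measurable_funM; first exact: (measurableT_comp (@measurable_powR K alpha)).
  apply: measurable_mixture_kernel; first exact: measurable_cst.
  by apply: measurable_funM => //; exact: measurable_fun_inv.
rewrite /F/=; under eq_integral do rewrite EFinM.
have [s0|s0] := ltP 0 s; last first.
  have -> : exponent_kernel theta s = 0.
    by rewrite /exponent_kernel indicE memNset ?mul0r//= in_itv/= andbT; apply/negP; rewrite -leNgt.
  by under eq_integral do rewrite mul0e; rewrite integral0 mul0r.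
rewrite ge0_integralZl//; last 2 first.
- by move=> u _; rewrite lee_fin mulr_ge0 ?powR_ge0 ?mixture_kernel_ge0.
- by rewrite lee_fin exponent_kernel_ge0.
by rewrite integral_mixture_kernel// EFinM.
Qed.

Context dR (OR : measurableType dR) (PR : probability OR K) (R Y : {RV PR >-> K}).
Hypothesis RY_indep : independent2 PR R Y.
Hypothesis RY_law : eq_in_law PR (fun w => R w * Y w)
  (uniform_prob (@ltr01 K)) (fun u => u `^ delta^-1).

(** Only the law of the product [R Y] matters, by independence. *)
Lemma mean_biased_exponent v : 0 < v ->
  (\int[PR]_w \int[PR]_w' biased_exponent v (R w * Y w') = stable_exponent v)%E.
Proof.
move=> v0.
pose f (z : K * K) := biased_exponent v (z.1 * z.2).
have mf : measurable_fun setT f.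
  apply: measurable_biased_exponent => //.
  by apply: measurable_funM; [exact: measurable_fst|exact: measurable_snd].
have f0 z : (0 <= f z)%E by exact: biased_exponent_ge0.
rewrite -(@ge0_integral_independent2 _ _ _ _ R Y f RY_indep mf f0)/= /f/=.
rewrite -uniform_biased_exponent//.
apply: (ge0_integral_eq_in_law (f := biased_exponent v) RY_law).
- by apply: measurable_biased_exponent => //; exact: measurable_id.
- by move=> z; exact: biased_exponent_ge0.
Qed.

Context dV (OV : measurableType dV) (PV : probability OV K) (V : {RV PV >-> K}).
Hypothesis V0 : ae_positive PV V.

Let G (z : (OR * OV) * OR) := biased_exponent (V z.1.2) (R z.1.1 * Y z.2).

Let G0 z : (0 <= G z)%E. Proof. exact: biased_exponent_ge0. Qed.

Let mG : measurable_fun setT G.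
Proof.
apply: measurable_biased_exponent.
  apply: (measurableT_comp (measurable_funP V)).
  exact: (measurableT_comp measurable_snd measurable_fst).
apply: measurable_funM; last exact: (measurableT_comp (measurable_funP Y) measurable_snd).
apply: (measurableT_comp (measurable_funP R)).
exact: (measurableT_comp measurable_fst measurable_fst).
Qed.

Let H (z : OR * OV) := (\int[PR]_w G (z, w))%E.

Let H0 z : (0 <= H z)%E. Proof. by apply: integral_ge0 => w _; exact: G0. Qed.

Let mH : measurable_fun setT H.
Proof. exact: (measurable_fun_fubini_tonelli_F (m2 := PR) G mG G0). Qed.

Lemma measurable_mean_biased_exponent : measurable_fun setT
  (fun w => \int[PV]_v \int[PR]_w' biased_exponent (V v) (R w * Y w'))%E.
Proof. exact: (measurable_fun_fubini_tonelli_F (m2 := PV) H mH H0). Qed.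

Lemma mean_mixture_exponent :
  (\int[PR]_w \int[PV]_v \int[PR]_w' biased_exponent (V v) (R w * Y w') =
   \int[PV]_v stable_exponent (V v))%E.
Proof.
rewrite (fubini_tonelli (m1 := PR) (m2 := PV) H mH H0).
apply: ge0_ae_eq_integral => //.
- exact: (measurable_fun_fubini_tonelli_G (m1 := PR) H mH H0).
- by apply: measurable_stable_exponent; exact: measurable_funP.
- by move=> v _; apply: integral_ge0 => w _; exact: H0.
- by move=> v _; exact: stable_exponent_ge0.
- have h v : 0 < V v -> setT v -> (\int[PR]_w H (w, v) = stable_exponent (V v))%E.
    by move=> Vv _; exact: (mean_biased_exponent Vv).
  by move: V0; apply: filterS => v Vv; exact: h.
Qed.

End mixture_identity.

Lemma levy_density_integral (K : realType) (nu : {measure set K -> \bar K})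
    (rho f : K -> K) :
  levy_density nu rho -> measurable_fun setT f -> (forall x, 0 < x -> 0 <= f x) ->
  (\int[nu]_(x in `]0%R, +oo[) (f x)%:E =
   \int[lebesgue_measure]_(x in `]0%R, +oo[) (f x * rho x)%:E)%E.
Proof.
move=> [mrho rho0 nuE] mf f0.
pose D : set K := `]0, +oo[%classic.
pose g : K -> \bar K := (EFin \o f) \_ D.
have mD : measurable D by exact: measurable_itv.
have mg : measurable_fun setT g.
  apply: (measurable_restrictT (EFin \o f) mD).1.
  by apply: measurable_funTS; exact/measurable_EFinP.
have g0 x : (0 <= g x)%E.
  rewrite /g patchE; case: ifPn => //; rewrite inE /D/= in_itv/= andbT => x0.
  by rewrite lee_fin f0.
transitivity (\int[nu]_x g x)%E; first by rewrite [LHS]integral_mkcond.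
have mid : measurable_fun (D : set (measurableTypeR K)) (fun x : measurableTypeR K => (x : K)).
  exact: measurable_id.
rewrite (@ge0_integral_density _ _ (measurableTypeR K) K K (@lebesgue_measure K) nu D
  (fun x => x) rho (measurable_itv _) mid mrho)//.
- apply: eq_integral => x /[!inE] Dx.
  by rewrite /g patchE mem_set.
- by move=> x; rewrite /D/= in_itv/= andbT => x0; exact: rho0.
- by move=> E mE; rewrite nuE// setIC.
Qed.

(** * Power-biased laws *)

Section power_bias.
Context (K : realType) d (O : measurableType d) (P : probability O K)
  (Y : {RV P >-> K}) (a : K) d' (O' : measurableType d') (P' : probability O' K)
  (Ya : {RV P' >-> K}).
Hypothesis bias : power_biased P Y a P' Ya.

Let c := expect P (fun w => Y w `^ a).

Let mYa : measurable_fun setT (fun w => Y w `^ a).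
Proof. exact: (measurableT_comp (@measurable_powR K a)). Qed.

Let biasE : exists k : K, forall E : set K, measurable E ->
  (P' (Ya @^-1` E) = k%:E * \int[P]_(w in Y @^-1` E) (Y w `^ a)%:E)%E.
Proof.
have [k kE] := bias; exists k => E mE; rewrite kE//; congr (_ * _)%E.
rewrite ge0_integral_pushforward//.
- apply: measurable_funTS; apply/measurable_EFinP; exact: measurable_powR.
- by move=> y _; rewrite lee_fin powR_ge0.
Qed.

(** The normalising constant of the biased law forces the moment to be finite
    and positive. *)
Lemma power_biased_moment :
  0 < c /\ (c%:E = \int[P]_w (Y w `^ a)%:E)%E.
Proof.
have [k kE] := biasE.
have := kE setT measurableT; rewrite !preimage_setT probability_setT => k1.
have I0 : (0 <= \int[P]_w (Y w `^ a)%:E)%E.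
  by apply: integral_ge0 => w _; rewrite lee_fin powR_ge0.
have cE : c = fine (\int[P]_w (Y w `^ a)%:E)%E by rewrite /c /expect unlock.
move: I0 k1 cE; case: (integral P _ _) => [r| |//]; last first.
  move=> _; have [k0|k0|<-] := ltgtP 0 k.
  - by rewrite gt0_muley// lte_fin.
  - by rewrite lt0_muley// lte_fin.
  - by rewrite mul0e => /eqP; rewrite eqe oner_eq0.
rewrite lee_fin => r0 /eqP; rewrite -EFinM eqe => /eqP kr ->; split => //=.
rewrite lt_neqAle r0 andbT eq_sym; apply/eqP => r00.
by move: kr; rewrite r00 mulr0 => /eqP; rewrite oner_eq0.
Qed.

Lemma ge0_integral_power_biased (f : K -> \bar K) :
  measurable_fun setT f -> (forall y, 0 <= f y)%E ->
  (c%:E * \int[P']_w f (Ya w) = \int[P]_w (f (Y w) * (Y w `^ a)%:E))%E.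
Proof.
move=> mf f0; have [c0 cE] := power_biased_moment.
have [k kE] := biasE.
have ck : k * c = 1.
  have := kE setT measurableT; rewrite !preimage_setT probability_setT -cE.
  by rewrite -EFinM => /eqP; rewrite eqe => /eqP ->.
have k0 : 0 <= k by rewrite -(pmulr_lge0 _ c0) ck.
rewrite -(ge0_integral_distribution Ya mf f0).
rewrite (@ge0_integral_density _ _ _ _ K P (distribution P' Ya) setT Y
  (fun w => k * Y w `^ a) measurableT _ _ _ _ f mf f0).
- rewrite -ge0_integralZl//.
  + apply: eq_integral => w _.
    by rewrite muleCA -EFinM mulrA [c * k]mulrC ck mul1r.
  + apply: emeasurable_funM; first exact: measurableT_comp.
    by apply/measurable_EFinP; exact: measurable_funM.
  + by move=> w _; rewrite mule_ge0// lee_fin mulr_ge0// powR_ge0.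
  + by rewrite lee_fin ltW.
- exact: measurable_funP.
- exact: measurable_funM.
- by move=> w _; rewrite mulr_ge0// powR_ge0.
- move=> E mE; rewrite setTI [LHS](_ : _ = P' (Ya @^-1` E))// kE//.
  rewrite -ge0_integralZl//.
  + by rewrite -[X in measurable X]setTI; exact: measurable_funP.
  + by apply: measurable_funTS; exact/measurable_EFinP.
  + by move=> w _; rewrite lee_fin powR_ge0.
Qed.

Lemma power_biased_positive : ae_positive P Y -> ae_positive P' Ya.
Proof.
move=> Y0; have [k kE] := biasE.
have m0 : measurable (`]-oo, 0]%classic : set K) by exact: measurable_itv.
have mYm : measurable (Ya @^-1` `]-oo, 0]).
  by rewrite -[X in measurable X]setTI; exact: measurable_funP.
have mY : measurable (Y @^-1` `]-oo, 0]).
  by rewrite -[X in measurable X]setTI; exact: measurable_funP.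
exists (Ya @^-1` `]-oo, 0]); split => //.
- have PN : P (Y @^-1` `]-oo, 0]) = 0%E := cdf_eq0 Y0 (lexx 0).
  rewrite kE// (ge0_negligible_integral mY mY _ _ PN).
  + by rewrite setDv integral_set0 mule0.
  + by apply: measurable_funTS; exact/measurable_EFinP.
  + by move=> w _; rewrite lee_fin powR_ge0.
- by move=> w /= /negP; rewrite -leNgt in_itv.
Qed.

End power_bias.

(** * Gamma laws and the variable V *)

Section gamma_facts.
Context (K : realType).

Lemma Gamma_ge0 (a : K) : 0 <= Gamma a.
Proof.
apply: fine_ge0; apply: integral_ge0 => x _.
by rewrite lee_fin mulr_ge0 ?powR_ge0 ?expR_ge0.
Qed.

Lemma cgmy_const_ge0 (alpha : K) : 0 <= cgmy_const alpha.
Proof. by rewrite /cgmy_const divr_ge0 ?mulr_ge0 ?powR_ge0 ?Gamma_ge0. Qed.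

Context d (O : measurableType d) (P : probability O K) (a : K) (g : {RV P >-> K}).
Hypothesis glaw : gamma_law P a g.

Lemma gamma_law_positive : ae_positive P g.
Proof.
exists (g @^-1` `]-oo, 0]); split.
- by rewrite -[X in measurable X]setTI; exact: measurable_funP.
- rewrite glaw; last exact: measurable_itv.
  rewrite (_ : _ `&` _ = set0) ?integral_set0//.
  apply/seteqP; split => // x [/=]; rewrite !in_itv/= andbT => x0.
  by rewrite ltNge x0.
- by move=> w /= /negP; rewrite -leNgt in_itv.
Qed.

(** Division by [Gamma a = 0] would make the gamma law the zero measure. *)
Lemma gamma_law_gt0 : 0 < Gamma a.
Proof.
rewrite lt_neqAle Gamma_ge0 andbT eq_sym; apply/eqP => G0.
have := glaw measurableT; rewrite preimage_setT probability_setT.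
under eq_integral do rewrite G0 invr0 mulr0.
by rewrite integral0 => /eqP; rewrite eqe oner_eq0.
Qed.

Lemma ge0_integral_gamma_law (f : K -> \bar K) :
  measurable_fun setT f -> (forall x, 0 <= f x)%E ->
  (\int[P]_w f (g w) = \int[lebesgue_measure]_(x in `]0%R, +oo[)
     (f x * (x `^ (a - 1) * expR (- x) / Gamma a)%:E))%E.
Proof.
move=> mf f0; rewrite -(ge0_integral_distribution g mf f0).
have mid : measurable_fun (`]0%R, +oo[%classic : set (measurableTypeR K))
   (fun x : measurableTypeR K => (x : K)) by exact: measurable_id.
have := @ge0_integral_density _ _ (measurableTypeR K) K K (@lebesgue_measure K)
  (distribution P g) `]0, +oo[%classic (fun x => x)
  (fun x => x `^ (a - 1) * expR (- x) / Gamma a) (measurable_itv _) mid.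
apply => //.
- apply: measurable_funTS; apply: measurable_funM => //.
  apply: measurable_funM; first exact: measurable_powR.
  by apply: measurableT_comp => //; exact: measurableT_comp.
- by move=> x _; rewrite divr_ge0 ?mulr_ge0 ?powR_ge0 ?expR_ge0 ?Gamma_ge0.
- by move=> E mE; rewrite [LHS](_ : _ = P (g @^-1` E))// glaw// setIC.
Qed.

End gamma_facts.

Section cgmy_variable.
Context (K : realType) (alpha G M : K) d (O : measurableType d)
  (P : probability O K) (g h : {RV P >-> K}).
Hypotheses (G0 : 0 < G) (M0 : 0 < M).
Hypotheses (glaw : gamma_law P alpha g) (hlaw : gamma_law P (1 / 2) h).
Context dV (OV : measurableType dV) (PV : probability OV K) (V : {RV PV >-> K}).
Hypothesis Vlaw : eq_in_law PV V P (cgmyV G M g h).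

Lemma cgmyB_gt0 : 0 < cgmyB G M.
Proof. by rewrite /cgmyB divr_gt0// addr_gt0. Qed.

Lemma cgmyV_positive : ae_positive PV V.
Proof.
have [_ mV' VE] := Vlaw.
have mI : measurable (`]-oo, 0]%classic : set K) by exact: measurable_itv.
have : {ae P, forall w, 0 < cgmyV G M g h w}.
  have := gamma_law_positive glaw; apply: filterS2 (gamma_law_positive hlaw) => w h0 g0.
  rewrite /cgmyV; apply: divr_gt0 => //; apply: addr_gt0; first exact: mulr_gt0.
  by apply: mulr_gt0; [exact/exprn_gt0/cgmyB_gt0|exact: divr_gt0].
move=> [N [mN N0 subN]].
exists (V @^-1` `]-oo, 0]); split.
- by rewrite -[X in measurable X]setTI; exact: measurable_funP.
- rewrite VE//; apply/eqP; rewrite eq_le measure_ge0 andbT -N0; apply: le_measure.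
  + by rewrite inE -[X in measurable X]setTI; exact: mV'.
  + by rewrite inE.
  + move=> w /=; rewrite in_itv/= => h0; apply: subN => /=.
    by apply/negP; rewrite -leNgt.
- by move=> w /= /negP; rewrite -leNgt in_itv.
Qed.

End cgmy_variable.

(** * Levy densities as mixtures *)

(** Expectations are real-valued, and [s > 0] makes the variables bounded, by
    [1] and [1 / s]; this is where they are turned into extended integrals. *)
Section laplace_moments.
Context (K : realType) d (O : measurableType d) (P : probability O K) (X : O -> K).
Hypotheses (mX : measurable_fun setT X) (X0 : ae_positive P X).
Variable s : K.
Hypothesis s0 : 0 < s.

Let Xp w := Num.max 0 (X w).

Let Xp0 w : 0 <= Xp w. Proof. by rewrite le_max lexx. Qed.

Let mXp : measurable_fun setT Xp. Proof. exact: measurable_maxr. Qed.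

Let XpE : {ae P, forall w, X w = Xp w}.
Proof. by apply: filterS X0 => w Xw; rewrite /Xp max_r// ltW. Qed.

Let mexp (Z : O -> K) : measurable_fun setT Z ->
  measurable_fun setT (fun w => expR (- (s * Z w))).
Proof.
by move=> mZ; apply: measurableT_comp => //; apply: measurableT_comp => //; exact: measurable_funM.
Qed.

Let expect_ae (f g : O -> K) (c : K) : measurable_fun setT f -> measurable_fun setT g ->
  {ae P, forall w, f w = g w} -> (forall w, 0 <= g w <= c) ->
  ((expect P f)%:E = \int[P]_w (g w)%:E)%E.
Proof.
move=> mf mg fg g0; rewrite /expect unlock.
have -> : (\int[P]_w (f w)%:E = \int[P]_w (g w)%:E)%E.
  apply: ae_eq_integral => //; first exact/measurable_EFinP.
    exact/measurable_EFinP.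
  by apply: filterS fg => w -> _.
rewrite fineK//; apply: integrable_fin_num => //.
apply: (@bounded_prob_integrable _ _ _ _ _ c) => // w.
by have /andP[g1 g2] := g0 w; rewrite ger0_norm.
Qed.

Lemma expect_expR :
  ((expect P (fun w => expR (- (s * X w))))%:E =
   \int[P]_w (expR (- (s * Num.max 0 (X w))))%:E)%E.
Proof.
apply: (@expect_ae _ _ 1).
- exact: mexp.
- exact: mexp.
- by apply: filterS XpE => w Xw; rewrite -/(Xp w) -Xw.
- by move=> w; rewrite expR_ge0 expR_le1 oppr_le0 mulr_ge0 ?Xp0// ltW.
Qed.

Lemma expect_mul_expR :
  ((expect P (fun w => X w * expR (- (s * X w))))%:E =
   \int[P]_w (Num.max 0 (X w) * expR (- (s * Num.max 0 (X w))))%:E)%E.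
Proof.
apply: (@expect_ae _ _ (s^-1)).
- by apply: measurable_funM => //; exact: mexp.
- by apply: measurable_funM => //; exact: mexp.
- by apply: filterS XpE => w Xw; rewrite -/(Xp w) -Xw.
- move=> w; rewrite -/(Xp w) mulr_ge0 ?Xp0 ?expR_ge0//= expRN ler_pdivrMr ?expR_gt0//.
  rewrite mulrC ler_pdivlMr// mulrC (le_trans _ (expR_ge1Dx _))//.
  by rewrite lerDr.
Qed.

Lemma expect_mixture_kernel (alpha delta : K) : 0 < alpha -> 0 < delta ->
  (((1 + alpha / delta) * s `^ (- alpha - 1) * expect P (fun w => expR (- (s * X w)))
   + delta^-1 * s `^ (- alpha) * expect P (fun w => X w * expR (- (s * X w))))%:E =
   \int[P]_w (mixture_kernel alpha delta s (X w))%:E)%E.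
Proof.
move=> alpha0 delta0; rewrite EFinD !(EFinM (_ * _)) expect_expR expect_mul_expR.
have a0 : 0 <= (1 + alpha / delta) * s `^ (- alpha - 1).
  by rewrite mulr_ge0 ?powR_ge0// addr_ge0// divr_ge0// ltW.
have b0 : 0 <= delta^-1 * s `^ (- alpha) by rewrite mulr_ge0 ?powR_ge0// invr_ge0 ltW.
pose f1 w := (expR (- (s * Xp w)))%:E; pose f2 w := (Xp w * expR (- (s * Xp w)))%:E.
have mf1 : measurable_fun setT f1 by apply/measurable_EFinP; exact: mexp.
have mf2 : measurable_fun setT f2.
  by apply/measurable_EFinP; apply: measurable_funM => //; exact: mexp.
have f10 w : (0 <= f1 w)%E by rewrite lee_fin expR_ge0.
have f20 w : (0 <= f2 w)%E by rewrite lee_fin mulr_ge0 ?expR_ge0// Xp0.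
have Zl (a : K) (f : O -> \bar K) : 0 <= a -> measurable_fun setT f -> (forall w, 0 <= f w)%E ->
    (a%:E * \int[P]_w f w = \int[P]_w (a%:E * f w))%E.
  by move=> a1 mf f0; rewrite ge0_integralZl.
rewrite (Zl _ f1 a0 mf1 f10) (Zl _ f2 b0 mf2 f20) -ge0_integralD//.
- apply: eq_integral => w _; rewrite /f1 /f2 -!EFinM -EFinD; congr EFin.
  by rewrite /mixture_kernel -/(Xp w); ring.
- by move=> w _; rewrite mule_ge0.
- exact: emeasurable_funM.
- by move=> w _; rewrite mule_ge0.
- exact: emeasurable_funM.
Qed.

End laplace_moments.

Section exponents.
Context (K : realType) (alpha delta : K).
Hypotheses (alpha0 : 0 < alpha) (delta0 : 0 < delta).
Context dV (OV : measurableType dV) (PV : probability OV K) (V Ya : {RV PV >-> K}).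
Hypothesis V0 : ae_positive PV V.
Context dR (OR : measurableType dR) (PR : probability OR K) (Y : {RV PR >-> K}).
Hypotheses (Y0 : ae_positive PR Y) (Ya_law : power_biased PR Y alpha PV Ya)
  (Ya_indep : independent2 PV V Ya).

Let c := expect PR (fun w => Y w `^ alpha).
Let C := cgmy_const alpha.

Let C0 : 0 <= C. Proof. exact: cgmy_const_ge0. Qed.

Lemma ratio_positive : ae_positive PV (fun w => V w / Ya w).
Proof.
have := power_biased_positive Ya_law Y0; apply: filterS2 V0 => w Vw Yw.
exact: divr_gt0.
Qed.

Lemma measurable_ratio : measurable_fun setT (fun w => V w / Ya w).
Proof. by apply: measurable_funM => //; exact: measurable_fun_inv. Qed.

Let mk_ge0 := mixture_kernel_ge0 alpha0 delta0.

(** The constant [c] of [rho_L] is the normalising constant of the law of [Ya],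
    so that the law of [Ya] is traded for that of [Y] with weight [Y ^ alpha]. *)
Lemma rho_L_mixture s : 0 < s ->
  ((rho_L alpha delta c PV V Ya s)%:E =
   C%:E * \int[PV]_v \int[PR]_w
     ((Y w `^ alpha)%:E * (mixture_kernel alpha delta s (V v / Y w))%:E))%E.
Proof.
move=> s0.
have [c0 _] := power_biased_moment Ya_law.
transitivity (C%:E * (c%:E *
    \int[PV]_w (mixture_kernel alpha delta s (V w / Ya w))%:E))%E.
  rewrite -(expect_mixture_kernel measurable_ratio ratio_positive s0 alpha0 delta0).
  rewrite -!EFinM /rho_L -/C; congr EFin; ring.
congr (_ * _)%E.
pose f (z : K * K) := (mixture_kernel alpha delta s (z.1 / z.2))%:E.
have mf : measurable_fun setT f.
  apply/measurable_EFinP; apply: measurable_mixture_kernel; first exact: measurable_cst.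
  by apply: measurable_funM; [exact: measurable_fst|
    apply: measurable_fun_inv; exact: measurable_snd].
have f0 z : (0 <= f z)%E by rewrite lee_fin mk_ge0.
rewrite (@ge0_integral_independent2 _ _ _ _ V Ya f Ya_indep mf f0).
pose F (z : OV * OV) := f (V z.1, Ya z.2).
have mF : measurable_fun setT F.
  apply: (measurableT_comp mf); apply: measurable_fun_pair.
    exact: (measurableT_comp (measurable_funP V) measurable_fst).
  exact: (measurableT_comp (measurable_funP Ya) measurable_snd).
rewrite -ge0_integralZl//; last 3 first.
- exact: (measurable_fun_fubini_tonelli_F (m2 := PV) F mF (fun z => f0 _)).
- by move=> v _; apply: integral_ge0 => w _; exact: f0.
- by rewrite lee_fin ltW.
apply: eq_integral => v _.
rewrite (ge0_integral_power_biased Ya_law (f := fun y => f (V v, y))).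
- by apply: eq_integral => w _; rewrite muleC.
- exact: (measurableT_comp mf (measurable_pair1 _)).
- by move=> y; exact: f0.
Qed.

Variables (theta r : K).
Hypotheses (theta0 : 0 <= theta) (r0 : 0 < r).

Let eta := theta * r.

Let eta0 : 0 <= eta. Proof. by rewrite mulr_ge0// ltW. Qed.

Let ker_ge0 (s : K) : 0 <= exponent_kernel eta s.
Proof. exact: exponent_kernel_ge0. Qed.

Let G (z : (measurableTypeR K * OV) * OR) : \bar K :=
  ((Y z.2 `^ alpha)%:E *
   (exponent_kernel eta z.1.1 * mixture_kernel alpha delta z.1.1 (V z.1.2 / Y z.2))%:E)%E.

Let G0 z : (0 <= G z)%E.
Proof.
by apply: mule_ge0; rewrite lee_fin ?powR_ge0//; apply: mulr_ge0; [exact: ker_ge0|exact: mk_ge0].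
Qed.

Let mG : measurable_fun setT G.
Proof.
have mY : measurable_fun setT (fun z : (measurableTypeR K * OV) * OR => Y z.2).
  exact: (measurableT_comp (measurable_funP Y) measurable_snd).
apply: emeasurable_funM.
  by apply/measurable_EFinP; exact: (measurableT_comp (@measurable_powR K alpha)).
apply: measurable_exponent_mixture_kernel.
  exact: (measurableT_comp measurable_fst measurable_fst).
apply: measurable_funM; last exact: measurable_fun_inv.
apply: (measurableT_comp (measurable_funP V)).
exact: (measurableT_comp measurable_snd measurable_fst).
Qed.

Let H (z : measurableTypeR K * OV) : \bar K := (\int[PR]_w G (z, w))%E.

Let H0 z : (0 <= H z)%E. Proof. by apply: integral_ge0 => w _; exact: G0. Qed.

Let mH : measurable_fun setT H.
Proof. exact: (measurable_fun_fubini_tonelli_F (m2 := PR) G mG G0). Qed.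

Let mix (s : K) (v : OV) : \bar K := (\int[PR]_w
     ((Y w `^ alpha)%:E * (mixture_kernel alpha delta s (V v / Y w))%:E))%E.

Let mmix1 s v : measurable_fun setT (fun w =>
  (Y w `^ alpha)%:E * (mixture_kernel alpha delta s (V v / Y w))%:E)%E.
Proof.
apply: emeasurable_funM.
  by apply/measurable_EFinP; exact: (measurableT_comp (@measurable_powR K alpha)).
apply/measurable_EFinP; apply: measurable_mixture_kernel; first exact: measurable_cst.
by apply: measurable_funM => //; exact: measurable_fun_inv.
Qed.

Let HE s v : H (s, v) = ((exponent_kernel eta s)%:E * mix s v)%E.
Proof.
rewrite /H /mix -ge0_integralZl//; last 2 first.
- by move=> w _; apply: mule_ge0; rewrite lee_fin ?powR_ge0.
- by rewrite lee_fin.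
by apply: eq_integral => w _; rewrite /G /= EFinM muleCA.
Qed.

Let mmix s : measurable_fun setT (mix s).
Proof.
pose F (z : OV * OR) : \bar K :=
  ((Y z.2 `^ alpha)%:E * (mixture_kernel alpha delta s (V z.1 / Y z.2))%:E)%E.
have mY : measurable_fun setT (fun z : OV * OR => Y z.2).
  exact: (measurableT_comp (measurable_funP Y) measurable_snd).
have mF : measurable_fun setT F.
  apply: emeasurable_funM.
    by apply/measurable_EFinP; exact: (measurableT_comp (@measurable_powR K alpha)).
  apply/measurable_EFinP; apply: measurable_mixture_kernel; first exact: measurable_cst.
  apply: measurable_funM; last exact: measurable_fun_inv.
  exact: (measurableT_comp (measurable_funP V) measurable_fst).
apply: (measurable_fun_fubini_tonelli_F (m2 := PR) F mF) => z.
by apply: mule_ge0; rewrite lee_fin ?powR_ge0.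
Qed.

Let inner v : (\int[lebesgue_measure]_s H (s, v) =
  \int[PR]_w biased_exponent alpha delta theta (V v) (r * Y w))%E.
Proof.
pose F (z : measurableTypeR K * OR) := G ((z.1, v), z.2).
have mF : measurable_fun setT F.
  apply: (measurableT_comp mG); apply: measurable_fun_pair; last exact: measurable_snd.
  by apply: measurable_fun_pair; [exact: measurable_fst|exact: measurable_cst].
have F0 z : (0 <= F z)%E by exact: G0.
transitivity (\int[PR]_w \int[lebesgue_measure]_s F (s, w))%E.
  exact: (fubini_tonelli (m1 := lebesgue_measure) (m2 := PR) F mF F0).
have FE w : (\int[lebesgue_measure]_s F (s, w) =
    (Y w `^ alpha)%:E * mixture_exponent alpha delta eta (V v / Y w))%E.
  rewrite /F /G/= /mixture_exponent ge0_integralZl//.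
  - by apply: measurable_exponent_mixture_kernel => //; exact: measurable_id.
  - by move=> s _; rewrite lee_fin; apply: mulr_ge0.
  - by rewrite lee_fin powR_ge0.
apply: ge0_ae_eq_integral => //.
- exact: (measurable_fun_fubini_tonelli_G (m1 := lebesgue_measure) F mF F0).
- by apply: measurable_biased_exponent => //; exact: measurable_funM.
- by move=> w _; apply: integral_ge0.
- by move=> w _; exact: biased_exponent_ge0.
- have e w : 0 < Y w -> setT w -> (\int[lebesgue_measure]_s F (s, w) =
      biased_exponent alpha delta theta (V v) (r * Y w))%E.
    move=> Yw _; rewrite FE /eta mixture_exponent_scale// /biased_exponent.
    have e1 : (r * Y w) `^ alpha = Y w `^ alpha * r `^ alpha.
      by rewrite powRM ?(ltW r0) ?(ltW Yw)// mulrC.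
    have e2 : V v / (r * Y w) = V v / Y w / r by rewrite invfM -mulrA [r^-1 * _]mulrC.
    by rewrite e1 e2 EFinM muleA.
  by move: Y0; apply: filterS => w Yw; exact: e.
Qed.

Context (dL : measure_display) (OL : measurableType dL) (PL : probability OL K)
  (L : K -> OL -> K) (nu : {measure set K -> \bar K}).
Hypotheses (sL : subordinator PL L nu)
  (nuL : levy_density nu (rho_L alpha delta c PV V Ya)).

(** The weight [Y ^ alpha] and the factor [r ^ alpha] produced by scaling
    combine into the weight [(r Y) ^ alpha] of [biased_exponent]. *)
Lemma laplace_exponent_rho_L :
  ((laplace_exponent nu (theta * r))%:E =
   C%:E * \int[PV]_v \int[PR]_w biased_exponent alpha delta theta (V v) (r * Y w))%E.
Proof.
rewrite (laplace_exponentE sL eta0) (levy_density_integral nuL); last 2 first.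
- exact: measurable_one_minus_expR.
- by move=> x x0; rewrite one_minus_expR_ge0// ltW.
transitivity (\int[lebesgue_measure]_s (C%:E * \int[PV]_v H (s, v)))%E.
  rewrite integral_mkcond; apply: eq_integral => s _; rewrite patchE.
  have mixv : (\int[PV]_v H (s, v) = (exponent_kernel eta s)%:E * \int[PV]_v mix s v)%E.
    under eq_integral do rewrite HE.
    rewrite ge0_integralZl//; last by rewrite lee_fin.
    move=> v _; apply: integral_ge0 => w _.
    by apply: mule_ge0; rewrite lee_fin ?powR_ge0.
  rewrite mixv /exponent_kernel indicE.
  case: ifPn => [|_]; last by rewrite mul0r mul0e mule0.
  rewrite inE/= in_itv/= andbT => s0; rewrite mul1r EFinM rho_L_mixture//.
  by rewrite muleCA.
rewrite ge0_integralZl//; last 2 first.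
- exact: (measurable_fun_fubini_tonelli_F (m2 := PV) H mH H0).
- by move=> s _; apply: integral_ge0.
congr (_ * _)%E.
transitivity (\int[PV]_v \int[lebesgue_measure]_s H (s, v))%E.
  exact: (fubini_tonelli (m1 := lebesgue_measure) (m2 := PV) H mH H0).
by apply: eq_integral => v _; exact: inner.
Qed.

End exponents.

Section zeta_exponent.
Context (K : realType) (alpha G M : K).
Hypotheses (G0 : 0 < G) (M0 : 0 < M).
Context dg (Og : measurableType dg) (Pg : probability Og K) (g h : {RV Pg >-> K}).
Hypotheses (glaw : gamma_law Pg alpha g) (hlaw : gamma_law Pg (1 / 2) h).
Context dV (OV : measurableType dV) (PV : probability OV K) (V : {RV PV >-> K}).
Hypothesis Vlaw : eq_in_law PV V Pg (cgmyV G M g h).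

Let C := cgmy_const alpha.

(** The tilt in [rho_zeta] is the constant part of [V]:
    [(A ^ 2 - B ^ 2) / 2 = - M G / 2]. *)
Lemma rho_zetaE s : rho_zeta alpha G M Pg g h s =
  C * s `^ (- alpha - 1) * expect PV (fun w => expR (- (s * V w))).
Proof.
have mh : measurable_fun setT (fun w => g w / h w).
  by apply: measurable_funM => //; exact: measurable_fun_inv.
have mexp (b : K) : measurable_fun setT (fun w => expR (- (s * (b * (g w / h w))))).
  apply: measurableT_comp => //; apply: measurableT_comp => //.
  by apply: measurable_funM => //; exact: measurable_funM.
have -> : expect PV (fun w => expR (- (s * V w))) =
    expect Pg (fun w => expR (- (s * cgmyV G M g h w))).
  rewrite /expect unlock; congr fine.
  apply: (ge0_integral_eq_in_law (f := fun x => (expR (- (s * x)))%:E) Vlaw).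
  - by apply/measurable_EFinP; apply: measurableT_comp => //; exact: measurableT_comp.
  - by move=> x; rewrite lee_fin expR_ge0.
have -> : expect Pg (fun w => expR (- (s * cgmyV G M g h w))) =
    expR (- (s * (M * G / 2))) *
    expect Pg (fun w => expR (- (s * (cgmyB G M ^+ 2 / 2 * (g w / h w))))).
  rewrite /expect unlock.
  have -> : (\int[Pg]_w (expR (- (s * cgmyV G M g h w)))%:E =
    (expR (- (s * (M * G / 2))))%:E * \int[Pg]_w
    (expR (- (s * (cgmyB G M ^+ 2 / 2 * (g w / h w)))))%:E)%E.
    rewrite -ge0_integralZl//.
    + apply: eq_integral => w _; rewrite -EFinM -expRD /cgmyV; congr (expR _)%:E.
      by move: (g w / h w) => x; field.
    + by apply/measurable_EFinP; exact: mexp.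
  set I := (\int[Pg]_w _)%E.
  have I0 : (0 <= I)%E by apply: integral_ge0 => w _; rewrite lee_fin expR_ge0.
  case: I I0 => [x _| _|//]; first by rewrite -EFinM.
  by rewrite gt0_muley ?lte_fin ?expR_gt0//= mulr0.
have eA : (cgmyA G M ^+ 2 - cgmyB G M ^+ 2) * s / 2 = - (s * (M * G / 2)).
  by rewrite /cgmyA /cgmyB; field.
by rewrite /rho_zeta -/C eA; ring.
Qed.

Lemma ge0_expect_exp s : 0 < s ->
  ((expect PV (fun w => expR (- (s * V w))))%:E = \int[PV]_w (expR (- (s * V w)))%:E)%E.
Proof.
move=> s0; rewrite (expect_expR _ _ s0)//; last exact: (cgmyV_positive G0 M0 glaw hlaw Vlaw).
apply: ae_eq_integral => //.
- apply/measurable_EFinP; apply: measurableT_comp => //; apply: measurableT_comp => //.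
  by apply: measurable_funM => //; exact: measurable_maxr.
- apply/measurable_EFinP; apply: measurableT_comp => //; apply: measurableT_comp => //.
  exact: measurable_funM.
- have := cgmyV_positive G0 M0 glaw hlaw Vlaw; apply: filterS => w Vw _.
  by rewrite max_r// ltW.
Qed.

Context (dL : measure_display) (OL : measurableType dL) (PL : probability OL K)
  (L : K -> OL -> K) (nu : {measure set K -> \bar K}).
Hypotheses (sL : subordinator PL L nu)
  (nuL : levy_density nu (rho_zeta alpha G M Pg g h)).

Lemma laplace_exponent_rho_zeta theta : 0 <= theta ->
  ((laplace_exponent nu theta)%:E =
   C%:E * \int[PV]_v stable_exponent alpha theta (V v))%E.
Proof.
move=> theta0.
have C0 : 0 <= C by exact: cgmy_const_ge0.
pose H (z : measurableTypeR K * OV) : \bar K := (exponent_kernel theta z.1 *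
     (z.1 `^ (- alpha - 1) * expR (- (z.1 * V z.2))))%:E.
have H0 z : (0 <= H z)%E.
  by rewrite lee_fin mulr_ge0 ?exponent_kernel_ge0 ?mulr_ge0 ?powR_ge0 ?expR_ge0.
have mH : measurable_fun setT H.
  apply: measurable_stable_kernel; first exact: measurable_fst.
  exact: (measurableT_comp (measurable_funP V) measurable_snd).
rewrite (laplace_exponentE sL theta0) (levy_density_integral nuL); last 2 first.
- exact: measurable_one_minus_expR.
- by move=> x x0; rewrite one_minus_expR_ge0// ltW.
transitivity (\int[lebesgue_measure]_s (C%:E * \int[PV]_v H (s, v)))%E.
  rewrite integral_mkcond; apply: eq_integral => s _; rewrite patchE.
  have HE : (\int[PV]_v H (s, v) = (exponent_kernel theta s * s `^ (- alpha - 1))%:E *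
      \int[PV]_v (expR (- (s * V v)))%:E)%E.
    rewrite -ge0_integralZl//.
    - by apply: eq_integral => v _; rewrite /H/= -EFinM mulrA.
    - apply/measurable_EFinP; apply: measurableT_comp => //; apply: measurableT_comp => //.
      exact: measurable_funM.
    - by rewrite lee_fin mulr_ge0 ?exponent_kernel_ge0 ?powR_ge0.
  rewrite HE /exponent_kernel indicE.
  case: ifPn => [|_]; last by rewrite !mul0r mul0e mule0.
  rewrite inE/= in_itv/= andbT => s0; rewrite mul1r -ge0_expect_exp// rho_zetaE.
  by rewrite -!EFinM; congr EFin; ring.
rewrite ge0_integralZl//; last 2 first.
- exact: (measurable_fun_fubini_tonelli_F (m2 := PV) H mH H0).
- by move=> s _; apply: integral_ge0.
congr (_ * _)%E.
exact: (fubini_tonelli (m1 := lebesgue_measure) (m2 := PV) H mH H0).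
Qed.

End zeta_exponent.

(** * The exponent of the clock is that of zeta *)

Section exponent_identity.
Context (K : realType) (alpha delta G M : K).
Hypotheses (alpha0 : 0 < alpha) (delta0 : 0 < delta) (G0 : 0 < G) (M0 : 0 < M).
Context dg (Og : measurableType dg) (Pg : probability Og K) (g h : {RV Pg >-> K}).
Hypotheses (glaw : gamma_law Pg alpha g) (hlaw : gamma_law Pg (1 / 2) h).
Context dV (OV : measurableType dV) (PV : probability OV K) (V Ya : {RV PV >-> K}).
Hypothesis Vlaw : eq_in_law PV V Pg (cgmyV G M g h).
Context dR (OR : measurableType dR) (PR : probability OR K) (R Y : {RV PR >-> K}).
Hypotheses (R0 : ae_positive PR R) (Y0 : ae_positive PR Y)
  (RY_indep : independent2 PR R Y)
  (RY_law : eq_in_law PR (fun w => R w * Y w)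
    (uniform_prob (@ltr01 K)) (fun u => u `^ delta^-1))
  (Ya_law : power_biased PR Y alpha PV Ya) (Ya_indep : independent2 PV V Ya).
Context dL (OL : measurableType dL) (PL : probability OL K)
  (L : K -> OL -> K) (nuL : {measure set K -> \bar K}).
Hypotheses (sL : subordinator PL L nuL) (nuLE : levy_density nuL
    (rho_L alpha delta (expect PR (fun w => Y w `^ alpha)) PV V Ya)).
Context dZ (OZ : measurableType dZ) (PZ : probability OZ K)
  (Z : K -> OZ -> K) (nuZ : {measure set K -> \bar K}).
Hypotheses (sZ : subordinator PZ Z nuZ)
  (nuZE : levy_density nuZ (rho_zeta alpha G M Pg g h)).

(** This identity is what the Levy density of [L] is made for. *)
Lemma mean_laplace_exponent theta : 0 <= theta ->
  (\int[PR]_w (laplace_exponent nuL (theta * Num.max 0 (R w)))%:E =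
   (laplace_exponent nuZ theta)%:E)%E.
Proof.
move=> theta0.
have V0 : ae_positive PV V := cgmyV_positive G0 M0 glaw hlaw Vlaw.
have C0 : (0 <= (cgmy_const alpha)%:E)%E by rewrite lee_fin cgmy_const_ge0.
pose Xi w := (\int[PV]_v \int[PR]_w' biased_exponent alpha delta theta (V v) (R w * Y w'))%E.
have mXi : measurable_fun setT Xi by exact: measurable_mean_biased_exponent.
have Xi0 w : (0 <= Xi w)%E.
  by apply: integral_ge0 => v _; apply: integral_ge0 => w' _; exact: biased_exponent_ge0.
have max0 (y : K) : 0 <= Num.max 0 y by rewrite le_max lexx.
transitivity (\int[PR]_w ((cgmy_const alpha)%:E * Xi w))%E.
  apply: ge0_ae_eq_integral => //.
  - apply/measurable_EFinP.
    have mpsi : measurable_fun setT (fun y : K => laplace_exponent nuL (theta * Num.max 0 y)).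
      apply: nondecreasing_measurable; first exact: measurableT.
      move=> x y xy; apply: (le_laplace_exponent sL); first by rewrite mulr_ge0.
      by rewrite ler_wpM2l// ge_max max0/= le_max xy orbT.
    exact: (measurableT_comp mpsi (measurable_funP R)).
  - exact: emeasurable_funM.
  - by move=> w _; rewrite lee_fin laplace_exponent_ge0// mulr_ge0.
  - by move=> w _; rewrite mule_ge0.
  - have e w : 0 < R w -> setT w ->
       ((laplace_exponent nuL (theta * Num.max 0 (R w)))%:E = (cgmy_const alpha)%:E * Xi w)%E.
      move=> Rw _; rewrite max_r ?(ltW Rw)//.
      exact: (laplace_exponent_rho_L alpha0 delta0 V0 Y0 Ya_law Ya_indep theta0 Rw sL nuLE).
    by move: R0; apply: filterS => w Rw; exact: e.
rewrite ge0_integralZl//.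
rewrite (mean_mixture_exponent alpha0 delta0 theta0 RY_indep RY_law V0).
by rewrite -(laplace_exponent_rho_zeta G0 M0 glaw hlaw Vlaw sZ nuZE).
Qed.

End exponent_identity.

Section clock_law.
Context (K : realType).

Lemma eq_in_law_cst d d' (O : measurableType d) (P : probability O K)
    (O' : measurableType d') (P' : probability O' K) (a : K) :
  eq_in_law P (cst a) P' (cst a).
Proof.
split=> [||E mE]; [exact: measurable_cst|exact: measurable_cst|].
by rewrite !preimage_cst; case: ifP => _; rewrite ?probability_setT ?measure0.
Qed.

Lemma clock_eq_in_law dR (OR : measurableType dR) (PR : probability OR K)
    (R : {RV PR >-> K}) d (O : measurableType d) (P : probability O K)
    (L T : K -> O -> K) (nu : {measure set K -> \bar K})
    d' (O' : measurableType d') (P' : probability O' K)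
    (Z : K -> O' -> K) (nuZ : {measure set K -> \bar K}) (t : K) :
  quantile_clock PR P R L nu T -> subordinator P' Z nuZ -> 0 <= t ->
  (forall theta : K, (0 <= theta)%R ->
    \int[PR]_w (laplace_exponent nu (theta * Num.max 0 (R w)))%:E =
    (laplace_exponent nuZ theta)%:E)%E ->
  eq_in_law P (T t) P' (Z t).
Proof.
move=> cT sZ; rewrite le_eqVlt => /predU1P[<- _|t0 H].
  have -> : T 0 = cst 0 by apply/funext => w; rewrite (clock0 cT).
  have -> : Z 0 = cst 0 by apply/funext => w; rewrite (sub_start sZ).
  exact: eq_in_law_cst.
apply: eq_in_law_laplace.
- exact: (measurable_clock cT t0).
- exact: (sub_measurable sZ (ltW t0)).
- by move=> w; exact: (clock_ge0 cT _ (ltW t0)).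
- by move=> w; exact: (subordinator_ge0 sZ _ (ltW t0)).
move=> n; have n0 : 0 <= n%:R :> K by [].
by rewrite (clock_laplace cT t0 n0 (H _ n0)) (subordinator_laplace sZ (ltW t0) n0).
Qed.

End clock_law.

(** * Moments of V of order at least one half are infinite *)

Section fractional_moment.
Context (K : realType).

Let inv01 (s : K) : K := \1_(`]0, 1]%classic : set K) s * s^-1.

Let inv01_ge0 s : 0 <= inv01 s.
Proof.
rewrite /inv01 indicE; have [|] := boolP (s \in `]0, 1]%classic); last by rewrite mul0r.
by rewrite inE/= in_itv/= mul1r => /andP[s0 _]; rewrite invr_ge0 ltW.
Qed.

Let minv01 : measurable_fun setT inv01.
Proof.
apply: measurable_funM; first by apply: measurable_indic; exact: measurable_itv.
by apply: measurable_fun_inv; exact: measurable_id.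
Qed.

(** The integral [I] over the unit interval is, by scaling, also the integral over
    the interval of length [2], so that [I + 1 / 2 <= I]. *)
Lemma integral_inv_itv01 :
  (\int[lebesgue_measure]_(s in `]0%R, 1%R]) (s^-1)%:E = +oo :> \bar K)%E.
Proof.
have inv01E : (\int[lebesgue_measure]_s (inv01 s)%:E =
    \int[lebesgue_measure]_(s in `]0%R, 1%R]) (s^-1)%:E :> \bar K)%E.
  rewrite [RHS]integral_mkcond; apply: eq_integral => s _.
  by rewrite patchE /inv01 indicE; case: ifP => _; rewrite ?mul1r ?mul0r.
rewrite -inv01E; set I := (\int[_]_s _)%E.
pose f (s : K) : K := 2^-1 * \1_(`]1, 2]%classic : set K) s.
have f0 s : 0 <= f s by rewrite mulr_ge0.
have mf : measurable_fun setT f.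
  by apply: measurable_funM => //; apply: measurable_indic; exact: measurable_itv.
have I0 : (0 <= I)%E by apply: integral_ge0 => s _; rewrite lee_fin.
have fE : (\int[lebesgue_measure]_s (f s)%:E = (2^-1)%:E :> \bar K)%E.
  under eq_integral do rewrite EFinM.
  rewrite ge0_integralZl//; last first.
    by apply/measurable_EFinP; apply: measurable_indic; exact: measurable_itv.
  have e12 : lebesgue_measure (`]1, 2]%classic : set K) = 1%E.
    by rewrite lebesgue_measure_itv/= lte_fin ltr1n -EFinB mulr2n addrK.
  rewrite integral_indic// setIT [X in (_ * X)%E](_ : _ = 1%E); last exact: e12.
  by rewrite mule1.
have h : 0 < (2^-1 : K) by [].
suff : (I + (2^-1)%:E <= I)%E.
  by case: I I0 => [x| |]// _; rewrite -EFinD lee_fin gerDl leNgt h.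
rewrite -fE -ge0_integralD//; last 4 first.
- by move=> s _; rewrite lee_fin.
- exact/measurable_EFinP.
- by move=> s _; rewrite lee_fin.
- exact/measurable_EFinP.
have -> : I = (\int[lebesgue_measure]_s (2^-1 * inv01 (2^-1 * s))%:E)%E.
  rewrite [LHS](ge0_integral_lebesgue_scale h); last 2 first.
  - exact/measurable_EFinP.
  - by move=> s; rewrite lee_fin.
  rewrite -ge0_integralZl//.
  - apply/measurable_EFinP; apply: (measurableT_comp minv01).
    exact: measurable_funM.
  - by move=> s _; rewrite lee_fin.
apply: ge0_le_integral => //.
- by move=> s _; rewrite adde_ge0// lee_fin.
- by apply: emeasurable_funD; exact/measurable_EFinP.
- apply/measurable_EFinP; apply: measurable_funM => //.
  by apply: (measurableT_comp minv01); exact: measurable_funM.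
- move=> s _; rewrite -EFinD lee_fin /inv01 /f !indicE.
  have inI (a b x : K) : (x \in `]a, b]%classic) = (a < x <= b).
    by apply/idP/idP; rewrite inE/= in_itv.
  rewrite !inI pmulr_rgt0// ler_pdivrMl// mulr1.
  have -> : (2^-1 * s)^-1 = 2 * s^-1 by rewrite invfM invrK.
  rewrite [leRHS](_ : _ = (0 < s <= 2)%R%:R * s^-1); last first.
    by move: (s^-1) => x; field.
  have [s0|s0] := leP s 0.
    by rewrite !ltNge (le_trans s0)//= !mul0r mulr0 addr0.
  have [s1|s1] := leP s 1.
    by rewrite (le_trans s1) ?ler1n//= mulr0 addr0.
  rewrite mul0r add0r; have [s2|s2] := leP s 2; last by rewrite mulr0 mul0r.
  by rewrite mulr1 mul1r lef_pV2 ?posrE.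
Qed.

Context d (O : measurableType d) (P : probability O K) (h : {RV P >-> K}).
Hypothesis hlaw : gamma_law P (1 / 2) h.

(** On the unit interval the integrand is at least a multiple of
    [s ^ (- alpha) s ^ (- 1 / 2)], hence of [1 / s]. *)
Lemma gamma_half_moment_infty (alpha k : K) : 1 / 2 <= alpha -> 0 < k ->
  (\int[P]_w ((k / h w) `^ alpha)%:E = +oo)%E.
Proof.
move=> a2 k0; have G0 := gamma_law_gt0 hlaw.
pose c := k `^ alpha * expR (- 1) / Gamma (1 / 2 : K).
have c0 : 0 < c by rewrite divr_gt0// mulr_gt0 ?powR_gt0 ?expR_gt0.
have mk : measurable_fun setT (fun y : K => (k / y) `^ alpha).
  apply: (measurableT_comp (@measurable_powR K alpha)).
  by apply: measurable_funM => //; apply: measurable_fun_inv; exact: measurable_id.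
rewrite (ge0_integral_gamma_law hlaw (f := fun y => ((k / y) `^ alpha)%:E)); last 2 first.
- exact/measurable_EFinP.
- by move=> y; rewrite lee_fin powR_ge0.
have mden (D : set (measurableTypeR K)) : measurable_fun D
    (fun x : measurableTypeR K => (x `^ (1 / 2 - 1) * expR (- x) / Gamma (1 / 2 : K))%:E).
  apply: measurable_funTS; apply/measurable_EFinP; apply: measurable_funM => //.
  apply: measurable_funM; first exact: measurable_powR.
  by apply: measurableT_comp => //; exact: measurableT_comp.
have mkD (D : set (measurableTypeR K)) : measurable_fun D
    (fun y : measurableTypeR K => ((k / y) `^ alpha)%:E).
  by apply: measurable_funTS; exact/measurable_EFinP.
have minvD (D : set (measurableTypeR K)) : measurable_fun D
    (fun y : measurableTypeR K => (y^-1)%:E).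
  apply: measurable_funTS; apply/measurable_EFinP.
  by apply: measurable_fun_inv; exact: measurable_id.
have den0 (x : K) : (0 <= (x `^ (1 / 2 - 1) * expR (- x) / Gamma (1 / 2 : K))%:E)%E.
  by rewrite lee_fin divr_ge0 ?mulr_ge0 ?powR_ge0 ?expR_ge0 ?Gamma_ge0.
apply/eqP; rewrite -leye_eq.
have -> : +oo%E = (c%:E * \int[lebesgue_measure]_(s in `]0%R, 1%R]) (s^-1)%:E)%E.
  by rewrite integral_inv_itv01 gt0_muley ?lte_fin.
rewrite -ge0_integralZl//; last 2 first.
- by move=> s /=; rewrite in_itv/= => /andP[s0 _]; rewrite lee_fin invr_ge0 ltW.
- by rewrite lee_fin ltW.
apply: (@le_trans _ _ (\int[lebesgue_measure]_(x in `]0%R, 1%R])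
   (((k / x) `^ alpha)%:E * (x `^ (1 / 2 - 1) * expR (- x) / Gamma (1 / 2 : K))%:E)%E)%E).
  apply: ge0_le_integral => //.
  - move=> s /=; rewrite in_itv/= => /andP[s0 _].
    by rewrite mule_ge0// lee_fin ?invr_ge0 ltW.
  - by apply: emeasurable_funM.
  - by apply: emeasurable_funM.
  - move=> s /=; rewrite in_itv/= => /andP[s0 s1]; rewrite -!EFinM lee_fin.
    rewrite /c powRM ?(ltW k0) ?invr_ge0 ?(ltW s0)//.
    have -> : s^-1 `^ alpha = s `^ (- alpha).
      by rewrite -powR_inv1 ?ltW// -powRrM mulN1r.
    have h1 : s^-1 <= s `^ (- alpha) * s `^ (1 / 2 - 1).
      rewrite -powRD ?(gt_eqF s0) ?implybT// -[leLHS]powR_inv1 ?(ltW s0)//.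
      rewrite -ler_ln ?posrE ?powR_gt0// !ln_powR ler_wnM2r//.
        by rewrite ln_le0.
      by move: a2; lra.
    have h2 : expR (- 1) <= expR (- s) by rewrite ler_expR lerN2.
    have -> : k `^ alpha * s `^ (- alpha) *
       (s `^ (1 / 2 - 1) * expR (- s) / Gamma (1 / 2 : K)) =
       k `^ alpha * expR (- s) / Gamma (1 / 2 : K) * (s `^ (- alpha) * s `^ (1 / 2 - 1)).
      by ring.
    apply: ler_pM => //.
    + by rewrite ltW.
    + by rewrite invr_ge0 ltW.
    + by rewrite ler_pM2r ?invr_gt0// ler_pM2l ?powR_gt0.
apply: ge0_subset_integral => //.
- by apply: emeasurable_funM.
- by move=> s _; rewrite mule_ge0// lee_fin powR_ge0.
- by move=> s /=; rewrite !in_itv/= => /andP[->].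
Qed.

End fractional_moment.

(** By independence, integrate over [h] first: for almost every value of [g] the
    integral is already infinite. *)
Lemma cgmyV_moment (K : realType) (alpha G M : K) dg (Og : measurableType dg)
    (Pg : probability Og K) (g h : {RV Pg >-> K}) dV (OV : measurableType dV)
    (PV : probability OV K) (V : {RV PV >-> K}) :
  0 < alpha -> 0 < G -> 0 < M ->
  gamma_law Pg alpha g -> gamma_law Pg (1 / 2) h -> independent2 Pg g h ->
  eq_in_law PV V Pg (cgmyV G M g h) ->
  (\int[PV]_w (V w `^ alpha)%:E < +oo)%E -> alpha < 1 / 2.
Proof.
move=> alpha0 G0 M0 glaw hlaw gh Vlaw; rewrite ltNge => fin.
rewrite ltNge; apply/negP => a2; move: fin; apply/negP; rewrite negbK.
have mpow : measurable_fun setT (fun x : K => (x `^ alpha)%:E).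
  by apply/measurable_EFinP; exact: measurable_powR.
rewrite (ge0_integral_eq_in_law (f := fun x => (x `^ alpha)%:E) Vlaw mpow); last first.
  by move=> x; rewrite lee_fin powR_ge0.
have B0 : 0 < cgmyB G M by rewrite /cgmyB divr_gt0// addr_gt0.
pose b := cgmyB G M ^+ 2 / 2; have b0 : 0 < b by rewrite divr_gt0// exprn_gt0.
pose f (z : K * K) := ((b * z.1 / z.2) `^ alpha)%:E.
have mf : measurable_fun setT f.
  apply/measurable_EFinP; apply: (measurableT_comp (@measurable_powR K alpha)).
  apply: measurable_funM; first by apply: measurable_funM => //; exact: measurable_fst.
  by apply: measurable_fun_inv; exact: measurable_snd.
have f0 z : (0 <= f z)%E by rewrite lee_fin powR_ge0.
have gpos := gamma_law_positive glaw; have hpos := gamma_law_positive hlaw.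
apply: (@le_trans _ _ (\int[Pg]_w f (g w, h w))%E); last first.
  apply: ae_ge0_le_integral => //.
  - apply: (measurableT_comp mf); exact: measurable_fun_pair.
  - by move=> w _; rewrite lee_fin powR_ge0.
  - by apply: (measurableT_comp mpow); have [] := Vlaw.
  - move: hpos; apply: filterS2 gpos => w gw hw _; rewrite lee_fin.
    apply: ge0_ler_powR; rewrite ?nnegrE ?(ltW alpha0)//.
    + by apply: divr_ge0; [apply: mulr_ge0; exact: ltW|exact: ltW].
    + apply: divr_ge0 => //; apply: addr_ge0; first by apply: mulr_ge0; exact: ltW.
      by apply: mulr_ge0; [exact: sqr_ge0|apply: divr_ge0; exact: ltW].
    + rewrite /cgmyV mulrDl /b.
      have -> : cgmyB G M ^+ 2 / 2 * g w / h w = cgmyB G M ^+ 2 * (g w / h w) / 2.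
        by move: (h w)^-1 => x; ring.
      by rewrite lerDr; apply: divr_ge0 => //; apply: mulr_ge0; exact: ltW.
rewrite ge0_integral_independent2// leye_eq; apply/eqP.
rewrite -[RHS](_ : \int[Pg]_w (cst +oo w) = +oo)%E; last first.
  exact: integral_probability_cst.
apply: ge0_ae_eq_integral => //.
- pose F (z : Og * Og) := f (g z.1, h z.2).
  have mF : measurable_fun setT F.
    apply: (measurableT_comp mf); apply: measurable_fun_pair.
      exact: (measurableT_comp (measurable_funP g) measurable_fst).
    exact: (measurableT_comp (measurable_funP h) measurable_snd).
  exact: (measurable_fun_fubini_tonelli_F (m2 := Pg) F mF (fun z => f0 _)).
- by move=> w _; apply: integral_ge0.
- by move=> w _; rewrite leey.
- have e w : 0 < g w -> setT w -> (\int[Pg]_w' f (g w, h w') = cst +oo w)%E.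
    by move=> gw _; rewrite /f/= (gamma_half_moment_infty hlaw a2)// mulr_gt0.
  by move: gpos; apply: filterS => w gw; exact: e.
Qed.

(** * Finite Levy mass and the moment of V *)

(** With probability [e ^ (- rate)] there is no jump up to time [1], so that the
    Laplace transform of [X 1] stays above [e ^ (- rate)]; letting its argument
    tend to infinity bounds the mass of the Levy measure by [rate]. *)
Lemma compound_poisson_levy_mass (K : realType) d (O : measurableType d)
    (P : probability O K) (X : K -> O -> K) (nu : {measure set K -> \bar K}) :
  subordinator P X nu -> compound_poisson P X ->
  exists rate : K, (\int[nu]_(x in `]0%R, +oo[) 1 <= rate%:E)%E.
Proof.
move=> sX [rate [N [J [rate0 pN _ _ [_ XE]]]]]; exists rate.
have psi_le n : laplace_exponent nu n%:R <= rate.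
  have := subordinator_laplace sX ler01 (ler0n K n); rewrite mul1r => psiE.
  rewrite -lerN2 -ler_expR -lee_fin -psiE.
  pose A := N 1 @^-1` [set 0%N].
  have mA : measurable A.
    rewrite -[A]setTI; exact: (pp_measurable pN ler01).
  have PA : P A = (expR (- rate))%:E.
    have := pp_poisson pN (s := 0) (t := 1) _ 0%N; rewrite lexx ltr01 => /(_ isT).
    rewrite subr0 mulr1 /poisson_pmf rate0 expr0 fact0 invr1 !mul1r => <-.
    by congr (P _); apply/seteqP; split => w /=; rewrite (pp_start pN).
  rewrite -PA -(setIT A) -(integral_indic _ measurableT mA).
  apply: ge0_le_integral => //.
  - by apply/measurable_EFinP; exact: measurable_indic.
  - by apply/measurable_EFinP; exact: (measurable_laplace sX).
  - move=> w _; rewrite lee_fin indicE; have [|_] := boolP (w \in A); last exact: expR_ge0.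
    by rewrite inE /A/= => N0; rewrite XE// N0 big_ord0 mulr0 oppr0 expR0.
pose f n (x : K) := (1 - expR (- (n%:R * x)))%:E : \bar K.
have fcvg : (\int[nu]_(x in `]0%R, +oo[) f n x @[n --> \oo] -->
    \int[nu]_(x in `]0%R, +oo[) 1)%E.
  rewrite [X in _ --> X](_ : _ = \int[nu]_(x in `]0%R, +oo[) limn (f ^~ x))%E; last first.
    apply: eq_integral => x; rewrite inE/= in_itv/= andbT => x0; apply/esym/cvg_lim => //.
    apply: cvg_EFin; first exact: nearW.
    rewrite -[X in _ --> X]subr0; apply: cvgB; first exact: cvg_cst.
    under eq_fun do rewrite -mulrN expRM_natl.
    by apply: cvg_expr; rewrite ger0_norm ?expR_ge0// expR_lt1 oppr_lt0.
  apply: cvg_monotone_convergence => //.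
  - by move=> n; apply/measurable_EFinP; exact: measurable_one_minus_expR.
  - move=> n x /=; rewrite in_itv/= andbT => x0.
    by rewrite lee_fin one_minus_expR_ge0// ltW.
  - move=> x /=; rewrite in_itv/= andbT => x0 m n mn.
    by rewrite lee_fin lerD2l lerN2 ler_expR lerN2 ler_wpM2r ?ler_nat// ltW.
apply: (cvge_le _ fcvg); apply: nearW => n.
by rewrite -(laplace_exponentE sX (ler0n K n)) lee_fin psi_le.
Qed.

Section moment_of_finite_levy_mass.
Context (K : realType) (alpha : K) d (O : measurableType d) (P : probability O K)
  (X : O -> K).
Hypotheses (alpha0 : 0 < alpha) (mX : measurable_fun setT X) (X0 : ae_positive P X).

(** On [0 < s <= 1 / x], an interval of length [1 / x], the first factor is at
    least [x ^ alpha] and the exponential at least [e ^ (- 1)]. *)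
Lemma integral_stable_tilt_ge (x : K) : 0 <= x ->
  ((x `^ alpha * expR (- 1))%:E <= \int[lebesgue_measure]_(s in `]0%R, +oo[)
     (s `^ (- alpha) * (x * expR (- (s * x))))%:E)%E.
Proof.
rewrite le_eqVlt => /predU1P[<-|x0].
  rewrite powR0 ?gt_eqF// mul0r; apply: integral_ge0 => s _.
  by rewrite lee_fin mul0r mulr0.
have mf (D : set (measurableTypeR K)) : measurable_fun D (fun s : measurableTypeR K =>
    (s `^ (- alpha) * (x * expR (- (s * x))))%:E).
  apply: measurable_funTS; apply/measurable_EFinP; apply: measurable_funM.
    exact: measurable_powR.
  apply: measurable_funM => //; apply: measurableT_comp => //.
  by apply: measurableT_comp => //; exact: measurable_funM.
apply: (@le_trans _ _ (\int[lebesgue_measure]_(s in `]0%R, x^-1%R])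
    (s `^ (- alpha) * (x * expR (- (s * x))))%:E)%E); last first.
  apply: ge0_subset_integral => //.
  - by move=> s _; rewrite lee_fin mulr_ge0 ?powR_ge0// mulr_ge0 ?expR_ge0// ltW.
  - by move=> s /=; rewrite !in_itv/= => /andP[->].
rewrite [X in (X <= _)%E](_ : _ = \int[lebesgue_measure]_(s in `]0%R, x^-1%R])
    (cst (x `^ alpha * (x * expR (- 1)))%:E s))%E; last first.
  rewrite integral_cst//= lebesgue_measure_itv/= lte_fin invr_gt0 x0 -EFinD subr0 -EFinM.
  by congr EFin; rewrite -mulrA; congr (_ * _); rewrite mulrAC mulfV ?mul1r// gt_eqF.
apply: ge0_le_integral => //.
- by move=> s _; rewrite lee_fin mulr_ge0 ?powR_ge0// mulr_ge0 ?expR_ge0// ltW.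
- move=> s /=; rewrite in_itv/= => /andP[s0 sx]; rewrite lee_fin.
  have sx1 : s * x <= 1 by rewrite -ler_pdivlMr// div1r.
  apply: ler_pM.
  + exact: powR_ge0.
  + by rewrite mulr_ge0 ?expR_ge0// ltW.
  + rewrite -ler_ln ?posrE ?powR_gt0// !ln_powR mulNr -mulrN ler_wpM2l ?(ltW alpha0)//.
    by rewrite lerNr -lnV ?posrE// ler_ln ?posrE ?invr_gt0.
  + by rewrite ler_wpM2l ?(ltW x0)// ler_expR lerN2.
Qed.

Lemma fractional_moment_lty (nu : {measure set K -> \bar K}) :
  levy_density nu
    (fun s => s `^ (- alpha) * expect P (fun w => X w * expR (- (s * X w)))) ->
  (\int[nu]_(x in `]0%R, +oo[) 1 < +oo)%E ->
  (\int[P]_w (Num.max 0 (X w) `^ alpha)%:E < +oo)%E.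
Proof.
move=> nuE; rewrite (levy_density_integral (f := cst 1) nuE)// => fin.
pose Xp w := Num.max 0 (X w).
have Xp0 w : 0 <= Xp w by rewrite le_max lexx.
have mXp : measurable_fun setT Xp by exact: measurable_maxr.
pose H (z : measurableTypeR K * O) : \bar K := (\1_(`]0, +oo[%classic : set K) z.1 *
  (z.1 `^ (- alpha) * (Xp z.2 * expR (- (z.1 * Xp z.2)))))%:E.
have H0 z : (0 <= H z)%E.
  by rewrite lee_fin !mulr_ge0 ?powR_ge0 ?expR_ge0// indicE.
have mH : measurable_fun setT H.
  have m1 := @measurable_fst _ _ (measurableTypeR K) O.
  have m2 : measurable_fun setT (fun z : measurableTypeR K * O => Xp z.2).
    exact: (measurableT_comp mXp measurable_snd).
  apply/measurable_EFinP; apply: measurable_funM.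
    by apply: (measurableT_comp _ m1); exact: measurable_indic.
  apply: measurable_funM; first exact: (measurableT_comp (measurable_powR _) m1).
  apply: measurable_funM => //; apply: measurableT_comp => //.
  by apply: measurableT_comp => //; exact: measurable_funM.
have HE : (\int[P]_w \int[lebesgue_measure]_s H (s, w) < +oo)%E.
  rewrite -(fubini_tonelli (m1 := lebesgue_measure) (m2 := P) H mH H0).
  rewrite [X in (X < _)%E](_ : _ = \int[lebesgue_measure]_(s in `]0%R, +oo[)
      (cst 1 s * (s `^ (- alpha) * expect P (fun w => X w * expR (- (s * X w)))))%:E)%E//.
  rewrite [RHS]integral_mkcond; apply: eq_integral => s _.
  rewrite patchE /H/= indicE; case: ifPn => [|_]; last first.
    by under eq_integral do rewrite mul0r; rewrite integral0.
  rewrite inE/= in_itv/= andbT => s0; rewrite mul1r EFinM (expect_mul_expR mX X0 s0).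
  rewrite -ge0_integralZl//.
  - by apply: eq_integral => w _; rewrite mul1r EFinM.
  - apply/measurable_EFinP; apply: measurable_funM => //.
    apply: measurableT_comp => //; apply: measurableT_comp => //.
    exact: measurable_funM.
  - by move=> w _; rewrite lee_fin; apply: mulr_ge0; [exact: Xp0|exact: expR_ge0].
  - by rewrite lee_fin powR_ge0.
have e0 : 0 < expR (- 1) :> K by exact: expR_gt0.
have : ((expR (- 1))%:E * \int[P]_w (Xp w `^ alpha)%:E < +oo)%E.
  apply: le_lt_trans HE; rewrite -ge0_integralZl//; last 2 first.
  - by apply/measurable_EFinP; exact: (measurableT_comp (measurable_powR _) mXp).
  - by move=> w _; rewrite lee_fin powR_ge0.
  apply: ge0_le_integral => //.
  - by move=> w _; rewrite -EFinM lee_fin mulr_ge0 ?powR_ge0// ltW.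
  - apply: emeasurable_funM => //.
    by apply/measurable_EFinP; exact: (measurableT_comp (measurable_powR _) mXp).
  - exact: (measurable_fun_fubini_tonelli_G (m1 := lebesgue_measure) H mH H0).
  - move=> w _; rewrite -EFinM mulrC.
    apply: (le_trans (integral_stable_tilt_ge (Xp0 w))).
    rewrite le_eqVlt; apply/orP; left; apply/eqP.
    rewrite [LHS]integral_mkcond; apply: eq_integral => s _.
    by rewrite patchE /H/= indicE; case: ifPn => _; rewrite ?mul1r ?mul0r.
have [//|] := ltP (\int[P]_w (Xp w `^ alpha)%:E)%E +oo%E.
rewrite leye_eq => /eqP ->; by rewrite gt0_muley ?lte_fin.
Qed.

End moment_of_finite_levy_mass.

(** The weight [Y ^ alpha] of the biased law cancels the denominator of
    [(V / Y) ^ alpha]. *)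
Lemma fractional_moment_ratio (K : realType) (alpha : K)
    dV (OV : measurableType dV) (PV : probability OV K) (V Ya : {RV PV >-> K})
    dR (OR : measurableType dR) (PR : probability OR K) (Y : {RV PR >-> K}) :
  ae_positive PV V -> ae_positive PR Y -> power_biased PR Y alpha PV Ya ->
  independent2 PV V Ya ->
  ((expect PR (fun w => Y w `^ alpha))%:E *
     \int[PV]_w (Num.max 0 (V w / Ya w) `^ alpha)%:E =
   \int[PV]_w (V w `^ alpha)%:E)%E.
Proof.
move=> V0 Y0 bias indep; have [c0 _] := power_biased_moment bias.
pose f (z : K * K) : \bar K := (Num.max 0 (z.1 / z.2) `^ alpha)%:E.
have mf : measurable_fun setT f.
  apply/measurable_EFinP; apply: (measurableT_comp (measurable_powR _)).
  apply: measurable_maxr => //; apply: measurable_funM; first exact: measurable_fst.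
  by apply: measurable_fun_inv; exact: measurable_snd.
have f0 z : (0 <= f z)%E by rewrite lee_fin powR_ge0.
rewrite (ge0_integral_independent2 indep mf f0).
pose F (z : OV * OV) := f (V z.1, Ya z.2).
have mF : measurable_fun setT F.
  apply: (measurableT_comp mf); apply: measurable_fun_pair.
    exact: (measurableT_comp (measurable_funP V) measurable_fst).
  exact: (measurableT_comp (measurable_funP Ya) measurable_snd).
have mI : measurable_fun setT (fun v => \int[PV]_w F (v, w))%E.
  exact: (measurable_fun_fubini_tonelli_F (m2 := PV) F mF (fun z => f0 _)).
rewrite -ge0_integralZl//; last 2 first.
- by move=> w _; apply: integral_ge0.
- by rewrite lee_fin ltW.
apply: ge0_ae_eq_integral => //.
- exact: emeasurable_funM.
- by apply/measurable_EFinP; exact: (measurableT_comp (measurable_powR _)).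
- by move=> w _; rewrite mule_ge0// ?lee_fin ?(ltW c0)//; exact: integral_ge0.
- by move=> w _; rewrite lee_fin powR_ge0.
have e v : 0 < V v -> setT v -> ((expect PR (fun w => Y w `^ alpha))%:E *
    \int[PV]_w f (V v, Ya w) = (V v `^ alpha)%:E)%E.
  move=> Vv _; rewrite (ge0_integral_power_biased bias (f := fun y => f (V v, y))) => [||y].
  - transitivity (\int[PR]_w (cst (V v `^ alpha)%:E w))%E; last first.
      exact: integral_probability_cst.
    apply: ge0_ae_eq_integral => //.
    + apply: emeasurable_funM.
        apply: (measurableT_comp mf); exact: measurable_fun_pair.
      by apply/measurable_EFinP; exact: (measurableT_comp (measurable_powR _)).
    + by move=> w _; rewrite mule_ge0// lee_fin powR_ge0.
    + by move=> w _; rewrite lee_fin powR_ge0.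
    + have e' w : 0 < Y w -> setT w ->
          (f (V v, Y w) * (Y w `^ alpha)%:E = cst (V v `^ alpha)%:E w)%E.
        move=> Yw _; rewrite /f/= -EFinM max_r; last by apply: divr_ge0; exact: ltW.
        by rewrite -powRM ?divfK ?gt_eqF//; [apply: divr_ge0; exact: ltW|exact: ltW].
      by move: Y0; apply: filterS => w Yw; exact: e'.
  - by apply: (measurableT_comp mf); exact: measurable_fun_pair.
  - exact: f0.
by move: V0; apply: filterS => v Vv; exact: e.
Qed.

(** * The case where Y is the constant 1 *)

Lemma rho_L_unbiased (K : realType) (alpha delta G M : K)
    dg (Og : measurableType dg) (Pg : probability Og K) (g h : {RV Pg >-> K})
    dV (OV : measurableType dV) (PV : probability OV K) (V Ya : {RV PV >-> K})
    dR (OR : measurableType dR) (PR : probability OR K) (Y : {RV PR >-> K}) (s : K) :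
  0 < alpha -> 0 < delta -> 0 < G -> 0 < M ->
  gamma_law Pg alpha g -> gamma_law Pg (1 / 2) h ->
  eq_in_law PV V Pg (cgmyV G M g h) ->
  {ae PR, forall w, Y w = 1} -> power_biased PR Y alpha PV Ya ->
  independent2 PV V Ya -> 0 < s ->
  rho_L alpha delta (expect PR (fun w => Y w `^ alpha)) PV V Ya s =
  rho_Z alpha delta G M Pg g h PV V s.
Proof.
move=> alpha0 delta0 G0 M0 glaw hlaw Vlaw Y1 bias indep s0.
have V0 := cgmyV_positive G0 M0 glaw hlaw Vlaw.
have Y0 : ae_positive PR Y by move: Y1; apply: filterS => w ->.
apply: EFin_inj; rewrite (rho_L_mixture alpha0 delta0 V0 Y0 bias indep s0).
have inner v : (\int[PR]_w ((Y w `^ alpha)%:E *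
    (mixture_kernel alpha delta s (V v / Y w))%:E) = (mixture_kernel alpha delta s (V v))%:E)%E.
  transitivity (\int[PR]_w (cst (mixture_kernel alpha delta s (V v))%:E w))%E; last first.
    exact: integral_probability_cst.
  apply: ge0_ae_eq_integral => //.
  - apply: emeasurable_funM.
      by apply/measurable_EFinP; exact: (measurableT_comp (measurable_powR _)).
    apply/measurable_EFinP; apply: measurable_mixture_kernel => //.
    by apply: measurable_funM => //; exact: measurable_fun_inv.
  - by move=> w _; rewrite mule_ge0// lee_fin ?powR_ge0// mixture_kernel_ge0.
  - by move=> w _; rewrite lee_fin mixture_kernel_ge0.
  - by move: Y1; apply: filterS => w -> _; rewrite powR1 mul1e divr1.
under eq_integral do rewrite inner.
rewrite -(expect_mixture_kernel _ V0 s0 alpha0 delta0)// -EFinM; congr EFin.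
rewrite /rho_Z (rho_zetaE alpha Vlaw); ring.
Qed.

Lemma eq_levy_density (K : realType) (nu : {measure set K -> \bar K}) (rho rho' : K -> K) :
  (forall s, 0 < s -> rho s = rho' s) -> levy_density nu rho -> levy_density nu rho'.
Proof.
move=> E [mrho rho0 nuE]; split.
- apply: eq_measurable_fun mrho => s; rewrite inE/= in_itv/= andbT => s0; exact: E.
- by move=> s s0; rewrite -E// rho0.
- move=> A mA; rewrite nuE//; apply: eq_integral => s.
  by rewrite inE => -[_ /=]; rewrite in_itv/= andbT => s0; rewrite E.
Qed.

(** * Quantile-clock representation of the CGMY law *)

Theorem proposition8p1 (K : realType)
  (alpha delta G M : K)
  (alpha01 : 0 < alpha < 1) (G0 : 0 < G) (M0 : 0 < M) (delta0 : 0 < delta)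
  (* the gamma variables, and V with an independent Y_alpha *)
  (dg : measure_display) (Og : measurableType dg) (Pg : probability Og K)
  (gam_alpha gam_half : {RV Pg >-> K})
  (gam_alpha_law : gamma_law Pg alpha gam_alpha)
  (gam_half_law : gamma_law Pg (1 / 2) gam_half)
  (gam_indep : independent2 Pg gam_alpha gam_half)
  (dV : measure_display) (OV : measurableType dV) (PV : probability OV K)
  (V Y_alpha : {RV PV >-> K})
  (V_law : eq_in_law PV V Pg (cgmyV G M gam_alpha gam_half))
  (dC : measure_display) (OC : measurableType dC) (PC : probability OC K)
  (chi_CGMY : K -> OC -> K)
  (chi_CGMY_process : cgmy_process alpha G M Pg gam_alpha gam_half PC chi_CGMY)
  (* R and Y *)
  (dR : measure_display) (OR : measurableType dR) (PR : probability OR K)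
  (R Y : {RV PR >-> K})
  (Y_pos : ae_positive PR Y)
  (RY_indep : independent2 PR R Y)
  (RY_law : eq_in_law PR (fun w => R w * Y w)
              (uniform_prob (@ltr01 K)) (fun u => u `^ delta^-1))
  (Y_alpha_law : power_biased PR Y alpha PV Y_alpha)
  (Y_alpha_indep : independent2 PV V Y_alpha)
  (* the quantile clock T and the independent Brownian motion *)
  (d : measure_display) (O : measurableType d) (P : probability O K)
  (L T W : K -> O -> K) (nu_L : {measure set K -> \bar K})
  (T_clock : quantile_clock PR P R L nu_L T)
  (W_bm : brownian_motion P W)
  (W_T_indep : independent_processes P W T)
  (L_density : levy_density nu_L
    (rho_L alpha delta (expect PR (fun w => Y w `^ alpha)) PV V Y_alpha)) :
  (forall t, 0 <= t ->
     eq_in_law P (fun w => drifted W (cgmyA G M) (T t w) w)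
               PC (chi_CGMY t))
  /\ ({ae PR, forall w, Y w = 1} ->
      (forall s, 0 < s ->
         rho_L alpha delta (expect PR (fun w => Y w `^ alpha)) PV V Y_alpha s =
         rho_Z alpha delta G M Pg gam_alpha gam_half PV V s)
      /\ levy_density nu_L
           (rho_Z alpha delta G M Pg gam_alpha gam_half PV V))
  /\ (('E_PV[(fun w => V w `^ alpha)%R] < +oo)%E -> alpha < 1 / 2)
  /\ (compound_poisson_levy_density
        (fun s => s `^ (- alpha) *
           expect PV (fun w => V w / Y_alpha w
                               * expR (- (s * (V w / Y_alpha w))))) ->
      alpha < 1 / 2).
Proof.
have [alpha0 _] := andP alpha01.
have V0 := cgmyV_positive G0 M0 gam_alpha_law gam_half_law V_law.
have moment := cgmyV_moment alpha0 G0 M0 gam_alpha_law gam_half_law gam_indep V_law.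
have rhoE (Y1 : {ae PR, forall w, Y w = 1}) s (s0 : 0 < s) :=
  rho_L_unbiased alpha0 delta0 G0 M0 gam_alpha_law gam_half_law V_law Y1
    Y_alpha_law Y_alpha_indep s0.
split; [|split; [|split]].
- move=> t t0; have [zeta [W' [nu [sZ nuE bW' iW' chiE]]]] := chi_CGMY_process.
  rewrite (_ : chi_CGMY t = fun w => drifted W' (cgmyA G M) (zeta t w) w); last first.
    by apply/funext => w; rewrite chiE.
  apply: eq_in_law_brownian_time_change => //.
  + apply: (clock_eq_in_law T_clock sZ t0) => theta theta0.
    exact: (mean_laplace_exponent alpha0 delta0 G0 M0 gam_alpha_law gam_half_law V_law
      (qc_positive T_clock) Y_pos RY_indep RY_law Y_alpha_law Y_alpha_indep
      (qc_subordinator T_clock) L_density sZ nuE theta0).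
  + by move=> w; exact: (clock_ge0 T_clock).
  + by move=> w; exact: (subordinator_ge0 sZ).
  + by move=> s s0; exact: independent_processes_marginals.
  + by move=> s s0; exact: independent_processes_marginals.
- move=> Y1; split; first exact: rhoE.
  exact: eq_levy_density (rhoE Y1) L_density.
- by rewrite unlock; exact: moment.
- move=> [dX [OX [PX [X [nu [sX cX nuE]]]]]]; apply: moment.
  have [c0 _] := power_biased_moment Y_alpha_law.
  have [rate rateE] := compound_poisson_levy_mass sX cX.
  rewrite -(fractional_moment_ratio V0 Y_pos Y_alpha_law Y_alpha_indep).
  rewrite lte_mul_pinfty ?lee_fin ?(ltW c0)//.
  apply: (fractional_moment_lty alpha0 _ _ nuE).
  + exact: measurable_ratio.
  + exact: (ratio_positive V0 Y_pos Y_alpha_law).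
  + by rewrite (le_lt_trans rateE)// ltry.
Qed.
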